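(* Let $A=T(V)/(R)$ be a Koszul Artin-Schelter regular algebra of dimension $d$ with Nakayama automorphism $\mu_A$, let $\overline{\sigma}$ be a graded automorphism of $A$ with $\sigma=\overline{\sigma}|_V$, let $\overline{\delta}$ be a degree-one $\overline{\sigma}$-derivation of $A$, and let $\omega$ be a basis of $W_d$. Let $(\{\delta_{i,r}\},\{\delta_{i,l}\})$ and $(\{\delta'_{i,r}\},\{\delta'_{i,l}\})$ be two sequence pairs for $\overline{\delta}$, and let $(\delta_r,\delta_l)$ and $(\delta'_r,\delta'_l)$ be the pairs of elements of $V$ determined by $\delta_{d,r}(\omega)=\omega\otimes\delta_r$, $\delta_{d,l}(\omega)=\delta_l\otimes\omega$, $\delta'_{d,r}(\omega)=\omega\otimes\delta'_r$, $\delta'_{d,l}(\omega)=\delta'_l\otimes\omega$. Then $$\delta_r+\mu_A\sigma^{-1}(\delta_l)=\delta'_r+\mu_A\sigma^{-1}(\delta'_l).$$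
   Context: Everything is over a field $k$, $\otimes=\otimes_k$. $V$ is a finite-dimensional vector space with basis $x_1,\dots,x_n$, $T(V)$ is the tensor algebra graded by tensor length, $R\subseteq V\otimes V$ is a subspace, $A=T(V)/(R)$, $\pi_A:T(V)\to A$ is the projection, and $V$ is identified with $A_1$. $A$ is Koszul if the trivial right graded module $k_A$ has a minimal graded free resolution whose $i$-th term is generated in degree $i$ for all $i\ge 0$. Put $W_0=k$, $W_1=V$, $W_2=R$, $W_i=\bigcap_{0\le s\le i-2}V^{\otimes s}\otimes R\otimes V^{\otimes i-s-2}$ for $i\ge 3$. A connected graded algebra $C$ is Artin-Schelter (AS-)regular of dimension $d$ if it has finite global dimension $d$, $\dim\underline{\mathrm{Ext}}^d_C(k_C,C_C)=1$ and $\underline{\mathrm{Ext}}^i_C(k_C,C_C)=0$ for $i\ne d$. Its Nakayama automorphism is the unique graded automorphism $\mu_C$ such that $\underline{\mathrm{Ext}}^d_{C^e}(C,C^e)\cong C^{\mu_C}(l)$ as graded $C$-bimodules for some $l\geq 0$ (and $\underline{\mathrm{Ext}}^i_{C^e}(C,C^e)=0$ for $i\neq d$), where $C^e=C\otimes C^{op}$ and $C^{\mu}$ is $C$ with action $a\cdot x\cdot b=ax\mu(b)$. If $A$ is Koszul AS-regular of dimension $d$ then $\dim W_d=1$ and $W_i=0$ for $i>d$. A degree-one $\overline{\sigma}$-derivation is a linear map $\overline{\delta}:A\to A$ with $\overline{\delta}(A_i)\subseteq A_{i+1}$ and $\overline{\delta}(ab)=\overline{\sigma}(a)\overline{\delta}(b)+\overline{\delta}(a)b$.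 $B=A[z;\overline{\sigma},\overline{\delta}]$ is the graded Ore extension with $\deg z=1$, $za=\overline{\sigma}(a)z+\overline{\delta}(a)$. Let $m_B$ be the multiplication map $V\otimes B\to B$ (restricting to $V\otimes V\to B$). Sequence pair for $\overline{\delta}$: choose a linear map $\delta:V\to V\otimes V$ with $\pi_A\delta=\overline{\delta}|_V$. A sequence pair $(\{\delta_{i,r}\}_{i\ge1},\{\delta_{i,l}\}_{i\ge1})$ for $\overline{\delta}$ consists of linear maps $\delta_{i,r}:W_i\to W_i\otimes V$ and $\delta_{i,l}:W_i\to V\otimes W_i$ with $\delta_{1,r}=\delta_{1,l}=\delta$ such that, with $\delta_{0,r}=\delta_{0,l}=0$, (1) for $i\ge2$, on $W_i$: $(\mathrm{id}_V^{\otimes i-1}\otimes m_B)\delta_{i,r}=(\mathrm{id}_V^{\otimes i-1}\otimes m_B)(\sigma^{\otimes i-1}\otimes\delta+\delta_{i-1,r}\otimes\mathrm{id}_V)$; (2) for $i\ge1$, on $W_i$: $\delta_{i,r}+(-1)^i\delta_{i,l}=\sigma\otimes\delta_{i-1,r}+(-1)^i\delta_{i-1,l}\otimes\mathrm{id}_V$. Different sequence pairs for $\overline{\delta}$ may be constructed from different maps $\delta$. *)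

(* Defs.v *)
From HB Require Import structures.
From mathcomp Require Import all_boot all_order all_algebra.
From mathcomp.finmap Require Import finmap.
From mathcomp.multinomials Require Import monalg.

Set Implicit Arguments.
Unset Strict Implicit.
Unset Printing Implicit Defensive.

Import GRing.Theory.
Local Open Scope ring_scope.

Definition is_grading (M : zmodType) (D : int -> M -> Prop) : Prop :=
  [/\ forall i, D i 0,
      forall i x y, D i x -> D i y -> D i (x - y),
      forall x, exists (s : seq int) (F : int -> M),
        (forall i, D i (F i)) /\ x = \sum_(i <- s) F i
    & forall (s : seq int) (F : int -> M), uniq s -> (forall i, D i (F i)) ->
        \sum_(i <- s) F i = 0 -> forall i, i \in s -> F i = 0].

Section Modules.
Variable R : nzRingType.

(* As usual in MathComp, modules are left modules; right modules over a ring  *)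
(* C are modules over the converse ring C^c.                                  *)

Definition graded_module (RD : int -> R -> Prop)
    (M : lmodType R) (D : int -> M -> Prop) : Prop :=
  is_grading D /\ forall i j a x, RD i a -> D j x -> D (i + j) (a *: x).

Definition is_basis (M : lmodType R) (I : eqType) (b : I -> M) : Prop :=
  (forall x, exists (s : seq I) (a : I -> R), x = \sum_(i <- s) a i *: b i) /\
  (forall (s : seq I) (a : I -> R), uniq s ->
     \sum_(i <- s) a i *: b i = 0 -> forall i, i \in s -> a i = 0).

Definition projective (P : lmodType R) : Prop :=
  forall (X Y : lmodType R) (g : {linear X -> Y}) (f : {linear P -> Y}),
    (forall y, exists x, g x = y) ->
    exists h : {linear P -> X}, forall p, g (h p) = f p.

Record proj_resolution (M : lmodType R) := ProjResolution {
  pr_term :> nat -> lmodType R;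
  pr_diff : forall i, {linear pr_term i.+1 -> pr_term i};
  pr_aug : {linear pr_term 0 -> M};
  pr_proj : forall i, projective (pr_term i);
  pr_surj : forall m, exists p, pr_aug p = m;
  pr_exact0 : forall p, pr_aug p = 0 <-> exists q, p = pr_diff 0 q;
  pr_exactS : forall i (p : pr_term i.+1),
    pr_diff i p = 0 <-> exists q, p = pr_diff i.+1 q
}.

Definition pd_le (M : lmodType R) (d : nat) : Prop :=
  exists P : proj_resolution M, forall i, (d < i)%N -> forall x : P i, x = 0.

Definition gldim (d : nat) : Prop :=
  (forall M : lmodType R, pd_le M d) /\
  (forall e, (e < d)%N -> ~ forall M : lmodType R, pd_le M e).

Section Graded.
Variables (RD : int -> R -> Prop) (M : lmodType R) (MD : int -> M -> Prop).

Definition graded_resolution (P : proj_resolution M)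
    (PD : forall i, int -> P i -> Prop) : Prop :=
  [/\ forall i, graded_module RD (PD i),
      forall i m x, PD i.+1 m x -> PD i m (pr_diff P i x)
    & forall m x, PD 0%N m x -> MD m (pr_aug P x)].

(* The i-th term is graded free and generated in degree i, that is, free on a *)
(* basis in degree i; minimality means that the image of each differential    *)
(* lies in the span of the multiples by elements of positive degree.          *)
Definition linear_minimal_free (P : proj_resolution M)
    (PD : forall i, int -> P i -> Prop) : Prop :=
  (forall i, exists (I : eqType) (b : I -> P i),
     is_basis b /\ forall j, PD i i%:Z (b j)) /\
  (forall i (x : P i.+1), exists s : seq (R * P i),
     (forall p, p \in s -> exists2 m : int, 0 < m & RD m p.1) /\
     pr_diff P i x = \sum_(p <- s) p.1 *: p.2).

(* The cohomology of the complex of graded homomorphisms Hom(P, N), that is   *)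
(* Ext(M, N); homomorphisms are plain functions satisfying graded_hom, and    *)
(* are compared pointwise.                                                    *)
Section Ext.
Variables (P : proj_resolution M) (PD : forall i, int -> P i -> Prop).
Variables (N : lmodType R) (ND : int -> N -> Prop).

Definition hom_degree i (j : int) (f : P i -> N) : Prop :=
  linear f /\ forall m x, PD m x -> ND (m + j) (f x).

Definition graded_hom i (f : P i -> N) : Prop :=
  exists (s : seq int) (F : int -> P i -> N),
    (forall j, hom_degree j (F j)) /\ forall x, f x = \sum_(j <- s) F j x.

Definition cocycle i (f : P i -> N) : Prop :=
  graded_hom f /\ forall x, f (pr_diff P i x) = 0.

Definition coboundary i : (P i -> N) -> Prop :=
  match i with
  | 0 => fun f => forall x, f x = 0
  | j.+1 => fun f => exists g : P j -> N,
      graded_hom g /\ forall x, f x = g (pr_diff P j x)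
  end.

Definition Ext_vanishes i : Prop :=
  forall f : P i -> N, cocycle f -> coboundary f.

End Ext.
End Graded.
End Modules.

Record connected_algebra (k : fieldType) := ConnectedAlgebra {
  ca_sort :> algType k;
  ca_gr : int -> ca_sort -> Prop;
  ca_grading : is_grading ca_gr;
  ca_mul : forall i j a b, ca_gr i a -> ca_gr j b -> ca_gr (i + j) (a * b);
  ca_neg : forall i a, i < 0 -> ca_gr i a -> a = 0;
  ca_gr0 : forall a, ca_gr 0 a <-> exists c : k, a = c%:A;
  ca_eps : {lrmorphism ca_sort -> k^o};
  ca_epsP : forall i a, 0 < i -> ca_gr i a -> ca_eps a = 0
}.

Record graded_auto (k : fieldType) (C : connected_algebra k) := GradedAuto {
  gau :> {lrmorphism C -> C};
  gau_inv : C -> C;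
  gauK : cancel gau gau_inv;
  gau_invK : cancel gau_inv gau;
  gau_gr : forall i a, ca_gr i a -> ca_gr i (gau a)
}.

Definition trivial_module (k : fieldType) (C : connected_algebra k) : Type := k.

Section TrivialModule.
Variables (k : fieldType) (C : connected_algebra k).

HB.instance Definition _ := GRing.Zmodule.copy (trivial_module C) k.

Definition triv_scale (a : C^c) (x : trivial_module C) : trivial_module C :=
  (x : k) * ca_eps C a.

Fact triv_scaleA a b v :
  triv_scale a (triv_scale b v) = triv_scale (a * b) v.
Proof. by rewrite /triv_scale rmorphM mulrA. Qed.

Fact triv_scale1 : left_id 1 triv_scale.
Proof. by move=> v; rewrite /triv_scale rmorph1 mulr1. Qed.

Fact triv_scaleDr : right_distributive triv_scale +%R.
Proof. by move=> a u v; rewrite /triv_scale mulrDl. Qed.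

Fact triv_scaleDl v : {morph triv_scale^~ v : a b / a + b}.
Proof. by move=> a b; rewrite /triv_scale rmorphD mulrDr. Qed.

HB.instance Definition _ := GRing.Zmodule_isLmodule.Build C^c (trivial_module C)
  triv_scaleA triv_scale1 triv_scaleDr triv_scaleDl.

Definition triv_gr (i : int) (x : trivial_module C) : Prop := i = 0 \/ x = 0.

End TrivialModule.

Section KoszulAS.
Variables (k : fieldType) (C : connected_algebra k).

Let gr : int -> C^c -> Prop := @ca_gr k C.

Definition Koszul : Prop :=
  exists (P : proj_resolution (trivial_module C))
         (PD : forall i, int -> P i -> Prop),
    graded_resolution gr (@triv_gr k C) PD /\ linear_minimal_free gr PD.

(* Modules over C^c being right C-modules, (C^c)^o is C_C. Ext(k_C, C_C) may  *)
(* be computed from any graded projective resolution P of k_C.                *)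
Definition AS_regular (d : nat) : Prop :=
  gldim C^c d /\
  forall (P : proj_resolution (trivial_module C))
         (PD : forall i, int -> P i -> Prop),
    graded_resolution gr (@triv_gr k C) PD ->
    let cocyc i := @cocycle _ _ P PD (C^c)^o gr i in
    let cobound i := @coboundary _ _ P PD (C^c)^o gr i in
    (forall i, i <> d -> @Ext_vanishes _ _ P PD (C^c)^o gr i) /\
    exists e : P d -> C,
      [/\ cocyc d e, ~ cobound d e
        & forall f : P d -> C, cocyc d f ->
            exists c : k, cobound d (fun x => f x - c *: e x)].

End KoszulAS.

Definition bilinear_map (k : fieldType) (M N Q : lmodType k)
    (f : M -> N -> Q) : Prop :=
  (forall x, linear (f x)) /\ (forall y, linear (f^~ y)).

(* C^e: the tensor product of C and C^op, given by its universal property,    *)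
(* with env_tens a b standing for the pure tensor of a and b.                 *)
Record enveloping_algebra (k : fieldType) (C : algType k) := EnvelopingAlgebra {
  env_sort :> algType k;
  env_tens : C -> C -> env_sort;
  env_bilin : bilinear_map env_tens;
  env_lift : forall (Q : lmodType k) (f : C -> C -> Q),
    bilinear_map f -> {linear env_sort -> Q};
  env_liftE : forall (Q : lmodType k) (f : C -> C -> Q) (hf : bilinear_map f)
    a b, env_lift hf (env_tens a b) = f a b;
  env_ext : forall (Q : lmodType k) (g h : env_sort -> Q),
    linear g -> linear h ->
    (forall a b, g (env_tens a b) = h (env_tens a b)) -> g =1 h;
  env_1 : env_tens 1 1 = 1;
  env_M : forall a b a' b',
    env_tens a b * env_tens a' b' = env_tens (a * a') (b' * b)
}.

Definition env_module (k : fieldType) (C : algType k)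
  (Ce : enveloping_algebra C) : Type := C.

Section EnvModule.
Variables (k : fieldType) (C : algType k) (Ce : enveloping_algebra C).

HB.instance Definition _ := GRing.Zmodule.copy (env_module Ce) C.

Fact sandwich_bilin (x : C) : bilinear_map (fun a b : C => a * x * b).
Proof.
split=> [a|b] c u v; first by rewrite mulrDr scalerAr.
by rewrite !mulrDl !scalerAl.
Qed.

Definition env_scale (r : Ce) (x : env_module Ce) : env_module Ce :=
  env_lift Ce (sandwich_bilin x) r.

Lemma env_scaleE a b (x : C) : env_scale (env_tens Ce a b) x = a * x * b.
Proof. by rewrite /env_scale env_liftE. Qed.

Lemma env_scale_linearl v : linear (env_scale^~ v : Ce -> C).
Proof. by move=> c r s; rewrite /env_scale linearP. Qed.

Lemma env_scale_linearr r : linear (env_scale r : C -> C).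
Proof.
move=> c u v; move: r; apply: (@env_ext _ _ Ce C).
- exact: env_scale_linearl.
- move=> e r s; rewrite !env_scale_linearl !scalerDr addrACA !scalerA.
  by rewrite (mulrC e c).
- by move=> a b; rewrite !env_scaleE mulrDr mulrDl scalerAl scalerAr.
Qed.

Fact env_scaleA r s v : env_scale r (env_scale s v) = env_scale (r * s) v.
Proof.
move: s; apply: (@env_ext _ _ Ce C) => [c s t|c s t|a b].
- by rewrite env_scale_linearl env_scale_linearr.
- by rewrite mulrDr -scalerAr env_scale_linearl.
move: r; apply: (@env_ext _ _ Ce C) => [|c s t|a' b'].
- exact: env_scale_linearl.
- by rewrite mulrDl -scalerAl env_scale_linearl.
by rewrite env_M !env_scaleE !mulrA.
Qed.

Fact env_scale1 : left_id 1 env_scale.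
Proof. by move=> v; rewrite -env_1 env_scaleE mul1r mulr1. Qed.

Fact env_scaleDr : right_distributive env_scale +%R.
Proof. by move=> r u v; rewrite -[u in LHS]scale1r env_scale_linearr scale1r. Qed.

Fact env_scaleDl v : {morph env_scale^~ v : r s / r + s}.
Proof. by move=> r s; rewrite /env_scale linearD. Qed.

HB.instance Definition _ := GRing.Zmodule_isLmodule.Build Ce (env_module Ce)
  env_scaleA env_scale1 env_scaleDr env_scaleDl.

End EnvModule.

Section Nakayama.
Variables (k : fieldType) (C : connected_algebra k).
Variable Ce : enveloping_algebra C.

Definition env_gr (m : int) (x : Ce) : Prop :=
  exists s : seq (C * C),
    (forall p, p \in s -> exists i j : int,
       [/\ i + j = m, ca_gr i p.1 & ca_gr j p.2]) /\
    x = \sum_(p <- s) env_tens Ce p.1 p.2.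

(* Ext over C^e of C with values in C^e may be computed from any graded       *)
(* projective resolution P of C. It vanishes in degrees other than d, and psi *)
(* induces in degree d a graded bimodule isomorphism onto C^mu(l). Left       *)
(* multiplication being used for the C^e-linearity of cochains, the bimodule  *)
(* structure of Ext comes from right multiplication:                          *)
(* (b . f . a)(x) = f x * env_tens a b.                                       *)
Definition is_Nakayama (d : nat) (mu : graded_auto C) : Prop :=
  exists l : nat,
  forall (P : proj_resolution (env_module Ce))
         (PD : forall i, int -> P i -> Prop),
    graded_resolution env_gr (@ca_gr k C : int -> env_module Ce -> Prop) PD ->
    let cocyc i := @cocycle _ _ P PD Ce^o env_gr i in
    let cobound i := @coboundary _ _ P PD Ce^o env_gr i in
    (forall i, i <> d -> @Ext_vanishes _ _ P PD Ce^o env_gr i) /\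
    exists psi : (P d -> Ce) -> C,
      [/\ forall f g h, cocyc d f -> cocyc d g ->
             (forall x, h x = f x + g x) -> psi h = psi f + psi g,
          forall a b f h, cocyc d f ->
             (forall x, h x = f x * env_tens Ce a b) ->
             psi h = b * psi f * mu a,
          forall j f, cocyc d f -> @hom_degree _ _ P PD Ce^o env_gr d j f ->
             ca_gr (j + l%:Z) (psi f),
          forall f, cocyc d f -> (psi f = 0 <-> cobound d f)
        & forall c, exists2 f, cocyc d f & psi f = c].

End Nakayama.

(* T(V) for V with basis x_0, ..., x_(n-1) is the free algebra on words over  *)
(* 'I_n. The space V^{(x)m} consists of the elements supported on words of    *)
(* length m, and the tensor product of elements is their product.             *)
Notation tensor_algebra k n := {malg k[{fmonom 'I_n}]}.

Section Tensor.
Variables (k : fieldType) (n : nat).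
Local Notation T := (tensor_algebra k n).

Definition tpow (m : nat) (x : T) : Prop :=
  forall w : {fmonom 'I_n}, w \in msupp x -> size w = m.

Definition subspace (P : T -> Prop) : Prop :=
  P 0 /\ forall (c : k) x y, P x -> P y -> P (c *: x + y).

Definition tens (P Q : T -> Prop) (x : T) : Prop :=
  exists s : seq (T * T),
    (forall p, p \in s -> P p.1 /\ Q p.2) /\ x = \sum_(p <- s) p.1 * p.2.

Definition ideal (R : T -> Prop) (x : T) : Prop :=
  exists s : seq (T * T * T),
    (forall p, p \in s -> R p.1.2) /\ x = \sum_(p <- s) p.1.1 * p.1.2 * p.2.

Definition W (R : T -> Prop) (i : nat) : T -> Prop :=
  match i with
  | 0 | 1 => tpow i
  | 2 => R
  | _ => fun x => forall s, (s <= i - 2)%N ->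
           tens (tens (tpow s) R) (tpow (i - s - 2)) x
  end.

(* f (x) g on V^{(x)p} (x) V^{(x)q}, for linear f and g; only the restriction *)
(* of f to V^{(x)p} and of g to V^{(x)q} matters.                             *)
Definition tensmap (p : nat) (f g : T -> T) (x : T) : T :=
  \sum_(w <- msupp x)
    x@_w *: (f << FMonom (take p w) >> * g << FMonom (drop p w) >>).

Fixpoint tpowmap (f : T -> T) (m : nat) : T -> T :=
  match m with 0 => id | m'.+1 => tensmap 1 f (tpowmap f m') end.

Definition presents (R : T -> Prop) (A : connected_algebra k)
    (pi : {lrmorphism T -> A}) : Prop :=
  [/\ subspace R,
      forall x, R x -> tpow 2 x,
      forall a, exists x, pi x = a,
      forall x, pi x = 0 <-> ideal R x
    & forall m x, tpow m x -> ca_gr m%:Z (pi x)].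

End Tensor.

Section OreExtension.
Variables (k : fieldType) (A : connected_algebra k).
Variables (sbar : graded_auto A) (dbar : {linear A -> A}).

Definition degree_one_derivation : Prop :=
  (forall i a, ca_gr i a -> ca_gr (i + 1) (dbar a)) /\
  (forall a b, dbar (a * b) = sbar a * dbar b + dbar a * b).

Definition Ore_extension (B : algType k) (iota : {lrmorphism A -> B}) (z : B) :
    Prop :=
  (forall a, z * iota a = iota (sbar a) * z + iota (dbar a)) /\
  (forall b, exists! p : {poly A}, b = \sum_(i < size p) iota p`_i * z ^+ i).

End OreExtension.

Section SequencePair.
Variables (k : fieldType) (n : nat) (R : tensor_algebra k n -> Prop).
Local Notation T := (tensor_algebra k n).
Variables (A : connected_algebra k) (pi : {lrmorphism T -> A}).
Variables (dbar : {linear A -> A}) (sigma : {linear T -> T}).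
Variables (B : algType k) (iota : {lrmorphism A -> B}).

Definition mB (v : T) (b : B) : B := iota (pi v) * b.

(* (id_V^{(x)j} (x) m_B) y, for y in V^{(x)j} (x) V (x) V, as an element of   *)
(* V^{(x)j} (x) B, that is, as a function from words of length j to B.        *)
Definition id_mB (j : nat) (y : T) (u : j.-tuple 'I_n) : B :=
  \sum_(w <- msupp y | take j w == u)
    y@_w *: mB << FMonom (take 1 (drop j w)) >>
               (iota (pi << FMonom (drop j.+1 w) >>)).

(* A linear map with domain W_i (resp. V) is given by a linear map on T(V)    *)
(* of which only the restriction to W_i (resp. V) is used.                    *)
Definition sequence_pair (dr dl : nat -> {linear T -> T}) : Prop :=
  exists delta : {linear T -> T},
  [/\ forall v, tpow 1 v -> tpow 2 (delta v) /\ pi (delta v) = dbar (pi v),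
      (forall v, W R 1 v -> dr 1%N v = delta v /\ dl 1%N v = delta v) /\
      (forall x, W R 0 x -> dr 0%N x = 0 /\ dl 0%N x = 0),
      forall i x, (1 <= i)%N -> W R i x ->
        tens (W R i) (@tpow k n 1) (dr i x) /\
        tens (@tpow k n 1) (W R i) (dl i x),
      forall i x, (2 <= i)%N -> W R i x ->
        @id_mB i.-1 (dr i x) =1
        @id_mB i.-1 (tensmap i.-1 (tpowmap sigma i.-1) delta x
                     + tensmap i.-1 (dr i.-1) id x)
    & forall i x, (1 <= i)%N -> W R i x ->
        dr i x + (-1) ^+ i *: dl i x =
        tensmap 1 sigma (dr i.-1) x
        + (-1) ^+ i *: tensmap i.-1 (dl i.-1) id x].

End SequencePair.

(* Main.v *)
(* Let D_(i,r), D_(i,l) be the differences of the two sequence pairs. Put      *)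
(* G_1 = D_(1,r) and G_i = D_(i,r) - G_(i-1) (x) id. Since condition (1) puts  *)
(* D_(i,r) - D_(i-1,r) (x) id in V^(i-1) (x) R, G_i maps W_i to W_(i+1), and   *)
(* condition (2) gives D_(i,l) = (-1)^i (sigma (x) G_(i-1) - G_i). Now W_(d+1) *)
(* vanishes because the projective dimension of k is at most d, so G_d = 0.    *)
(* Writing G_(d-1) = g omega with a functional g on W_(d-1), the differences   *)
(* of delta_r and of delta_l are (g (x) id) omega and                          *)
(* (-1)^d sigma ((id (x) g) omega). It remains to see that                     *)
(* mu_A ((id (x) g) omega) = - (-1)^d (g (x) id) omega. In the complex         *)
(* A (x) W_i (x) A the coboundary of g sends omega to                          *)
(* (id (x) g) omega (x) 1 + (-1)^d 1 (x) (g (x) id) omega, and its class in    *)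
(* Ext^d(A, A^e) = A^mu vanishes, which is the required relation. The complex  *)
(* is a resolution of A: the right Koszul complex is a retract of the given    *)
(* linear resolution of k, and filtering by the degree of the left factor      *)
(* carries exactness over to bimodules.                                        *)

Require Import Defs.
From HB Require Import structures.
From mathcomp Require Import all_boot all_order all_algebra.
From mathcomp.finmap Require Import finmap.
From mathcomp.multinomials Require Import monalg.
From mathcomp Require Import boolp zify.

Set Implicit Arguments.
Unset Strict Implicit.
Unset Printing Implicit Defensive.

Import GRing.Theory.
Local Open Scope ring_scope.

(** * Tensor powers *)

(** Two sequence pairs differ in the lift [delta], which may change by a map into R, and in what
    [m_B] does not see. As A embeds in the Ore extension ([iota_inj]), the kernel of [m_B] on V (x)
    V is R as well ([id_mB_kernel]), so [gpair_of_sequence_pair] restates each pair inside the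
    tensor algebra. The whole difference of two pairs is then carried by one family of maps G_i from
    W_i to W_(i+1) ([G_W], [EG]). In top degree only the functional g with G_(d-1) = g omega
    survives: by [pair_difference] the right elements differ by the contraction X of omega by g from
    the left, and the left elements differ, up to sign and sigma, by the contraction Y of omega by g
    from the right.

    The theorem thus amounts to mu_A(Y) = - (-1)^d X, which is [nakayama_relation]. On the complex A
    (x) W_i (x) A the top cochain e0 dual to omega is sent to a non-zero scalar by the isomorphism
    Ext^d(A, A^e) = A^mu. The coboundary of g is e0 times Y (x) 1 + (-1)^d 1 (x) X; its class is
    zero, and the bimodule structure of A^mu turns this into the relation.

    It remains to know that the complexes built from the W_i are resolutions, when Koszulity only
    provides some linear resolution. [comparisonS] makes the right Koszul complex a retract of it,
    so it is exact ([rk_exact]); comparing it with a finite projective resolution gives W_(d+1) = 0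
    ([rk_top]); and removing left degrees one at a time gives exactness of the bimodule complex
    ([left_step], [bk_exact]). [pair_invariance] combines these facts. In it and in the lemmas it
    rests on the dimension is written [d.+1]; dimension 0 is treated at the end. *)

Section LinearExtension.
Variables (k : fieldType) (n : nat).
Local Notation T := (tensor_algebra k n).
Local Notation word := {fmonom 'I_n}.

(** The linear map with prescribed values on words. [tensmap] is of this form by conversion, whence
    its linearity. *)
Definition linext (U : lmodType k) (g : word -> U) (x : T) : U :=
  \sum_(w <- msupp x) x@_w *: g w.

Lemma linextEw (U : lmodType k) (g : word -> U) (d : {fset word}) x :
  (msupp x `<=` d)%fset -> linext g x = \sum_(w <- d) x@_w *: g w.
Proof.
move=> le; rewrite /linext (big_fset_incl _ le) // => w _ /mcoeff_outdom ->.
by rewrite scale0r.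
Qed.

Fact linext_is_linear (U : lmodType k) (g : word -> U) : linear (linext g).
Proof.
move=> c x y; pose d := (msupp (c *: x + y) `|` (msupp x `|` msupp y))%fset.
have s1 : (msupp (c *: x + y) `<=` d)%fset by exact: fsubsetUl.
have s2 : (msupp x `<=` d)%fset.
  by apply: fsubset_trans (fsubsetUr _ _); exact: fsubsetUl.
have s3 : (msupp y `<=` d)%fset.
  by apply: fsubset_trans (fsubsetUr _ _); exact: fsubsetUr.
rewrite (linextEw _ s1) (linextEw _ s2) (linextEw _ s3) scaler_sumr -big_split.
by apply: eq_bigr => w _; rewrite /= mcoeffD mcoeffZ scalerDl scalerA.
Qed.

HB.instance Definition _ (U : lmodType k) (g : word -> U) :=
  GRing.isLinear.Build k T U *:%R (linext g) (linext_is_linear g).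

Lemma linextU (U : lmodType k) (g : word -> U) w : linext g << w >> = g w.
Proof.
by rewrite /linext msuppU1 big_seq_fset1 mcoeffU1 eqxx scale1r.
Qed.

(** As k is commutative, right multiplication by the constant [c%:MP] is scaling by c, so scalars
    move past the left factor. *)
Lemma TZAr (c : k) (x y : T) : c *: (x * y) = x * (c *: y).
Proof.
have xC : x * c%:MP = c *: x.
  rewrite malgM_def fgmulgU malgZ_def /fgscale; apply: eq_bigr => w _.
  by rewrite mulm1 mulrC.
by rewrite -[c *: y]mul_malgC mulrA xC scalerAl.
Qed.

(* Rewriting with the generic ring lemmas leaves nested structure projections *)
(* on T that are very slow to unify; these instances are in normal form.      *)
Lemma TZAl (c : k) (x y : T) : c *: (x * y) = (c *: x) * y.
Proof. exact: scalerAl. Qed.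

Lemma TmulDl (x y z : T) : (x + y) * z = x * z + y * z.
Proof. exact: mulrDl. Qed.

Lemma TmulDr (x y z : T) : x * (y + z) = x * y + x * z.
Proof. exact: mulrDr. Qed.

Lemma Tmul_suml (I : Type) (s : seq I) (P : pred I) (F : I -> T) y :
  (\sum_(i <- s | P i) F i) * y = \sum_(i <- s | P i) F i * y.
Proof. exact: mulr_suml. Qed.

Lemma Tmul_sumr (I : Type) (s : seq I) (P : pred I) (F : I -> T) y :
  y * (\sum_(i <- s | P i) F i) = \sum_(i <- s | P i) y * F i.
Proof. exact: mulr_sumr. Qed.

Lemma T1mul (x : T) : 1 * x = x. Proof. exact: mul1r. Qed.
Lemma Tmul1 (x : T) : x * 1 = x. Proof. exact: mulr1. Qed.
Lemma Tmul0 (x : T) : x * 0 = 0. Proof. exact: mulr0. Qed.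

Lemma wordM (s t : seq 'I_n) :
  << FMonom s >> * << FMonom t >> = << FMonom (s ++ t) >> :> T.
Proof.
rewrite malgM_def fgmulUU mulr1; congr (<< _ >>).
by apply/eqP; rewrite fmP fmM.
Qed.

Lemma mcoeffZU (c : k) (w v : word) : (c *: << w >> : T)@_v = if w == v then c else 0.
Proof. by rewrite mcoeffZ mcoeffU1; case: (w == v); rewrite ?mulr1 ?mulr0. Qed.

Section Subspace.
Variables (P : T -> Prop) (sP : subspace P).

Lemma subspaceD x y : P x -> P y -> P (x + y).
Proof. by case: sP => _ h hx hy; have := h 1 _ _ hx hy; rewrite scale1r. Qed.

Lemma subspaceZ (c : k) x : P x -> P (c *: x).
Proof. by case: sP => h0 h hx; have := h c _ _ hx h0; rewrite addr0. Qed.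

Lemma subspaceB x y : P x -> P y -> P (x - y).
Proof. by move=> hx hy; rewrite -scaleN1r; apply: subspaceD (subspaceZ _ hy). Qed.

Lemma subspace_sum (I : Type) (s : seq I) (Q : pred I) (F : I -> T) :
  (forall i, Q i -> P (F i)) -> P (\sum_(i <- s | Q i) F i).
Proof.
by case: sP => h0 _ hF; apply: big_ind => // x y; exact: subspaceD.
Qed.

Lemma subspace_sum_seq (I : eqType) (s : seq I) (F : I -> T) :
  (forall i, i \in s -> P (F i)) -> P (\sum_(i <- s) F i).
Proof. by move=> hF; rewrite big_seq; apply: subspace_sum. Qed.

End Subspace.

Section Tpow.
Implicit Types (m : nat) (x y : T).

Lemma tpowP m x : tpow m x <-> forall w : word, size w != m -> x@_w = 0.
Proof.
split=> [h w|h w]; first by case: msuppP => // /h -> ; rewrite eqxx.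
by rewrite -mcoeff_neq0; apply: contraNeq => /h ->.
Qed.

Lemma tpow0 m : tpow m (0 : T).
Proof. by apply/tpowP => w _; rewrite mcoeff0. Qed.

Lemma tpow_lin m (c : k) x y : tpow m x -> tpow m y -> tpow m (c *: x + y).
Proof.
move=> /tpowP hx /tpowP hy; apply/tpowP => w hw.
by rewrite mcoeffD mcoeffZ hx // hy // mulr0 addr0.
Qed.

Lemma subspace_tpow m : subspace (tpow m : T -> Prop).
Proof. split; [exact: tpow0 | move=> c x y hx hy; apply: tpow_lin => //]. Qed.

Lemma tpow_word m (t : m.-tuple 'I_n) : tpow m (<< FMonom t >> : T).
Proof. by move=> w; rewrite msuppU1 in_fset1 => /eqP ->; rewrite size_tuple. Qed.

Lemma tpow_wordP (w : word) : tpow (size w) (<< w >> : T).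
Proof. by move=> v; rewrite msuppU1 in_fset1 => /eqP ->. Qed.

Lemma tpowE m x : tpow m x ->
  x = \sum_(t : m.-tuple 'I_n) x@_(FMonom t) *: << FMonom t >>.
Proof.
move=> /tpowP hx; apply/malgP => w; rewrite raddf_sum /=.
under eq_bigr do rewrite mcoeffZU.
case: (eqVneq (size w) m) => hw; last first.
  rewrite hx // big1 // => t _; case: eqP => // e.
  by rewrite -e /= size_tuple eqxx in hw.
have hw' : size w == m by apply/eqP.
rewrite (bigD1 (Tuple hw')) //= fmK eqxx big1 => [|t ht]; first by rewrite addr0.
case: eqP => // e.
by case/eqP: ht; apply: val_inj; exact: (congr1 (@fmonom_val _) e).
Qed.

Lemma eq_tpow (U : lmodType k) (f g : {linear T -> U}) m :
  (forall t : m.-tuple 'I_n, f << FMonom t >> = g << FMonom t >>) ->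
  forall x, tpow m x -> f x = g x.
Proof.
move=> h x /tpowE ->; rewrite !linear_sum; apply: eq_bigr => t _.
by rewrite !linearZ h.
Qed.

Lemma word_cat p q (t : (p + q).-tuple 'I_n) : exists u : p.-tuple 'I_n,
  exists2 v : q.-tuple 'I_n, tval t = u ++ v
  & << FMonom t >> = << FMonom u >> * << FMonom v >> :> T.
Proof.
have hu : size (take p t) == p by rewrite size_take size_tuple; case: q t => [|q] t;
  rewrite ?addn0 ?ltnn // addnS ltnS leq_addr.
have hv : size (drop p t) == q by rewrite size_drop size_tuple addKn.
exists (Tuple hu), (Tuple hv); first by rewrite /= cat_take_drop.
by rewrite wordM /= cat_take_drop.
Qed.

Lemma tpowM p q x y : tpow p x -> tpow q y -> tpow (p + q) (x * y).
Proof.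
move=> /tpowE -> /tpowE ->; rewrite Tmul_suml.
have sS := subspace_tpow (p + q).
apply: (subspace_sum sS) => t _; rewrite Tmul_sumr; apply: (subspace_sum sS) => s _.
rewrite -TZAr; apply: (subspaceZ sS); rewrite -TZAl; apply: (subspaceZ sS).
rewrite wordM.
have hs : size (t ++ s) == (p + q)%N by rewrite size_cat !size_tuple.
exact: (@tpow_word _ (Tuple hs)).
Qed.

End Tpow.

Lemma tensmapE p (f g : T -> T) x : tensmap p f g x =
  linext (fun w : word => f << FMonom (take p w) >> * g << FMonom (drop p w) >>) x.
Proof. by []. Qed.

Fact tensmap_is_linear p (f g : T -> T) : linear (tensmap p f g).
Proof. by move=> c x y; rewrite !tensmapE linearP. Qed.

HB.instance Definition _ p (f g : T -> T) :=
  GRing.isLinear.Build k T T *:%R (tensmap p f g) (tensmap_is_linear p f g).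

Lemma tensmapU p q (f g : T -> T) (t : p.-tuple 'I_n) (s : q.-tuple 'I_n) :
  tensmap p f g (<< FMonom t >> * << FMonom s >>)
  = f << FMonom t >> * g << FMonom s >>.
Proof.
rewrite tensmapE wordM linextU /= take_cat drop_cat size_tuple ltnn subnn.
by rewrite take0 drop0 cats0.
Qed.

Lemma bilin_tpow (U : lmodType k) (b b' : T -> T -> U) p q :
  (forall x, linear (b x)) -> (forall y, linear (b^~ y)) ->
  (forall x, linear (b' x)) -> (forall y, linear (b'^~ y)) ->
  (forall (t : p.-tuple 'I_n) (s : q.-tuple 'I_n),
     b << FMonom t >> << FMonom s >> = b' << FMonom t >> << FMonom s >>) ->
  forall x y, tpow p x -> tpow q y -> b x y = b' x y.
Proof.
move=> h1 h2 h3 h4 h x y hx hy.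
pose mk (f : T -> U) (lf : linear f) : {linear T -> U} :=
  HB.pack f (GRing.isLinear.Build k T U *:%R f lf).
apply: (@eq_tpow U (mk _ (h2 y)) (mk _ (h4 y)) p) => // t /=.
by apply: (@eq_tpow U (mk _ (h1 _)) (mk _ (h3 _)) q) => // s /=.
Qed.

Lemma mulT_linr (x : T) : linear ( *%R x).
Proof. by move=> c u v; rewrite TmulDr TZAr. Qed.

Lemma mulT_linl (y : T) : linear ( *%R^~ y).
Proof. by move=> c u v; rewrite TmulDl TZAl. Qed.

Lemma tensmapM p q (f g : T -> T) x y : linear f -> linear g ->
  tpow p x -> tpow q y -> tensmap p f g (x * y) = f x * g y.
Proof.
move=> lf lg; apply: (bilin_tpow (b := fun x y => tensmap p f g (x * y))
  (b' := fun x y => f x * g y)) => [u|v|u|v|t s].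
- by move=> c a b; rewrite mulT_linr linearP.
- by move=> c a b; rewrite /= mulT_linl linearP.
- by move=> c a b; rewrite lg mulT_linr.
- by move=> c a b; rewrite /= lf mulT_linl.
- exact: tensmapU.
Qed.

End LinearExtension.

(** * Bases of subspaces given by predicates *)

Lemma vspace_of_pred (k : fieldType) (vT : vectType k) (P : vT -> Prop) :
  P 0 -> (forall c u v, P u -> P v -> P (c *: u + v)) ->
  exists U : {vspace vT}, forall v, v \in U <-> P v.
Proof.
move=> P0 Plin.
pose Q d := `[< exists U : {vspace vT}, (forall v, v \in U -> P v) /\ \dim U = d >].
have exQ : exists d, Q d.
  exists 0%N; apply/asboolP; exists 0%VS; split; last by rewrite dimv0.
  by move=> v; rewrite memv0 => /eqP ->.
have leQ d : Q d -> (d <= dim vT)%N.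
  by move=> /asboolP [U [_ <-]]; rewrite -dimvf dimvS // subvf.
(* A subspace inside [P] of maximal dimension is all of [P]: adjoining another vector of [P] would
   stay inside [P] and raise the dimension. *)
case: (ex_maxnP exQ leQ) => d /asboolP [U [hU dU]] hmax.
exists U => v; split=> [|Pv]; first exact: hU.
have /eqP -> : U == (U + <[v]>)%VS.
  rewrite eqEdim addvSl /= dU; apply: hmax; apply/asboolP.
  exists (U + <[v]>)%VS; split=> // _ /memv_addP [u hu [_ /vlineP [c ->] ->]].
  by rewrite addrC; apply: Plin => //; exact: hU.
by apply: (subvP (addvSr _ _)); exact: memv_line.
Qed.

Section Basis.
Variables (k : fieldType) (n : nat).
Local Notation T := (tensor_algebra k n).

(** [P] is transported to the finite-dimensional space of coefficient functions on words of length
    m. The dual functionals are defined on all of T, reading only coefficients of that length, so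
    that they can serve as factors of [tensmap]. *)
Lemma tpow_basis m (P : T -> Prop) : subspace P -> (forall x, P x -> tpow m x) ->
  exists (r : nat) (w : 'I_r -> T) (al : 'I_r -> T -> k),
  [/\ forall j, linear (al j : T -> k^o), forall j, P (w j), forall i j, al i (w j) = (i == j)%:R
    & forall x, P x -> x = \sum_j al j x *: w j].
Proof.
move=> sP hP; pose vT : vectType k := {ffun m.-tuple 'I_n -> k^o}.
pose phi (x : T) : vT := [ffun t : m.-tuple 'I_n => x@_(FMonom t)].
pose psi (f : vT) : T := \sum_t (f t : k) *: << FMonom (tval t) >>.
have phiL : linear phi.
  by move=> c x y; apply/ffunP => t; rewrite !ffunE mcoeffD mcoeffZ.
have psiL : linear psi.
  move=> c f g; rewrite /psi scaler_sumr -big_split; apply: eq_bigr => t _.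
  by rewrite /= !ffunE scalerDl scalerA.
have phiK x : tpow m x -> psi (phi x) = x.
  move=> /tpowE {2}->; apply: eq_bigr => t _; by rewrite ffunE.
have psiK f : phi (psi f) = f.
  apply/ffunP => t; rewrite ffunE /psi raddf_sum /=.
  under eq_bigr do rewrite mcoeffZU.
  rewrite (bigD1 t) //= eqxx big1 ?addr0 // => s hs; case: eqP => // e.
  by case/eqP: hs; apply: val_inj; exact: (congr1 (@fmonom_val _) e).
pose psi' : {linear vT -> T} := HB.pack psi (GRing.isLinear.Build k vT T *:%R psi psiL).
pose phi' : {linear T -> vT} := HB.pack phi (GRing.isLinear.Build k T vT *:%R phi phiL).
case: (@vspace_of_pred k vT (fun f => P (psi' f))) => [|c u v hu hv|U hU].
- by rewrite linear0; case: sP.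
- by rewrite linearP; case: sP => _; apply.
pose b := vbasis U.
have fb : free b := basis_free (vbasisP U).
exists (\dim U), (fun j => psi (b`_j)).
exists (fun i => (coord b i \o phi' : {linear T -> k^o}) : T -> k); split.
- by move=> j; exact: linearP.
- by move=> j; apply/hU; apply: vbasis_mem; rewrite mem_nth // size_tuple.
- by move=> i j; rewrite /= psiK coord_free // eq_sym.
move=> x Px; have tx := hP _ Px.
have hx : phi x \in U by apply/hU; rewrite (phiK x tx : psi' _ = _).
rewrite -{1}(phiK x tx : psi' _ = _) {1}(coord_vbasis hx) linear_sum.
by apply: eq_bigr => j _; rewrite linearZ.
Qed.

End Basis.

Section TensorPowers.
Variables (k : fieldType) (n : nat).
Local Notation T := (tensor_algebra k n).

Lemma mcoeff1_word (w : {fmonom 'I_n}) : (1 : T)@_w = (w == FMonom [::])%:R.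
Proof. by rewrite mcoeff1; congr ((w == _)%:R); apply/eqP; rewrite fmP fm1. Qed.

Lemma tpow0_1 : tpow 0 (1 : T).
Proof. by apply/tpowP => w hw; rewrite mcoeff1_word; case: eqP => // e; rewrite e in hw. Qed.

Lemma word1 : << FMonom [::] >> = 1 :> T.
Proof. by apply/malgP => w; rewrite mcoeff1_word mcoeffU1 eq_sym. Qed.

Lemma tpow0P (x : T) : tpow 0 x <-> x = x@_(FMonom [::]) *: 1.
Proof.
split=> [/tpowP hx|->]; last exact: subspaceZ (@subspace_tpow k n 0) _ _ tpow0_1.
apply/malgP => w; rewrite mcoeffZ mcoeff1_word.
case: (eqVneq w (FMonom [::])) => [->|hw]; first by rewrite mulr1.
by rewrite mulr0 hx //; apply: contra hw => /nilP e; rewrite fmP e.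
Qed.

Lemma tpow_tens p q x : @tpow k n (p + q) x -> tens (@tpow k n p) (@tpow k n q) x.
Proof.
move=> /tpowE ->.
exists [seq (x@_(FMonom t) *: << FMonom (take p t) >>, << FMonom (drop p t) >>) | t : (p + q).-tuple 'I_n].
split.
  move=> y /mapP [t _ ->] /=; have [u [v e _]] := word_cat k t.
  rewrite e take_size_cat ?size_tuple // drop_size_cat ?size_tuple //.
  split; last exact: (@tpow_word _ _ _ v).
  by apply: (subspaceZ (@subspace_tpow k n p)); exact: (@tpow_word _ _ _ u).
rewrite big_map big_enum /=; apply: eq_bigr => t _.
by rewrite -TZAl wordM cat_take_drop.
Qed.

End TensorPowers.

Section LinearFunctions.
Variables (k : fieldType) (U V : lmodType k) (f : U -> V) (lf : linear f).

Lemma lin0 : f 0 = 0.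
Proof. by have := lf (-1) 0 0; rewrite scaler0 addr0 scaleN1r addNr. Qed.

Lemma linD x y : f (x + y) = f x + f y.
Proof. by have := lf 1 x y; rewrite !scale1r. Qed.

Lemma linZ c x : f (c *: x) = c *: f x.
Proof. by have := lf c x 0; rewrite lin0 !addr0. Qed.

Lemma linN x : f (- x) = - f x.
Proof. by rewrite -scaleN1r linZ scaleN1r. Qed.

Lemma linB x y : f (x - y) = f x - f y.
Proof. by rewrite linD linN. Qed.

Lemma lin_sum (I : Type) (s : seq I) (P : pred I) (F : I -> U) :
  f (\sum_(i <- s | P i) F i) = \sum_(i <- s | P i) f (F i).
Proof. exact: (big_morph f linD lin0). Qed.

End LinearFunctions.

(** * Subspaces of tensor powers over an abstract algebra *)

Section TensorTheory.
Variables (k : fieldType) (T : lalgType k).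

Definition gsubspace (P : T -> Prop) : Prop :=
  P 0 /\ forall (c : k) x y, P x -> P y -> P (c *: x + y).

Definition gtens (P Q : T -> Prop) (x : T) : Prop :=
  exists s : seq (T * T),
    (forall p, p \in s -> P p.1 /\ Q p.2) /\ x = \sum_(p <- s) p.1 * p.2.

Section Subspace.
Variables (P : T -> Prop) (sP : gsubspace P).

Lemma gsubspaceD x y : P x -> P y -> P (x + y).
Proof. by case: sP => _ h hx hy; have := h 1 _ _ hx hy; rewrite scale1r. Qed.

Lemma gsubspaceZ (c : k) x : P x -> P (c *: x).
Proof. by case: sP => h0 h hx; have := h c _ _ hx h0; rewrite addr0. Qed.

Lemma gsubspaceB x y : P x -> P y -> P (x - y).
Proof. by move=> hx hy; rewrite -scaleN1r; apply: gsubspaceD (gsubspaceZ _ hy). Qed.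

Lemma gsubspace_sum (I : Type) (s : seq I) (Q : pred I) (F : I -> T) :
  (forall i, Q i -> P (F i)) -> P (\sum_(i <- s | Q i) F i).
Proof.
by case: sP => h0 _ hF; apply: big_ind => // x y; exact: gsubspaceD.
Qed.

Lemma gsubspace_sum_seq (I : eqType) (s : seq I) (F : I -> T) :
  (forall i, i \in s -> P (F i)) -> P (\sum_(i <- s) F i).
Proof. by move=> hF; rewrite big_seq; apply: gsubspace_sum. Qed.

End Subspace.

Implicit Types (P Q S : T -> Prop).

Lemma gtens_mul P Q x y : P x -> Q y -> gtens P Q (x * y).
Proof.
move=> hx hy; exists [:: (x, y)]; split; last by rewrite big_seq1.
by move=> p; rewrite inE => /eqP ->.
Qed.

Lemma gtens_add P Q x y : gtens P Q x -> gtens P Q y -> gtens P Q (x + y).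
Proof.
move=> [s [hs ->]] [t [ht ->]]; exists (s ++ t); split; last by rewrite big_cat.
by move=> p; rewrite mem_cat => /orP [/hs|/ht].
Qed.

Lemma gtens_zero P Q : gtens P Q 0.
Proof. by exists [::]; split => //; rewrite big_nil. Qed.

Lemma gtens_sum P Q (I : Type) (s : seq I) (C : pred I) (F : I -> T) :
  (forall i, C i -> gtens P Q (F i)) -> gtens P Q (\sum_(i <- s | C i) F i).
Proof.
by move=> hF; apply: big_ind => //; [exact: gtens_zero | move=> *; exact: gtens_add].
Qed.

Lemma gsubspace_gtens P Q : gsubspace P -> gsubspace (gtens P Q).
Proof.
move=> sP; split; first exact: gtens_zero.
move=> c x y [s [hs ->]] hy; apply: gtens_add => //.
rewrite scaler_sumr big_seq; apply: gtens_sum => p /hs [h1 h2].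
by rewrite scalerAl; apply: gtens_mul => //; apply: gsubspaceZ.
Qed.

Lemma gtens_mono P Q P' Q' x : (forall y, P y -> P' y) -> (forall y, Q y -> Q' y) ->
  gtens P Q x -> gtens P' Q' x.
Proof. by move=> hP hQ [s [hs ->]]; exists s; split=> // p /hs [/hP h1 /hQ h2]. Qed.

Lemma gtensA P Q S x : gtens P (gtens Q S) x <-> gtens (gtens P Q) S x.
Proof.
split=> -[s [hs ->]]; rewrite big_seq; apply: gtens_sum => p /hs [].
  move=> h1 [t [ht ->]]; rewrite mulr_sumr big_seq; apply: gtens_sum => q /ht [h2 h3].
  by rewrite mulrA; apply: gtens_mul => //; apply: gtens_mul.
move=> [t [ht ->]] h3; rewrite mulr_suml big_seq; apply: gtens_sum => q /ht [h1 h2].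
by rewrite -mulrA; apply: gtens_mul => //; apply: gtens_mul.
Qed.

Lemma gtens_sub P Q S x : gsubspace S -> (forall a b, P a -> Q b -> S (a * b)) ->
  gtens P Q x -> S x.
Proof.
by move=> sS h [s [hs ->]]; apply: (gsubspace_sum_seq sS) => p /hs []; exact: h.
Qed.

Lemma gtens_ind P Q S : gsubspace S -> (forall a b, P a -> Q b -> S (a * b)) ->
  forall x, gtens P Q x -> S x.
Proof. by move=> sS h x; apply: gtens_sub. Qed.

Lemma gsubspace_eq (U : lmodType k) (f g : T -> U) :
  linear f -> linear g -> gsubspace (fun x => f x = g x).
Proof.
by move=> lf lg; split=> [|c x y hx hy]; rewrite ?(lin0 lf) ?(lin0 lg) // lf lg hx hy.
Qed.

(* The grading of T by tensor length and the maps f (x) g determine all that  *)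
(* is used of the tensor algebra. Arguing from these properties rather than   *)
(* for {malg k[_]} keeps unification from unfolding its multiplication.       *)
Record tensor_theory (tp : nat -> T -> Prop)
    (tm : nat -> (T -> T) -> (T -> T) -> T -> T) : Prop := TensorTheory {
  tt_ZAr : forall (c : k) (x y : T), c *: (x * y) = x * (c *: y);
  tt_sub : forall m, gsubspace (tp m);
  tt_1 : tp 0%N 1;
  tt_0 : forall x, tp 0%N x -> exists c : k, x = c%:A;
  tt_M : forall p q x y, tp p x -> tp q y -> tp (p + q)%N (x * y);
  tt_cat : forall p q x, tp (p + q)%N x -> gtens (tp p) (tp q) x;
  tt_lin : forall p f g, linear (tm p f g);
  tt_tm : forall p q (f g : T -> T) x y, linear f -> linear g ->
    tp p x -> tp q y -> tm p f g (x * y) = f x * g y;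
  tt_basis : forall m (P : T -> Prop), gsubspace P -> (forall x, P x -> tp m x) ->
    exists (r : nat) (w : 'I_r -> T) (al : 'I_r -> T -> k),
    [/\ forall j, linear (al j : T -> k^o), forall j, P (w j),
        forall i j, al i (w j) = (i == j)%:R
      & forall x, P x -> x = \sum_j al j x *: w j]
}.

Variables (tp : nat -> T -> Prop) (tm : nat -> (T -> T) -> (T -> T) -> T -> T).
Hypothesis H : tensor_theory tp tm.

Let sub_tp m : gsubspace (tp m) := tt_sub H m.
Hint Resolve sub_tp : pair_invariance.

Lemma gtens_tp p q x : gtens (tp p) (tp q) x <-> tp (p + q) x.
Proof.
split; last exact: (tt_cat H).
by apply: gtens_sub => // a b; exact: (tt_M H).
Qed.

Lemma gtens_tp0l P x : gsubspace P -> gtens (tp 0) P x <-> P x.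
Proof.
move=> sP; split.
  apply: gtens_sub => // a b /(tt_0 H) [c ->] hb.
  by rewrite -scalerAl mul1r; apply: gsubspaceZ.
by move=> hx; rewrite -[x]mul1r; apply: gtens_mul => //; exact: (tt_1 H).
Qed.

Lemma gtens_tp0r P x : gsubspace P -> gtens P (tp 0) x <-> P x.
Proof.
move=> sP; split.
  apply: gtens_sub => // a b ha /(tt_0 H) [c ->].
  by rewrite -(tt_ZAr H) mulr1; apply: gsubspaceZ.
by move=> hx; rewrite -[x]mulr1; apply: gtens_mul => //; exact: (tt_1 H).
Qed.

Lemma gsubspace_preim (f : T -> T) Q : linear f -> gsubspace Q ->
  gsubspace (fun x => Q (f x)).
Proof.
move=> lf [h0 hQ]; split; first by rewrite (lin0 lf).
by move=> c x y hx hy; rewrite lf; exact: hQ.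
Qed.

Lemma tp_tm p q p' q' P (f g : T -> T) x : linear f -> linear g ->
  (forall y, P y -> tp p y /\ tp p' (f y)) -> (forall y, tp q y -> tp q' (g y)) ->
  gtens P (tp q) x -> tp (p' + q') (tm p f g x).
Proof.
move=> lf lg hf hg; move: x; apply: gtens_ind.
  exact: gsubspace_preim (tt_lin H p f g) (sub_tp _).
move=> a b /hf [ha fa] hb; rewrite (tt_tm H lf lg ha hb).
by apply: (tt_M H) => //; exact: hg.
Qed.

(* The functional a is applied to the factors after the first p by contr_r,   *)
(* and to the first p factors by contr_l.                                     *)
Definition contr_r p (a : T -> k) : T -> T := tm p id (fun y => (a y)%:A).
Definition contr_l p (a : T -> k) : T -> T := tm p (fun y => (a y)%:A) id.

Section Functional.
Variables (a : T -> k) (la : linear (a : T -> k^o)).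

Lemma functional_linear : linear (fun y => (a y)%:A : T).
Proof. by move=> c x y; rewrite la scalerDl -scalerA. Qed.

Lemma contr_l_linear p : linear (contr_l p a).
Proof. exact: (tt_lin H). Qed.

Lemma contr_r_linear p : linear (contr_r p a).
Proof. exact: (tt_lin H). Qed.

Lemma contr_rM p q x y : tp p x -> tp q y -> contr_r p a (x * y) = a y *: x.
Proof.
move=> hx hy; rewrite /contr_r (tt_tm H (f := id) _ functional_linear hx hy) //.
by rewrite -(tt_ZAr H) mulr1.
Qed.

Lemma contr_lM p q x y : tp p x -> tp q y -> contr_l p a (x * y) = a x *: y.
Proof.
move=> hx hy; rewrite /contr_l (tt_tm H (g := id) functional_linear _ hx hy) //.
by rewrite -scalerAl mul1r.
Qed.

Lemma contr_r_gtens p q P x : gsubspace P -> (forall y, P y -> tp p y) ->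
  gtens P (tp q) x -> P (contr_r p a x).
Proof.
move=> sP hP [s [hs ->]]; rewrite (lin_sum (contr_r_linear p)).
apply: (gsubspace_sum_seq sP) => y /hs [h1 h2].
by rewrite (contr_rM (hP _ h1) h2); exact: gsubspaceZ.
Qed.

Lemma contr_l_gtens p q P x : gsubspace P -> (forall y, P y -> tp q y) ->
  gtens (tp p) P x -> P (contr_l p a x).
Proof.
move=> sP hP [s [hs ->]]; rewrite (lin_sum (contr_l_linear p)).
apply: (gsubspace_sum_seq sP) => y /hs [h1 h2].
by rewrite (contr_lM h1 (hP _ h2)); exact: gsubspaceZ.
Qed.

Lemma tp_contr_l p q x : tp (p + q) x -> tp q (contr_l p a x).
Proof. by move=> /(tt_cat H); exact: (contr_l_gtens (sub_tp q) (fun _ h => h)). Qed.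

Lemma tp_contr_r p q x : tp (p + q) x -> tp p (contr_r p a x).
Proof. by move=> /(tt_cat H); exact: (contr_r_gtens (sub_tp p) (fun _ h => h)). Qed.

Lemma tp_cat_ind p q Q : gsubspace Q ->
  (forall x y, tp p x -> tp q y -> Q (x * y)) -> forall x, tp (p + q) x -> Q x.
Proof. by move=> sQ h x /(tt_cat H); apply: gtens_sub. Qed.

Lemma contr_l_mul p q s x y : tp (p + q) x -> tp s y ->
  contr_l p a (x * y) = contr_l p a x * y.
Proof.
move=> hx hy; move: x hx; apply: tp_cat_ind.
  apply: gsubspace_eq.
    by move=> c u v /=; rewrite mulrDl -scalerAl contr_l_linear.
  by move=> c u v /=; rewrite contr_l_linear mulrDl -scalerAl.
move=> u v hu hv; rewrite -mulrA (contr_lM hu (tt_M H hv hy)) (contr_lM hu hv).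
by rewrite scalerAl.
Qed.

Lemma contr_r_mul p q s x y : tp q x -> tp (p + s) y ->
  contr_r (q + p) a (x * y) = x * contr_r p a y.
Proof.
move=> hx; move: y; apply: tp_cat_ind.
  apply: gsubspace_eq.
    by move=> c u v /=; rewrite mulrDr -(tt_ZAr H) contr_r_linear.
  by move=> c u v /=; rewrite contr_r_linear mulrDr -(tt_ZAr H).
move=> u v hu hv; rewrite mulrA (contr_rM (tt_M H hx hu) hv) (contr_rM hu hv).
by rewrite (tt_ZAr H).
Qed.

End Functional.

Section DualBasis.
Variables (m r : nat) (P : T -> Prop) (w : 'I_r -> T) (al : 'I_r -> T -> k).
Hypotheses (hP : forall x, P x -> tp m x) (lal : forall j, linear (al j : T -> k^o)).
Hypothesis (hE : forall x, P x -> x = \sum_j al j x *: w j).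

(** On a product of an element of [P] with a second factor this is the dual basis expansion of the
    first; so the cofactors of the basis [w] are contractions. *)
Lemma contr_lE q x : gtens P (tp q) x -> x = \sum_j w j * contr_l m (al j) x.
Proof.
move=> [s [hs ->]].
under [RHS]eq_bigr do rewrite (lin_sum (contr_l_linear _ _)) mulr_sumr.
rewrite exchange_big /= [LHS]big_seq [RHS]big_seq; apply: eq_bigr => p /hs [h1 h2].
under eq_bigr do rewrite (contr_lM (lal _) (hP h1) h2) -(tt_ZAr H) scalerAl.
by rewrite -mulr_suml -hE.
Qed.

Lemma contr_rE q x : gtens (tp q) P x -> x = \sum_j contr_r q (al j) x * w j.
Proof.
move=> [s [hs ->]].
under [RHS]eq_bigr do rewrite (lin_sum (contr_r_linear _ _)) mulr_suml.
rewrite exchange_big /= [LHS]big_seq [RHS]big_seq; apply: eq_bigr => p /hs [h1 h2].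
under eq_bigr do rewrite (contr_rM (lal _) h1 (hP h2)) -scalerAl (tt_ZAr H).
by rewrite -mulr_sumr -hE.
Qed.

End DualBasis.

(** The cofactors of a basis of [tp p] in [x] are left contractions, so contractions test in which
    subspace the right factors lie. *)
Lemma gtensl_contr p q Q x : tp (p + q) x ->
  (forall a : T -> k, linear (a : T -> k^o) -> Q (contr_l p a x)) -> gtens (tp p) Q x.
Proof.
move=> hx hQ; have [r [w [al [lal hw _ hE]]]] := tt_basis H (sub_tp p) (fun x h => h).
rewrite (contr_lE (fun x h => h) lal hE (tt_cat H hx)).
by apply: gtens_sum => j _; apply: gtens_mul => //; apply: hQ.
Qed.

Lemma tens3_ind p q s Q : gsubspace Q ->
  (forall x y z, tp p x -> tp q y -> tp s z -> Q (x * y * z)) ->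
  forall x, tp (p + q + s) x -> Q x.
Proof.
move=> sQ h; apply: tp_cat_ind => // x z hx hz; move: x hx.
apply: tp_cat_ind; last by move=> x y hx hy; exact: h.
split; first by rewrite mul0r; case: sQ.
by move=> c u v hu hv; rewrite mulrDl -scalerAl; case: sQ => _; apply.
Qed.

(** * The spaces W_i *)

Section WSpaces.
Variables (R : T -> Prop) (sR : gsubspace R) (hR : forall x, R x -> tp 2 x).
Local Notation V := (tp 1).

Definition gW (i : nat) : T -> Prop :=
  match i with
  | 0 | 1 => tp i
  | 2 => R
  | _ => fun x => forall s, (s <= i - 2)%N ->
           gtens (gtens (tp s) R) (tp (i - s - 2)) x
  end.

(** The cases of the definition merge into one condition over all positions [s + 2 + t = i] of R,
    void for [i < 2], and the truncated subtractions disappear. *)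
Lemma gWP i x : gW i x <-> tp i x /\
  forall s t, (s + 2 + t)%N = i -> gtens (gtens (tp s) R) (tp t) x.
Proof.
case: i => [|[|[|i]]] /=.
- by split=> [h|[]//]; split=> // s t; lia.
- by split=> [h|[]//]; split=> // s t; lia.
- split=> [h|[_ h]].
    split=> [|s t e]; first exact: hR.
    have [-> ->] : s = 0%N /\ t = 0%N by lia.
    by apply/gtens_tp0r; [exact: gsubspace_gtens | exact/gtens_tp0l].
  have := h 0%N 0%N erefl.
  move=> /(gtens_tp0r _ (gsubspace_gtens _ (sub_tp 0))).
  by move=> /(gtens_tp0l _ sR).
split=> [h|[_ h] s hs]; last first.
  by apply: h; lia.
split.
  have := h 0%N isT; rewrite (_ : (i.+3 - 0 - 2)%N = i.+1); last by lia.
  apply: gtens_sub => // a b.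
  rewrite gtens_tp0l // => /hR ha hb; have -> : (i.+3 = 2 + i.+1)%N by lia.
  exact: (tt_M H).
move=> s t e; have := h s; rewrite (_ : (i.+3 - s - 2)%N = t); last by lia.
by apply; lia.
Qed.

Lemma gW_tp i x : gW i x -> tp i x.
Proof. by move=> /gWP []. Qed.

Lemma gsubspace_W i : gsubspace (gW i).
Proof.
have st s t := gsubspace_gtens (tp t) (gsubspace_gtens R (sub_tp s)).
split; first by apply/gWP; split=> [|s t _]; [case: (sub_tp i) | case: (st s t)].
move=> c x y /gWP [hx1 hx2] /gWP [hy1 hy2]; apply/gWP; split.
  exact: (sub_tp i).2.
by move=> s t e; apply: (st s t).2; [exact: hx2 | exact: hy2].
Qed.

Lemma tens_RW s t x : gtens (gtens (tp s) R) (tp t) x -> tp (s + 2 + t) x.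
Proof.
apply: gtens_sub => // a b ha hb; apply: (tt_M H) => //.
by move: ha; apply: gtens_sub => // u v hu /hR; exact: (tt_M H).
Qed.

(** The cofactors of a basis of the last factor V are right contractions, and contracting the last
    factor leaves R in every position that W_i prescribes. *)
Lemma W_tensr i x : gW i.+1 x -> gtens (gW i) V x.
Proof.
move=> /gWP [hx hx2].
have hx1 : gtens (tp i) V x by apply/gtens_tp; rewrite addn1.
have [r [v [al [lal hv _ hE]]]] := tt_basis H (sub_tp 1) (fun x h => h).
rewrite (contr_rE (fun x h => h) lal hE hx1); apply: gtens_sum => j _.
apply: gtens_mul => //; apply/gWP; split.
  by apply: (tp_contr_r (lal j) (q := 1)); apply/gtens_tp.
move=> s t e; apply: (contr_r_gtens (lal j) (q := 1)).
- exact: gsubspace_gtens (gsubspace_gtens _ (sub_tp s)).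
- by move=> y /tens_RW; rewrite e.
apply/gtensA; apply: gtens_mono (hx2 s t.+1 _) => //; last by lia.
by move=> y hy; apply/gtens_tp; rewrite addn1.
Qed.

Lemma W_tensl i x : gW i.+1 x -> gtens V (gW i) x.
Proof.
move=> /gWP [hx hx2]; have hx1 : gtens V (tp i) x by apply/gtens_tp.
apply: (gtensl_contr (q := i)) => // a la.
apply/gWP; split; first exact: (tp_contr_l la (p := 1)).
move=> s t e; apply: (contr_l_gtens la (p := 1) (q := i)).
- exact: gsubspace_gtens (gsubspace_gtens _ (sub_tp s)).
- by move=> y /tens_RW; rewrite e.
apply/gtensA; apply: gtens_mono (hx2 s.+1 t _) => //; last by lia.
move=> y hy; apply/gtensA; apply: gtens_mono hy => // z hz.
exact/gtens_tp.
Qed.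

Lemma W_R i x : gW i.+2 x -> gtens (tp i) R x.
Proof.
move=> /gWP [_ h]; have := h i 0%N; rewrite addn0 addn2 => /(_ erefl).
by move=> /(gtens_tp0r _ (gsubspace_gtens _ (sub_tp i))).
Qed.

Lemma W_Rl i x : gW i.+2 x -> gtens R (tp i) x.
Proof.
move=> /gWP [_ h]; have := h 0%N i erefl; apply: gtens_mono => // y.
by move=> /(gtens_tp0l _ sR).
Qed.

(** The first hypothesis puts R in every position but the last, which is the second hypothesis. *)
Lemma W_step i x : gtens (gW i.+1) V x -> gtens (tp i) R x -> gW i.+2 x.
Proof.
move=> h1 h2; apply/gWP; split.
  have -> : i.+2 = (i + 2)%N by lia.
  by apply/gtens_tp; apply: gtens_mono h2.
move=> s [|t] e.
  have -> : s = i by lia.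
  exact/(gtens_tp0r _ (gsubspace_gtens _ (sub_tp i))).
have : gtens (gtens (gtens (tp s) R) (tp t)) V x.
  by apply: gtens_mono h1 => // y /gWP [_]; apply; lia.
move=> /gtensA; apply: gtens_mono => // y /gtens_tp.
by rewrite addn1.
Qed.

Record W_bases := WBases {
  wr : nat -> nat;
  wb : forall i, 'I_(wr i) -> T;
  wd : forall i, 'I_(wr i) -> T -> k;
  wd_lin : forall i j, linear (@wd i j : T -> k^o);
  wbW : forall i j, gW i (@wb i j);
  wdE : forall i (j l : 'I_(wr i)), @wd i j (@wb i l) = (j == l)%:R;
  wbE : forall i x, gW i x -> x = \sum_(j < wr i) @wd i j x *: @wb i j
}.

Lemma W_bases_exist : inhabited W_bases.
Proof.
have h i := tt_basis H (gsubspace_W i) (@gW_tp i).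
have [r h1] := choice h.
pose ok i (w : 'I_(r i) -> T) (al : 'I_(r i) -> T -> k) :=
  [/\ forall j, linear (al j : T -> k^o), forall j, gW i (w j),
      forall j l, al j (w l) = (j == l)%:R
    & forall x, gW i x -> x = \sum_j al j x *: w j].
(* The types of [w] and [al] depend on [r], so they are chosen one after the other. *)
have [w h2] : exists w : forall i, 'I_(r i) -> T, forall i, exists al, ok i (w i) al.
  by exists (fun i => sval (cid (h1 i))) => i; exact: (svalP (cid (h1 i))).
have [al h3] : exists al : forall i, 'I_(r i) -> T -> k, forall i, ok i (w i) (al i).
  by exists (fun i => sval (cid (h2 i))) => i; exact: (svalP (cid (h2 i))).
by split; exists r w al => i; case: (h3 i).
Qed.

(** * Structure matrices of the Koszul complexes *)

Section Koszul.
Variable K : W_bases.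

(** Cofactors of [wb l] in [wb j], on the right in [Mr] and on the left in [Nl] (see [wb_Mr] and
    [wb_Nl]). Their images in A are the entries of the Koszul differentials. *)
Definition Mr i (j : 'I_(wr K i.+1)) (l : 'I_(wr K i)) : T := contr_l i (wd l) (wb j).
Definition Nl i (j : 'I_(wr K i.+1)) (l : 'I_(wr K i)) : T := contr_r 1 (wd l) (wb j).

Lemma wb_tp i (j : 'I_(wr K i)) : tp i (wb j).
Proof. exact: gW_tp (wbW j). Qed.

Lemma Mr_tp i j l : tp 1 (@Mr i j l).
Proof. by apply: (tp_contr_l (wd_lin l) (q := 1)); rewrite addn1; exact: wb_tp. Qed.

Lemma Nl_tp i j l : tp 1 (@Nl i j l).
Proof. by apply: (tp_contr_r (wd_lin l) (p := 1) (q := i)); exact: wb_tp. Qed.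

Lemma wb_Mr i (j : 'I_(wr K i.+1)) : wb j = \sum_l wb l * Mr j l.
Proof.
exact: (contr_lE (@gW_tp i) (@wd_lin K i) (@wbE K i) (W_tensr (wbW j))).
Qed.

Lemma wb_Nl i (j : 'I_(wr K i.+1)) : wb j = \sum_l Nl j l * wb l.
Proof.
exact: (contr_rE (@gW_tp i) (@wd_lin K i) (@wbE K i) (W_tensl (wbW j))).
Qed.

Lemma contr_l_wb q i (v : 'I_(wr K i) -> T) m : (forall l, tp q (v l)) ->
  contr_l i (wd m) (\sum_l wb l * v l) = v m.
Proof.
move=> hv; rewrite (lin_sum (contr_l_linear _ _)) (bigD1 m) //=.
rewrite (contr_lM (wd_lin m) (wb_tp m) (hv m)).
rewrite wdE eqxx scale1r big1 ?addr0 // => l hl.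
by rewrite (contr_lM (wd_lin m) (wb_tp l) (hv l)) wdE eq_sym (negPf hl) scale0r.
Qed.

(** This is [wb j], an element of V^i (x) R, contracted by [wd m] on its first i factors. In A it
    says that the right Koszul differential squares to zero. *)
Lemma Mr_Mr i (j : 'I_(wr K i.+2)) (m : 'I_(wr K i)) :
  R (\sum_l Mr l m * Mr j l).
Proof.
have h := contr_l_gtens (wd_lin m) sR hR (W_R (wbW j)).
move: h; rewrite wb_Mr (lin_sum (contr_l_linear _ _)); congr R.
apply: eq_bigr => l _.
rewrite (contr_l_mul (wd_lin m) (q := 1) _ (Mr_tp j l)) // addn1; exact: wb_tp.
Qed.

Lemma Nl_Nl i (j : 'I_(wr K i.+2)) (m : 'I_(wr K i)) :
  R (\sum_l Nl j l * Nl l m).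
Proof.
have h := contr_r_gtens (p := 2) (wd_lin m) sR hR (W_Rl (wbW j)).
move: h; rewrite wb_Nl (lin_sum (contr_r_linear _ _)); congr R.
apply: eq_bigr => l _.
exact: (contr_r_mul (wd_lin m) (p := 1) (q := 1) (s := i) (Nl_tp j l) (wb_tp l)).
Qed.

(** Both sides are id (x) [wd m] (x) id applied to [wb j] in V (x) V^i (x) V. This coassociativity
    will cancel the mixed terms of the squared bimodule differential. *)
Lemma Nl_Mr i (j : 'I_(wr K i.+2)) (m : 'I_(wr K i)) :
  \sum_l Nl j l * Mr l m = \sum_l Nl l m * Mr j l.
Proof.
have idl : linear (id : T -> T) by [].
have e1 : \sum_l Nl j l * Mr l m = tm 1 id (contr_l i (wd m)) (wb j).
  rewrite [in RHS]wb_Nl (lin_sum (tt_lin H _ _ _)); apply: eq_bigr => l _.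
  by rewrite (tt_tm H idl (contr_l_linear _ _) (Nl_tp j l) (wb_tp l)).
have e2 : \sum_l Nl l m * Mr j l = tm i.+1 (contr_r 1 (wd m)) id (wb j).
  rewrite [in RHS]wb_Mr (lin_sum (tt_lin H _ _ _)); apply: eq_bigr => l _.
  by rewrite (tt_tm H (contr_r_linear _ _) idl (wb_tp l) (Mr_tp j l)).
rewrite e1 e2; have := wb_tp j.
move: (wb j); have -> : i.+2 = (1 + i + 1)%N by lia.
apply: tens3_ind.
  by apply: gsubspace_eq; exact: (tt_lin H).
have ld := @wd_lin K i m.
move=> x y z hx hy hz.
rewrite [RHS](tt_tm H (contr_r_linear _ _) idl (tt_M H hx hy) hz) -mulrA.
rewrite (tt_tm H idl (contr_l_linear _ _) hx (tt_M H hy hz)).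
by rewrite (contr_lM ld hy hz) (contr_rM ld hx hy) -(tt_ZAr H) scalerAl.
Qed.

(** The sum y of the [wb l * v l] lies in W_(i+1) (x) V and, after expanding each [wb l], in V^i (x)
    R. Hence it lies in W_(i+2), and [c] are its coordinates there. This is exactness of the Koszul
    complex on entries of degree one. *)
Lemma Mr_kernel i (v : 'I_(wr K i.+1) -> T) : (forall l, tp 1 (v l)) ->
  (forall m, R (\sum_l Mr l m * v l)) ->
  exists c : 'I_(wr K i.+2) -> k, forall l, v l = \sum_j c j *: Mr j l.
Proof.
move=> hv hR'; pose y := \sum_l wb l * v l.
have Wy : gW i.+2 y.
  apply: W_step; first by apply: gtens_sum => l _; apply: gtens_mul => //; exact: wbW.
  have -> : y = \sum_m wb m * \sum_l Mr l m * v l.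
    rewrite /y; under eq_bigr do rewrite wb_Mr mulr_suml.
    rewrite exchange_big; apply: eq_bigr => m _; rewrite mulr_sumr.
    by apply: eq_bigr => l _; rewrite mulrA.
  by apply: gtens_sum => m _; apply: gtens_mul; [exact: wb_tp | exact: hR'].
exists (fun j => wd j y) => l.
rewrite -(contr_l_wb l hv) -/y {1}(@wbE K _ _ Wy) (lin_sum (contr_l_linear _ _)).
by apply: eq_bigr => j _; rewrite (linZ (contr_l_linear _ _)).
Qed.

Lemma Mr_kernel0 (v : 'I_(wr K 0) -> T) : (forall l, tp 1 (v l)) ->
  exists c : 'I_(wr K 1) -> k, forall l, v l = \sum_j c j *: Mr j l.
Proof.
move=> hv; pose y := \sum_l wb l * v l.
have Wy : gW 1 y.
  by apply: (gsubspace_sum (sub_tp 1)) => l _; apply: (tt_M H (wb_tp l) (hv l)).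
exists (fun j => wd j y) => l.
rewrite -(contr_l_wb l hv) -/y {1}(@wbE K _ _ Wy) (lin_sum (contr_l_linear _ _)).
by apply: eq_bigr => j _; rewrite (linZ (contr_l_linear _ _)).
Qed.

Lemma Mr_inj i (c : 'I_(wr K i.+1) -> k) :
  (forall l, \sum_j c j *: Mr j l = 0) -> forall j, c j = 0.
Proof.
move=> h j; have e : \sum_j c j *: wb j = 0.
  under eq_bigr do rewrite wb_Mr scaler_sumr.
  rewrite exchange_big big1 // => l _.
  by under eq_bigr do rewrite (tt_ZAr H); rewrite -mulr_sumr h mulr0.
have ld := @wd_lin K i.+1 j.
have := congr1 (wd j) e; rewrite (lin0 ld) (lin_sum ld) (bigD1 j) //= (linZ ld) wdE eqxx.
rewrite big1 ?addr0 => [|l hl]; first by move=> <-; rewrite /GRing.scale /= mulr1.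
by rewrite (linZ ld) wdE eq_sym (negPf hl) scaler0.
Qed.

(* If W_i is a line, the coordinates of its generator are inverse to those of *)
(* the basis.                                                                 *)
Lemma W_line i (om : T) : gW i om ->
  (forall x, gW i x -> exists c : k, x = c *: om) ->
  exists la ka : 'I_(wr K i) -> k,
  [/\ forall j, wb j = la j *: om, om = \sum_j ka j *: wb j
    & forall j l, ka j * la l = (j == l)%:R].
Proof.
move=> hom hline; have [la hla] := choice (fun j : 'I_(wr K i) => hline _ (wbW j)).
exists la, (fun j => wd j om); split=> //; first exact: wbE.
by move=> j l; rewrite -wdE hla (linZ (wd_lin j)) mulrC.
Qed.

End Koszul.
End WSpaces.
End TensorTheory.

(** * Differences of sequence pairs *)

Section PairDifference.
Variables (k : fieldType) (T : lalgType k).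
Variables (tp : nat -> T -> Prop) (tm : nat -> (T -> T) -> (T -> T) -> T -> T).
Hypothesis H : tensor_theory tp tm.
Variables (R : T -> Prop) (sR : gsubspace R) (hR : forall x, R x -> tp 2 x).
Local Notation W := (gW tp R).

Let ltm p f g : linear (tm p f g) := @tt_lin _ _ _ _ H p f g.

Lemma tm_ext p q (P : T -> Prop) (f f' g g' : T -> T) x :
  linear f -> linear f' -> linear g -> linear g' ->
  (forall y, P y -> tp p y /\ f y = f' y) -> (forall y, tp q y -> g y = g' y) ->
  gtens P (tp q) x -> tm p f g x = tm p f' g' x.
Proof.
move=> lf lf' lg lg' hf hg; move: x; apply: gtens_ind.
  by apply: gsubspace_eq; exact: ltm.
move=> a b /hf [ha fa] hb.
by rewrite (tt_tm H lf lg ha hb) (tt_tm H lf' lg' ha hb) fa (hg _ hb).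
Qed.

Lemma lin_sub (f g : T -> T) : linear f -> linear g -> linear (fun x => f x - g x).
Proof. by move=> lf lg c x y; rewrite lf lg scalerBr opprD addrACA. Qed.

Lemma lin_scale (c : k) (f : T -> T) : linear f -> linear (fun x => c *: f x).
Proof. by move=> lf e x y; rewrite lf scalerDr !scalerA mulrC. Qed.

Lemma tm_subl p q (f f' g : T -> T) x : linear f -> linear f' -> linear g ->
  tp (p + q) x -> tm p (fun y => f y - f' y) g x = tm p f g x - tm p f' g x.
Proof.
move=> lf lf' lg; move: x; apply: (tp_cat_ind H).
  by apply: gsubspace_eq; [exact: ltm | apply: lin_sub; exact: ltm].
move=> a b ha hb; rewrite (tt_tm H lf lg ha hb) (tt_tm H lf' lg ha hb).
by rewrite (tt_tm H (lin_sub lf lf') lg ha hb) mulrBl.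
Qed.

Lemma tm_subr p q (f g g' : T -> T) x : linear f -> linear g -> linear g' ->
  tp (p + q) x -> tm p f (fun y => g y - g' y) x = tm p f g x - tm p f g' x.
Proof.
move=> lf lg lg'; move: x; apply: (tp_cat_ind H).
  by apply: gsubspace_eq; [exact: ltm | apply: lin_sub; exact: ltm].
move=> a b ha hb; rewrite (tt_tm H lf lg ha hb) (tt_tm H lf lg' ha hb).
by rewrite (tt_tm H lf (lin_sub lg lg') ha hb) mulrBr.
Qed.

Lemma tm_scalel p q (c : k) (f g : T -> T) x : linear f -> linear g ->
  tp (p + q) x -> tm p (fun y => c *: f y) g x = c *: tm p f g x.
Proof.
move=> lf lg; move: x; apply: (tp_cat_ind H).
  by apply: gsubspace_eq; [exact: ltm | apply: lin_scale; exact: ltm].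
move=> a b ha hb; rewrite (tt_tm H lf lg ha hb).
by rewrite (tt_tm H (lin_scale c lf) lg ha hb) scalerAl.
Qed.

Let idl : linear (id : T -> T). Proof. by []. Qed.

Lemma tm_tm_id p q s (f : T -> T) x : linear f -> tp (p + q + s) x ->
  tm (p + q) (tm p f id) id x = tm p f id x.
Proof.
move=> lf; move: x; apply: (tens3_ind H).
  by apply: gsubspace_eq; exact: ltm.
move=> x y z hx hy hz; rewrite (tt_tm H (ltm _ _ _) idl (tt_M H hx hy) hz).
by rewrite (tt_tm H lf idl hx hy) -!mulrA (tt_tm H lf idl hx (tt_M H hy hz)).
Qed.

Lemma tm_assoc p q s (f g h : T -> T) x : linear f -> linear g -> linear h ->
  tp (p + q + s) x -> tm (p + q) (tm p f g) h x = tm p f (tm q g h) x.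
Proof.
move=> lf lg lh; move: x; apply: (tens3_ind H).
  by apply: gsubspace_eq; exact: ltm.
move=> x y z hx hy hz; rewrite (tt_tm H (ltm _ _ _) lh (tt_M H hx hy) hz).
rewrite (tt_tm H lf lg hx hy) -!mulrA (tt_tm H lf (ltm _ _ _) hx (tt_M H hy hz)).
by rewrite (tt_tm H lg lh hy hz) mulrA.
Qed.

Variables (sigma : T -> T) (lsigma : linear sigma).
Hypothesis sigma1 : forall v, tp 1 v -> tp 1 (sigma v).
Variables (F : nat -> T -> T) (lF : forall i, linear (F i)).
Hypothesis F_tp : forall i x, tp i x -> tp i (F i x).

(* In the first compatibility condition m_B has been replaced by its kernel   *)
(* R on V (x) V, and F i stands for the i-th tensor power of sigma.           *)
Record gpair (delta : T -> T) (dr dl : nat -> T -> T) : Prop := GPair {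
  gp_lin : linear delta;
  gp_lr : forall i, linear (dr i);
  gp_ll : forall i, linear (dl i);
  gp_tp : forall v, tp 1 v -> tp 2 (delta v);
  gp_1 : forall v, tp 1 v -> dr 1%N v = delta v /\ dl 1%N v = delta v;
  gp_Wr : forall i x, W i.+1 x -> gtens (W i.+1) (tp 1) (dr i.+1 x);
  gp_mB : forall i x, W i.+2 x -> gtens (tp i.+1) R
    (dr i.+2 x - tm i.+1 (F i.+1) delta x - tm i.+1 (dr i.+1) id x);
  gp_rl : forall i x, W i.+1 x -> dr i.+1 x + (-1) ^+ i.+1 *: dl i.+1 x
    = tm 1 sigma (dr i) x + (-1) ^+ i.+1 *: tm i (dl i) id x
}.

Variables (delta delta' : T -> T) (dr dl dr' dl' : nat -> T -> T).
Hypotheses (hp : gpair delta dr dl) (hp' : gpair delta' dr' dl').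
Hypothesis hdelta : forall v, tp 1 v -> R (delta v - delta' v).

Let D i x := dr i x - dr' i x.
Let E i x := dl i x - dl' i x.

(** Unfolded, the alternating sum D_i - D_(i-1) (x) id + D_(i-2) (x) id (x) id - ... *)
Fixpoint G i : T -> T :=
  match i with
  | 0 => fun=> 0
  | i.+1 => fun x => D i.+1 x - tm i (G i) id x
  end.

Let lD i : linear (D i).
Proof. by apply: lin_sub; [exact: gp_lr hp i | exact: gp_lr hp' i]. Qed.

Let lE i : linear (E i).
Proof. by apply: lin_sub; [exact: gp_ll hp i | exact: gp_ll hp' i]. Qed.

Lemma lG i : linear (G i).
Proof.
case: i => [|i] /=; first by move=> c x y; rewrite scaler0 addr0.
exact: lin_sub (lD _) (ltm _ _ _).
Qed.

Let GS i x : G i.+1 x = D i.+1 x - tm i (G i) id x.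
Proof. by []. Qed.

Let D_G i x : D i.+1 x = G i.+1 x + tm i (G i) id x.
Proof. by rewrite GS subrK. Qed.

Let tm_0 p x : tp (p + 1) x -> tm p (fun=> 0) id x = 0.
Proof.
move: x; apply: (tp_cat_ind H).
  by split=> [|c x y hx hy]; rewrite ?(lin0 (ltm _ _ _)) // ltm hx hy scaler0 addr0.
move=> a b ha hb; rewrite (tt_tm H _ idl ha hb) ?mul0r //.
by move=> c x y; rewrite scaler0 addr0.
Qed.

(** The cofactors of a basis of W_i in [x] are contractions of an element of V^i (x) R, hence lie in
    R. *)
Lemma W_tensR i x : W i.+2 x -> gtens (W i) R x.
Proof.
move=> hx; have [r [w [al [lal hw _ hE]]]] :=
  tt_basis H (gsubspace_W H sR hR i) (@gW_tp _ _ _ _ H _ sR hR i).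
have h : gtens (W i) (tp (1 + 1)) x.
  have : gtens (gtens (W i) (tp 1)) (tp 1) x.
    apply: gtens_mono (W_tensr H sR hR hx) => // y; exact: (W_tensr H sR hR).
  by move=> /gtensA; apply: gtens_mono => // y /(gtens_tp H).
rewrite (contr_lE H (@gW_tp _ _ _ _ H _ sR hR i) lal hE h).
apply: gtens_sum => j _; apply: gtens_mul => //.
exact: (contr_l_gtens H (lal j) sR hR) (W_R H sR hR hx).
Qed.

Let D_tens i x : W i.+1 x -> gtens (W i.+1) (tp 1) (D i.+1 x).
Proof.
move=> hx; apply: (gsubspaceB (gsubspace_gtens _ (gsubspace_W H sR hR i.+1))).
  exact: (gp_Wr hp).
exact: (gp_Wr hp').
Qed.

(** Subtracting condition (1) for the two pairs leaves the term F (x) (delta - delta'), and delta -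
    delta' maps V into R. *)
Let D_mB i x : W i.+2 x ->
  gtens (tp i.+1) R (D i.+2 x - tm i.+1 (D i.+1) id x).
Proof.
move=> hx; have tx : tp (i.+1 + 1) x by rewrite addn1; exact: (gW_tp H sR hR hx).
have sS := gsubspace_gtens R (tt_sub H i.+1).
pose y := tm i.+1 (F i.+1) (fun v => delta v - delta' v) x.
have hy : gtens (tp i.+1) R y.
  move: x tx @y {hx}; apply: (tp_cat_ind H).
    split; first by rewrite (lin0 (ltm _ _ _)); exact: gtens_zero.
    by move=> c u v hu hv; rewrite ltm; case: sS => _; apply.
  move=> a b ha hb; rewrite (tt_tm H (@lF _) _ ha hb).
    by apply: gtens_mul; [exact: F_tp | exact: hdelta].
  by apply: lin_sub; [exact: gp_lin hp | exact: gp_lin hp'].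
have := gsubspaceD sS (gsubspaceB sS (gp_mB hp hx) (gp_mB hp' hx)) hy.
rewrite /y (tm_subr (@lF _) (gp_lin hp) (gp_lin hp') tx).
rewrite (tm_subl (gp_lr hp _) (gp_lr hp' _) idl tx) /D.
set a1 := dr _ x; set a2 := dr' _ x; set b1 := tm _ _ delta x; set b2 := tm _ _ delta' x.
set c1 := tm _ (dr _) _ x; set c2 := tm _ (dr' _) _ x.
have s4 (u v x' y' : T) : (u - v) - (x' - y') = (u - x') - (v - y').
  by rewrite !opprD !opprK addrACA.
congr (gtens _ _ _).
by rewrite s4 (s4 a1) addrAC subrK.
Qed.

(** By [W_step] two memberships suffice. The one in W_(i+2) (x) V comes from [D_tens] and induction;
    the one in V^(i+1) (x) R comes from [D_mB], once G is unfolded twice. *)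
Lemma G_W i x : W i x -> W i.+1 (G i x).
Proof.
elim/ltn_ind: i x => -[_|[_|i IH]] x hx.
- by rewrite /=; case: (tt_sub H 1).
- have tx : tp (0 + 1) x by [].
  rewrite /= (tm_0 tx) subr0 /D.
  by rewrite (gp_1 hp tx).1 (gp_1 hp' tx).1; exact: hdelta.
have tx : tp (i.+1 + 1) x by rewrite addn1; exact: (gW_tp H sR hR hx).
have IH1 := IH i.+1 (ltnSn _); have IH0 := IH i (leqnSn _).
apply: (W_step H sR hR).
  have sS := gsubspace_gtens (tp 1) (gsubspace_W H sR hR i.+2).
  rewrite GS; apply: (gsubspaceB sS (D_tens hx)).
  move: x {hx tx} (W_tensr H sR hR hx); apply: gtens_ind.
    split; first by rewrite (lin0 (ltm _ _ _)); exact: gtens_zero.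
    by move=> c u v hu hv; rewrite ltm; case: sS => _; apply.
  move=> a b ha hb; rewrite (tt_tm H (lG _) idl (gW_tp H sR hR ha) hb).
  by apply: gtens_mul => //; exact: IH1.
have sS := gsubspace_gtens R (tt_sub H i.+1).
(* The extra term is G_i (x) id (x) id, which sends W_i (x) R into W_(i+1) (x) R. *)
have -> : G i.+2 x = (D i.+2 x - tm i.+1 (D i.+1) id x) + tm i (G i) id x.
  have e : tm i.+1 (tm i (G i) id) id x = tm i (G i) id x.
    rewrite -[in LHS](addn1 i) (tm_tm_id (s := 1)) //; first exact: lG.
    by rewrite addn1.
  have -> : tm i.+1 (D i.+1) id x = tm i.+1 (G i.+1) id x + tm i (G i) id x.
    rewrite -e; have := tm_subl (@lD i.+1) (ltm i (G i) id) idl tx.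
    by rewrite -/(G i.+1) => ->; rewrite subrK.
  by rewrite opprD addrA subrK.
apply: (gsubspaceD sS (D_mB hx)).
move: x {hx tx} (W_tensR hx); apply: gtens_ind.
  split; first by rewrite (lin0 (ltm _ _ _)); exact: gtens_zero.
  by move=> c u v hu hv; rewrite ltm; case: sS => _; apply.
move=> a b ha hb; rewrite (tt_tm H (@lG _) idl (gW_tp H sR hR ha) (hR hb)).
apply: gtens_mul => //; exact: (gW_tp H sR hR (IH0 _ ha)).
Qed.

Let sgn i : k := (-1) ^+ i.

(** Induction on condition (2): the term sigma (x) G_i (x) id occurs in sigma (x) D_(i+1) and, with
    the opposite sign, in the contribution of E_(i+1) (x) id. *)
Let EG i x : W i.+1 x -> E i.+1 x = sgn i.+1 *: (tm 1 sigma (G i) x - G i.+1 x).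
Proof.
have sgnS j : sgn j.+1 = - sgn j by rewrite /sgn exprS mulN1r.
have sgn2 j : sgn j * sgn j = 1 by rewrite /sgn -expr2 sqrr_sign.
elim: i x => [|i IH] x hx.
  have tx : tp (0 + 1) x by [].
  have e0 : tm 1 sigma (G 0) x = 0.
    have e : tp (1 + 0) x by [].
    move: x e {hx tx}; apply: (tp_cat_ind H).
      by split=> [|c u v hu hv]; rewrite ?(lin0 (ltm _ _ _)) // ltm hu hv scaler0 addr0.
    by move=> a b ha hb; rewrite (tt_tm H lsigma (@lG 0) ha hb) /= mulr0.
  rewrite e0 sub0r /= (tm_0 tx) subr0 sgnS /sgn expr0 scaleN1r opprK.
  by rewrite /D /E (gp_1 hp tx).1 (gp_1 hp tx).2 (gp_1 hp' tx).1 (gp_1 hp' tx).2.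
have wx := gW_tp H sR hR hx.
have tx1 : tp (1 + i.+1) x by rewrite add1n.
have tx2 : tp (i.+1 + 1) x by rewrite addn1.
have e1 : tm 1 sigma (D i.+1) x
    = tm 1 sigma (G i.+1) x + tm 1 sigma (tm i (G i) id) x.
  have := tm_subr lsigma (@lD i.+1) (ltm i (G i) id) tx1.
  by rewrite -/(G i.+1) => ->; rewrite subrK.
have e2 : tm i.+1 (E i.+1) id x
    = sgn i.+1 *: (tm i.+1 (tm 1 sigma (G i)) id x - tm i.+1 (G i.+1) id x).
  rewrite -(tm_subl (ltm _ _ _) (@lG _) idl tx2).
  rewrite -(tm_scalel _ (lin_sub (ltm _ _ _) (@lG _)) idl tx2).
  apply: (tm_ext _ _ idl idl _ (fun _ _ => erefl) (W_tensr H sR hR hx)) => //.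
  by apply: lin_scale; apply: lin_sub; [exact: ltm | exact: lG].
  by move=> y hy; split; [exact: (gW_tp H sR hR hy) | exact: IH].
have e3 : tm i.+1 (tm 1 sigma (G i)) id x = tm 1 sigma (tm i (G i) id) x.
  by apply: (@tm_assoc 1 i 1 _ _ _ x lsigma (lG i) idl); rewrite add1n addn1.
have e4 : D i.+2 x + sgn i.+2 *: E i.+2 x
    = tm 1 sigma (D i.+1) x + sgn i.+2 *: tm i.+1 (E i.+1) id x.
  rewrite (tm_subr lsigma (gp_lr hp _) (gp_lr hp' _) tx1).
  rewrite (tm_subl (gp_ll hp _) (gp_ll hp' _) idl tx2) /D /E.
  rewrite !scalerBr addrACA -opprD (gp_rl hp hx) (gp_rl hp' hx).
  by rewrite opprD addrACA.
have := congr1 (fun y => sgn i.+2 *: (y - D i.+2 x)) e4.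
rewrite addrAC subrr add0r scalerA sgn2 scale1r => ->.
congr (_ *: _); rewrite e1 e2 e3 scalerA [sgn i.+2]sgnS mulNr sgn2 scaleN1r opprB.
rewrite D_G; set a := tm 1 sigma (G i.+1) x; set b := tm 1 sigma _ x.
set c := tm i.+1 _ _ x; set g := G i.+2 x.
by rewrite -[a + b + _]addrA [b + _]addrC subrK [g + c]addrC opprD addrA addrK.
Qed.

Variable K : W_bases tp R.
Variables (d : nat) (om : T) (la ka : 'I_(wr K d.+1) -> k).
Hypotheses (hom : W d.+1 om) (om0 : om <> 0).
Hypothesis hline : forall x, W d.+1 x -> exists c : k, x = c *: om.
Hypothesis hka : om = \sum_j ka j *: wb j.
Hypothesis top : forall x, W d.+2 x -> x = 0.

(** G_(d+1) vanishes because W_(d+2) does, and G_d sends each basis element [wb j] of W_d to [ga j]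
    times [om]. [D_G] and [EG] then express both differences through [ga], up to the factor [om]. *)
Theorem pair_difference (er el er' el' : T) :
  tp 1 er -> tp 1 el -> tp 1 er' -> tp 1 el' ->
  dr d.+1 om = om * er -> dl d.+1 om = el * om ->
  dr' d.+1 om = om * er' -> dl' d.+1 om = el' * om ->
  exists ga : 'I_(wr K d) -> k,
    er - er' = \sum_l \sum_j (ka l * ga j) *: Mr tm l j /\
    el - el' = (-1) ^+ d.+1 *: sigma (\sum_l \sum_j (ka l * ga j) *: Nl tm l j).
Proof.
move=> h1 h2 h3 h4 e1 e2 e3 e4.
have hg (j : 'I_(wr K d)) : exists c : k, G d (wb j) = c *: om.
  by apply: hline; apply: G_W; exact: wbW.
have [ga hga] := choice hg; exists ga.
have Gom : G d.+1 om = 0 by apply: top; apply: G_W.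
have wt i (j : 'I_(wr K i)) : tp i (wb j) := wb_tp H sR hR j.
have eX : D d.+1 om = om * \sum_l \sum_j (ka l * ga j) *: Mr tm l j.
  rewrite D_G Gom add0r {1}hka (lin_sum (ltm _ _ _)) mulr_sumr.
  apply: eq_bigr => l _; rewrite (linZ (ltm _ _ _)) (wb_Mr H sR hR).
  rewrite (lin_sum (ltm _ _ _)) scaler_sumr mulr_sumr; apply: eq_bigr => j _.
  rewrite (tt_tm H (@lG _) idl (wt _ _) (Mr_tp H sR hR _ _)) hga.
  by rewrite -(tt_ZAr H) -scalerAl scalerA.
have eY : E d.+1 om = (-1) ^+ d.+1 *: sigma (\sum_l \sum_j (ka l * ga j) *: Nl tm l j) * om.
  rewrite (EG hom) Gom subr0 -scalerAl; congr (_ *: _).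
  rewrite {1}hka (lin_sum (ltm _ _ _)) (lin_sum lsigma) mulr_suml.
  apply: eq_bigr => l _; rewrite (linZ (ltm _ _ _)) (wb_Nl H sR hR).
  rewrite (lin_sum (ltm _ _ _)) (lin_sum lsigma) scaler_sumr mulr_suml.
  apply: eq_bigr => j _.
  rewrite (tt_tm H lsigma (@lG _) (Nl_tp H sR hR _ _) (wt _ _)) hga (linZ lsigma).
  by rewrite -(tt_ZAr H) -scalerAl scalerA.
(* Some coordinate of [om] is non-zero; contracting by this functional cancels the factor [om]. *)
have [a la' aom] : exists2 a : T -> k, linear (a : T -> k^o) & a om <> 0.
  apply: contrapT => hno; apply: om0; rewrite hka big1 // => j _.
  apply: contrapT => hj; apply: hno; exists (wd j); first exact: wd_lin.
  rewrite hka (lin_sum (wd_lin j)) (bigD1 j) //= (linZ (wd_lin j)) wdE eqxx.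
  rewrite big1 => [|i hi]; last by rewrite (linZ (wd_lin j)) wdE eq_sym (negPf hi) scaler0.
  rewrite addr0 /GRing.scale /= mulr1 => e; apply: hj; by rewrite e scale0r.
have om_t := gW_tp H sR hR hom.
have cancel_l x y : tp 1 x -> tp 1 y -> om * x = om * y -> x = y.
  move=> hx hy /(congr1 (contr_l tm d.+1 a)).
  rewrite (contr_lM H la' om_t hx) (contr_lM H la' om_t hy).
  by apply: scalerI; apply/eqP.
have cancel_r x y : tp 1 x -> tp 1 y -> x * om = y * om -> x = y.
  move=> hx hy /(congr1 (contr_r tm 1 a)).
  rewrite (contr_rM H la' hx om_t) (contr_rM H la' hy om_t).
  by apply: scalerI; apply/eqP.
have s1 := tt_sub H 1.
split.
  apply: cancel_l; first exact: gsubspaceB.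
    apply: (gsubspace_sum s1) => l _; apply: (gsubspace_sum s1) => j _.
    by apply: (gsubspaceZ s1); exact: Mr_tp.
  by rewrite -eX mulrBr -e1 -e3.
apply: cancel_r; first exact: gsubspaceB.
  apply: (gsubspaceZ s1); apply: sigma1.
  apply: (gsubspace_sum s1) => l _; apply: (gsubspace_sum s1) => j _.
  by apply: (gsubspaceZ s1); exact: Nl_tp.
by rewrite -eY mulrBl -e2 -e4.
Qed.

End PairDifference.

Lemma sum_pred1_seq (N : nmodType) (I : eqType) (s : seq I) i (F : I -> N) :
  uniq s -> i \in s -> \sum_(j <- s | j == i) F j = F i.
Proof.
move=> us hi; rewrite big_mkcond (bigD1_seq i) //= eqxx big1 ?addr0 //.
by move=> j /negPf ->.
Qed.

(** * Graded modules and bases *)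

Section Gradings.
Variables (M : zmodType) (D : int -> M -> Prop) (hD : is_grading D).

Lemma gr0 i : D i 0.
Proof. by case: hD. Qed.

Lemma grB i x y : D i x -> D i y -> D i (x - y).
Proof. by case: hD => _ h _ _; exact: h. Qed.

Lemma grN i x : D i x -> D i (- x).
Proof. by move=> hx; rewrite -sub0r; apply: grB (gr0 i) hx. Qed.

Lemma grD i x y : D i x -> D i y -> D i (x + y).
Proof. by move=> hx hy; rewrite -[y]opprK; apply: grB hx (grN hy). Qed.

Lemma gr_sum i (I : Type) (s : seq I) (P : pred I) (F : I -> M) :
  (forall j, P j -> D i (F j)) -> D i (\sum_(j <- s | P j) F j).
Proof.
move=> hF; apply: big_ind => //; [exact: gr0 | by move=> x y; exact: grD].
Qed.

Lemma gr_decomp x : exists s : seq (int * M),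
  (forall p, p \in s -> D p.1 p.2) /\ x = \sum_(p <- s) p.2.
Proof.
case: hD => _ _ h _; have [s [F [hF ->]]] := h x.
exists [seq (i, F i) | i <- s]; split; last by rewrite big_map.
by move=> p /mapP [i _ ->].
Qed.

(** Uniqueness of the decomposition, applied to the parts of the listed sum by degree, with [x]
    subtracted in degree m. *)
Lemma gr_component m x (s : seq (int * M)) : (forall p, p \in s -> D p.1 p.2) ->
  x = \sum_(p <- s) p.2 -> D m x -> x = \sum_(p <- s | p.1 == m) p.2.
Proof.
move=> hs ex hx; pose u := undup (m :: map fst s).
pose F i := \sum_(p <- s | p.1 == i) p.2 - (if i == m then x else 0).
have mu : m \in u by rewrite mem_undup inE eqxx.
have hF i : D i (F i).
  apply: grB; first by rewrite big_seq_cond; apply: gr_sum => p /andP [/hs h /eqP <-].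
  by case: eqP => [->|_] //; exact: gr0.
have sF : \sum_(i <- u) F i = 0.
  rewrite /F big_split sumrN /= -big_mkcond /= sum_pred1_seq ?undup_uniq //.
  rewrite (exchange_big_dep xpredT) //= [in X in _ - X]ex big_seq [in X in _ - X]big_seq.
  apply/eqP; rewrite subr_eq0; apply/eqP; apply: eq_bigr => p hp.
  rewrite (eq_bigl (pred1 p.1)) => [|i]; last by rewrite /= eq_sym.
  by rewrite sum_pred1_seq ?undup_uniq // mem_undup inE map_f ?orbT.
case: hD => _ _ _ h; have := h u F (undup_uniq _) hF sF m mu.
by rewrite /F eqxx => /eqP; rewrite subr_eq0 => /eqP ->.
Qed.

End Gradings.

(** The degree m part of any preimage of a homogeneous element of degree m is again a preimage. *)
Lemma gr_lift (M N : zmodType) (D : int -> M -> Prop) (D' : int -> N -> Prop)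
  (hD : is_grading D) (hD' : is_grading D') (f : M -> N) :
  f 0 = 0 -> {morph f : x y / x + y} ->
  (forall i x, D i x -> D' i (f x)) ->
  forall m x, D' m (f x) -> exists2 x', D m x' & f x' = f x.
Proof.
move=> f0 fD hf m x hy; have fS := big_morph f fD f0.
have [s [hs ex]] := gr_decomp hD x.
exists (\sum_(p <- s | p.1 == m) p.2).
  by rewrite big_seq_cond; apply: (gr_sum hD) => p /andP [/hs h /eqP <-].
have e : f x = \sum_(q <- [seq (p.1, f p.2) | p <- s]) q.2.
  by rewrite big_map ex fS.
rewrite (gr_component hD' _ e hy); first by rewrite big_map fS.
by move=> q /mapP [p hp ->]; apply: hf; exact: hs.
Qed.

Lemma gr_kernel (M N : zmodType) (D : int -> M -> Prop) (D' : int -> N -> Prop)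
  (hD : is_grading D) (hD' : is_grading D') (f : M -> N) :
  f 0 = 0 -> {morph f : x y / x + y} -> (forall i x, D i x -> D' i (f x)) ->
  forall x, f x = 0 -> exists (s : seq int) (F : int -> M),
    (forall i, D i (F i) /\ f (F i) = 0) /\ x = \sum_(i <- s) F i.
Proof.
move=> f0 fD hf x fx; have fS := big_morph f fD f0.
have [s [hs ex]] := gr_decomp hD x.
exists (undup (map fst s)), (fun i => \sum_(p <- s | p.1 == i) p.2); split.
  move=> i; split.
    by rewrite big_seq_cond; apply: (gr_sum hD) => p /andP [/hs h /eqP <-].
  have e : 0 = \sum_(q <- [seq (p.1, f p.2) | p <- s]) q.2 by rewrite big_map /= -fS -ex fx.
  rewrite fS [RHS](gr_component hD' _ e (gr0 hD' i)); first by rewrite big_map.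
  by move=> q /mapP [p hp ->]; apply: hf; exact: hs.
rewrite (exchange_big_dep xpredT) //= ex big_seq [RHS]big_seq; apply: eq_bigr => p hp.
rewrite (eq_bigl (pred1 p.1)) => [|i]; last by rewrite /= eq_sym.
by rewrite sum_pred1_seq ?undup_uniq // mem_undup map_f.
Qed.

Lemma gr_of_list (M : zmodType) (D : int -> M -> Prop) x (s : seq (int * M)) :
  (forall i, D i 0) -> (forall i x y, D i x -> D i y -> D i (x + y)) ->
  (forall p, p \in s -> D p.1 p.2) -> x = \sum_(p <- s) p.2 ->
  exists (s : seq int) (F : int -> M), (forall i, D i (F i)) /\ x = \sum_(i <- s) F i.
Proof.
move=> h0 hA hs ex; exists (undup (map fst s)), (fun i => \sum_(p <- s | p.1 == i) p.2).
split=> [i|].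
  rewrite big_seq_cond; apply: big_ind => // [x1 y1|p /andP [/hs h /eqP <-]] //.
  exact: hA.
rewrite (exchange_big_dep xpredT) //= ex big_seq [RHS]big_seq; apply: eq_bigr => p hp.
rewrite (eq_bigl (pred1 p.1)) => [|i]; last by rewrite /= eq_sym.
by rewrite sum_pred1_seq ?undup_uniq // mem_undup map_f.
Qed.

Section Rows.
Variables (S : nzRingType) (D : int -> S -> Prop) (hD : is_grading D).

Definition row_gr p (d e : int) (x : 'rV[S]_p) : Prop := forall j, D (e - d) (x 0 j).

Lemma is_grading_row p d : is_grading (@row_gr p d).
Proof.
split.
- by move=> e j; rewrite mxE; exact: (gr0 hD).
- by move=> e x y hx hy j; rewrite !mxE; exact: (grB hD (hx j) (hy j)).
- move=> x; have [s hs] := fin_all_exists (fun j : 'I_p => gr_decomp hD (x 0 j)).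
  pose t := flatten [seq [seq (q.1 + d, q.2 *: delta_mx 0 j : 'rV[S]_p) | q <- s j] | j <- enum 'I_p].
  apply: (gr_of_list (s := t)).
  + by move=> e j; rewrite mxE; exact: (gr0 hD).
  + by move=> e y z hy hz j; rewrite !mxE; exact: (grD hD (hy j) (hz j)).
  + move=> q /flattenP [_ /mapP [j _ ->] /mapP [u hu ->]] l /=.
    rewrite mxE addrK mxE eqxx /=; case: (l == j).
      by rewrite mulr1; exact: (hs j).1.
    by rewrite mulr0; exact: (gr0 hD).
  rewrite /t big_flatten big_map big_enum [LHS]row_sum_delta; apply: eq_bigr => j _.
  by rewrite big_map /= -scaler_suml -(hs j).2.
move=> s F us hF e i0 hi0; apply/rowP => j; rewrite mxE.
case: hD => _ _ _ h; pose F' e0 : S := F (e0 + d) 0 j.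
have -> : F i0 0 j = F' (i0 - d) by rewrite /F' subrK.
apply: (h [seq e0 - d | e0 <- s] F').
- by rewrite map_inj_uniq // => a b; exact: addIr.
- by move=> e0; have := hF (e0 + d) j; rewrite addrK.
- rewrite big_map /F'; under eq_bigr do rewrite subrK.
  by have := congr1 (fun M : 'rV[S]_p => M 0 j) e; rewrite /= summxE mxE.
- exact: map_f.
Qed.

Variables (p : nat) (M : lmodType S).

Definition row_lin (v : 'I_p -> M) (x : 'rV[S]_p) : M := \sum_j x 0 j *: v j.

Fact row_lin_linear v : linear (row_lin v).
Proof.
move=> a x y; rewrite /row_lin scaler_sumr -big_split; apply: eq_bigr => j _.
by rewrite !mxE scalerDl scalerA.
Qed.

HB.instance Definition _ v := GRing.isLinear.Build S 'rV[S]_p M *:%R (row_lin v)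
  (row_lin_linear v).

Lemma eq_row_lin (f g : {linear 'rV[S]_p -> M}) :
  (forall j, f (delta_mx 0 j) = g (delta_mx 0 j)) -> f =1 g.
Proof.
move=> h x; rewrite [x]row_sum_delta !linear_sum; apply: eq_bigr => j _.
by rewrite !linearZ h.
Qed.

Lemma row_linE v j : row_lin v (delta_mx 0 j) = v j.
Proof.
rewrite /row_lin (bigD1 j) //= mxE !eqxx scale1r big1 ?addr0 // => l hl.
by rewrite mxE eqxx (negPf hl) scale0r.
Qed.

End Rows.

Lemma row_projective (S : nzRingType) p : projective ('rV[S]_p : lmodType S).
Proof.
move=> X Y g f hg; have [v hv] := choice (fun j : 'I_p => hg (f (delta_mx 0 j))).
exists (row_lin v) => x.
pose u : {linear 'rV[S]_p -> Y} := (g \o row_lin v)%FUN.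
by rewrite -[LHS]/(u x); apply: eq_row_lin => j; rewrite /= row_linE hv.
Qed.

Section Submodule.
Variables (R : nzRingType) (Y : lmodType R) (P : Y -> Prop).

Definition submodule : Prop := P 0 /\ forall a x y, P x -> P y -> P (a *: x + y).

Hypothesis hP : submodule.

(** The closure proof is an argument, so that the submodule structures can be attached to an
    arbitrary predicate. *)
Definition submod_pred (_ : submodule) : {pred Y} := fun y => `[< P y >].

Fact submod_pred_closed : submod_closed (submod_pred hP).
Proof.
split; first by apply/asboolP; case: hP.
by move=> a x y /asboolP hx /asboolP hy; apply/asboolP; case: hP => _; apply.
Qed.

HB.instance Definition _ := GRing.isSubmodClosed.Build R Y (submod_pred hP)
  submod_pred_closed.

Record submod_type := Submod { submod_val : Y; submod_valP : submod_val \in submod_pred hP }.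

HB.instance Definition _ := [isSub for submod_val].
HB.instance Definition _ := [Choice of submod_type by <:].
HB.instance Definition _ := [SubChoice_isSubLmodule of submod_type by <:].

End Submodule.

Section Bases.
Variables (R : nzRingType) (M : lmodType R) (I : eqType) (b : I -> M).
Hypothesis hb : is_basis b.

Lemma eq_linear_basis (N : lmodType R) (f g : {linear M -> N}) :
  (forall i, f (b i) = g (b i)) -> f =1 g.
Proof.
move=> h x; have [s [a ->]] := hb.1 x.
by rewrite !linear_sum; apply: eq_bigr => i _; rewrite !linearZ h.
Qed.

Lemma big_sub_uniq (N : nmodType) (s u : seq I) (F : I -> N) :
  uniq s -> uniq u -> {subset s <= u} -> (forall i, i \notin s -> F i = 0) ->
  \sum_(i <- u) F i = \sum_(i <- s) F i.
Proof.
move=> us uu su hF; rewrite (bigID (mem s)) /= [X in _ + X]big1 ?addr0 //.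
rewrite -big_filter; apply: perm_big; apply: uniq_perm => //; first exact: filter_uniq.
by move=> i; rewrite mem_filter /=; case: (boolP (i \in s)) => // /su.
Qed.

Lemma basis_repr x : exists p : seq I * (I -> R),
  [/\ uniq p.1, forall i, i \notin p.1 -> p.2 i = 0 & x = \sum_(i <- p.1) p.2 i *: b i].
Proof.
have [s [a ->]] := hb.1 x.
exists (undup s, fun i => \sum_(j <- s | j == i) a j); split=> /=.
- exact: undup_uniq.
- by move=> i; rewrite mem_undup => hi; rewrite big_seq_cond big1 // => j /andP [hj /eqP e];
    rewrite e (negPf hi) in hj.
under [RHS]eq_bigr do rewrite scaler_suml.
rewrite [RHS](exchange_big_dep xpredT) //= big_seq [RHS]big_seq; apply: eq_bigr => j hj.
rewrite (eq_bigl (pred1 j)) => [|i]; last by rewrite /= eq_sym.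
by rewrite sum_pred1_seq ?undup_uniq // mem_undup.
Qed.

Lemma basis_coef_unique (s s' : seq I) (a a' : I -> R) : uniq s -> uniq s' ->
  (forall i, i \notin s -> a i = 0) -> (forall i, i \notin s' -> a' i = 0) ->
  \sum_(i <- s) a i *: b i = \sum_(i <- s') a' i *: b i -> a =1 a'.
Proof.
move=> us us' ha ha' e i; pose u := undup (s ++ s').
have hs : {subset s <= u} by move=> j; rewrite mem_undup mem_cat => ->.
have hs' : {subset s' <= u} by move=> j; rewrite mem_undup mem_cat orbC => ->.
have uu : uniq u by exact: undup_uniq.
have e' : \sum_(j <- u) (a j - a' j) *: b j = 0.
  under eq_bigr do rewrite scalerBl; rewrite sumrB.
  rewrite (big_sub_uniq us uu hs) => [|j /ha ->]; last by rewrite scale0r.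
  rewrite (big_sub_uniq us' uu hs') => [|j /ha' ->]; last by rewrite scale0r.
  by rewrite e subrr.
case: (boolP (i \in u)) => hi.
  by apply/eqP; rewrite -subr_eq0; apply/eqP; apply: (hb.2 u (fun j => a j - a' j) uu e').
by rewrite ha ?ha' //; apply: contra hi; [exact: hs' | exact: hs].
Qed.

(** The index type may be infinite, so the map is defined through a chosen finite expansion of each
    element; [basis_coef_unique] makes the value independent of this choice, which gives
    linearity. *)
Lemma basis_extend (N : lmodType R) (c : I -> N) :
  exists f : {linear M -> N}, forall i, f (b i) = c i.
Proof.
have [p hp] := choice basis_repr.
pose f x := \sum_(i <- (p x).1) (p x).2 i *: c i.
have fE x (s : seq I) (a : I -> R) : uniq s -> (forall i, i \notin s -> a i = 0) ->
    x = \sum_(i <- s) a i *: b i -> f x = \sum_(i <- s) a i *: c i.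
  move=> us ha ex; have [u1 h1 e1] := hp x.
  have eq := basis_coef_unique u1 us h1 ha (etrans (esym e1) ex).
  pose u := undup ((p x).1 ++ s).
  have hs : {subset (p x).1 <= u} by move=> j; rewrite mem_undup mem_cat => ->.
  have hs' : {subset s <= u} by move=> j; rewrite mem_undup mem_cat orbC => ->.
  have uu : uniq u by exact: undup_uniq.
  rewrite /f -(big_sub_uniq u1 uu hs) => [|j /h1 ->]; last by rewrite scale0r.
  rewrite -(big_sub_uniq us uu hs') => [|j /ha ->]; last by rewrite scale0r.
  by apply: eq_bigr => i _; rewrite eq.
have lf : linear f.
  move=> e x y; have [ux hx ex] := hp x; have [uy hy ey] := hp y.
  pose u := undup ((p x).1 ++ (p y).1).
  have hsx : {subset (p x).1 <= u} by move=> j; rewrite mem_undup mem_cat => ->.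
  have hsy : {subset (p y).1 <= u} by move=> j; rewrite mem_undup mem_cat orbC => ->.
  have uu : uniq u by exact: undup_uniq.
  rewrite (fE _ u (fun i => e * (p x).2 i + (p y).2 i)) //; last first.
  - under eq_bigr do rewrite scalerDl -scalerA; rewrite big_split -scaler_sumr /=.
    rewrite (big_sub_uniq ux uu hsx) => [|j /hx ->]; last by rewrite scale0r.
    rewrite (big_sub_uniq uy uu hsy) => [|j /hy ->]; last by rewrite scale0r.
    by rewrite -ex -ey.
  - move=> i hi; rewrite hx ?hy ?mulr0 ?addr0 //; apply: contra hi; [exact: hsy | exact: hsx].
  under eq_bigr do rewrite scalerDl -scalerA; rewrite big_split -scaler_sumr /=.
  rewrite (big_sub_uniq ux uu hsx) => [|j /hx ->]; last by rewrite scale0r.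
  by rewrite (big_sub_uniq uy uu hsy) => [|j /hy ->]; last by rewrite scale0r.
pose f' : {linear M -> N} := HB.pack f (GRing.isLinear.Build R M N *:%R f lf).
exists f' => i; rewrite /= (fE _ [:: i] (fun j => (j == i)%:R)) //.
- by rewrite big_seq1 eqxx scale1r.
- by move=> j; rewrite inE => /negPf ->.
by rewrite big_seq1 eqxx scale1r.
Qed.

(** The coefficients of [x] are split into homogeneous parts, on which the claim is clear;
    [gr_component] then discards the parts of the wrong degree. *)
Lemma basis_graded (RD : int -> R -> Prop) (hR : is_grading RD)
  (D : int -> M -> Prop) (N : lmodType R) (D' : int -> N -> Prop)
  (hM : graded_module RD D) (hN : graded_module RD D') d (f : {linear M -> N}) :
  (forall i, D d (b i)) -> (forall i, D' d (f (b i))) ->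
  forall m x, D m x -> D' m (f x).
Proof.
move=> hb1 hf m x hx.
have [s [hs ex]] : exists s : seq (int * M),
    (forall p, p \in s -> D p.1 p.2 /\ D' p.1 (f p.2)) /\ x = \sum_(p <- s) p.2.
  have [s [a ->]] := hb.1 x.
  elim: s => [|i s [t [ht IH]]]; first by exists [::]; rewrite !big_nil.
  have [u [hu eu]] := gr_decomp hR (a i).
  exists ([seq (p.1 + d, p.2 *: b i) | p <- u] ++ t); split.
    move=> p; rewrite mem_cat => /orP [/mapP [q /hu hq ->]|/ht //].
    by split=> /=; [exact: hM.2 | rewrite linearZ; exact: hN.2].
  by rewrite big_cons big_cat big_map IH eu scaler_suml.
rewrite (gr_component hM.1 _ ex hx) => [|p /hs []//].
rewrite linear_sum big_seq_cond; apply: (gr_sum hN.1) => p /andP [/hs [_ h] /eqP <-].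
exact: h.
Qed.

End Bases.

(* What remains of the spaces W_i in A, after choosing bases w^i_j of them:   *)
(* w^(i+1)_j = \sum_l w^i_l (x) kd_m i j l = \sum_l kd_n i j l (x) w^i_l.     *)
Record koszul_data (k : fieldType) (A : connected_algebra k) := KoszulData {
  kd_r : nat -> nat;
  kd_m : forall i, 'I_(kd_r i.+1) -> 'I_(kd_r i) -> A;
  kd_n : forall i, 'I_(kd_r i.+1) -> 'I_(kd_r i) -> A;
  kd_la : 'I_(kd_r 0) -> k;
  kd_ka : 'I_(kd_r 0) -> k;
  kd_m1 : forall i j l, ca_gr 1 (@kd_m i j l);
  kd_n1 : forall i j l, ca_gr 1 (@kd_n i j l);
  kd_mm : forall i j q, \sum_l @kd_m i l q * @kd_m i.+1 j l = 0;
  kd_nn : forall i j q, \sum_l @kd_n i.+1 j l * @kd_n i l q = 0;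
  kd_mn0 : forall j, \sum_l kd_la l *: @kd_n 0 j l = \sum_l kd_la l *: @kd_m 0 j l;
  kd_ker : forall i (x : 'I_(kd_r i.+1) -> A), (forall l, ca_gr 1 (x l)) ->
    (forall q, \sum_l @kd_m i l q * x l = 0) ->
    exists c : 'I_(kd_r i.+2) -> k, forall l, x l = \sum_j c j *: @kd_m i.+1 j l;
  kd_ker0 : forall x : 'I_(kd_r 0) -> A, (forall l, ca_gr 1 (x l)) ->
    exists c : 'I_(kd_r 1) -> k, forall l, x l = \sum_j c j *: @kd_m 0 j l;
  kd_inj : forall i (c : 'I_(kd_r i.+1) -> k),
    (forall l, \sum_j c j *: @kd_m i j l = 0) -> forall j, c j = 0;
  kd_kala : forall j l, kd_ka j * kd_la l = (j == l)%:R;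
  kd_kala1 : \sum_j kd_ka j * kd_la j = 1
}.

Section Augmentation.
Variables (k : fieldType) (A : connected_algebra k).

Definition eps (a : A) : k := ca_eps A a.

Lemma epsD a b : eps (a + b) = eps a + eps b.
Proof. exact: raddfD. Qed.

Lemma epsM a b : eps (a * b) = eps a * eps b.
Proof. exact: rmorphM. Qed.

Lemma eps1 : eps 1 = 1.
Proof. exact: rmorph1. Qed.

Lemma epsZ c a : eps (c *: a) = c * eps a.
Proof. by rewrite /eps linearZ. Qed.

Lemma eps_sum (I : Type) (s : seq I) (P : pred I) (F : I -> A) :
  eps (\sum_(i <- s | P i) F i) = \sum_(i <- s | P i) eps (F i).
Proof. exact: raddf_sum. Qed.

Lemma gr0_scalar (a : A) : ca_gr 0 a -> a = (eps a)%:A.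
Proof. by move=> /ca_gr0 [c ->]; rewrite epsZ eps1 mulr1. Qed.

Lemma eps_pos (e : int) (a : A) : 0 < e -> ca_gr e a -> eps a = 0.
Proof. exact: ca_epsP. Qed.

End Augmentation.

(** * The right Koszul complex *)

Section RightKoszul.
Variables (k : fieldType) (A : connected_algebra k) (K : koszul_data A).
Local Notation r := (kd_r K).

(** The term W_i (x) A in coordinates along the basis of W_i, over [A^c] because right A-modules are
    modules over the converse ring. *)
Definition rk (i : nat) : lmodType A^c := 'rV[A^c]_(r i).
Definition rk_mx i : 'M[A^c]_(r i.+1, r i) := \matrix_(j, l) (kd_m j l : A^c).
Definition rk_gr (i : nat) (e : int) (x : rk i) : Prop :=
  row_gr (@ca_gr k A : int -> A^c -> Prop) i%:Z e (x : 'rV[A^c]_(r i)).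

Definition rk_ker i : rk i -> Prop :=
  match i with
  | 0 => fun x => \sum_j kd_la j * eps ((x : 'rV_(r 0)) 0 j : A) = 0
  | i.+1 => fun x => (x : 'rV_(r i.+1)) *m rk_mx i = 0
  end.

Let gr : int -> A^c -> Prop := @ca_gr k A.
Let hgr : is_grading gr := ca_grading A.

Lemma mulcE (a b : A) : (a : A^c) * (b : A^c) = b * a :> A.
Proof. by []. Qed.

Lemma rk_mulE i (x : rk i.+1) l :
  ((x : 'rV_(r i.+1)) *m rk_mx i) 0 l = \sum_j kd_m j l * (x : 'rV_(r i.+1)) 0 j :> A.
Proof. by rewrite mxE; apply: eq_bigr => j _; rewrite mxE. Qed.

Lemma is_grading_rk i : is_grading (@rk_gr i).
Proof. exact: (is_grading_row hgr). Qed.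

Lemma graded_module_rk i : graded_module gr (@rk_gr i).
Proof.
split; first exact: is_grading_rk.
move=> e f a x ha hx j; rewrite mxE mulcE.
have -> : e + f - i%:Z = (f - i%:Z) + e by rewrite addrC addrA addrC addrA [_ - _]addrC.
exact: (ca_mul (hx j) ha).
Qed.

Lemma is_grading_triv : is_grading (@triv_gr k A).
Proof.
split.
- by move=> i; right.
- by move=> i x y [->|->] [e|->]; try (by left); right; rewrite subr0.
- move=> x; exists [:: 0], (fun i => if i == 0 then x else 0); split.
    by move=> i; case: eqP => [->|_]; [left | right].
  by rewrite big_seq1.
move=> s F us hF e i hi; case: (hF i) => [i0|//].
move: e; rewrite (bigD1_seq i) //= big1 ?addr0 // => j hj.
by case: (hF j) => // j0; rewrite j0 i0 eqxx in hj.
Qed.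

Definition rk_aug (x : rk 0) : trivial_module A :=
  \sum_j kd_la j * eps ((x : 'rV_(r 0)) 0 j : A).

Fact rk_aug_linear : linear rk_aug.
Proof.
move=> a x y; have -> (u : trivial_module A) : a *: u = (u : k) * eps a by [].
rewrite /rk_aug mulr_suml -big_split.
by apply: eq_bigr => j _; rewrite !mxE mulcE epsD epsM mulrDr mulrA.
Qed.

HB.instance Definition _ := GRing.isLinear.Build A^c (rk 0) (trivial_module A) *:%R
  rk_aug rk_aug_linear.

Section Resolution.
Variables (P : proj_resolution (trivial_module A)) (PD : forall i, int -> P i -> Prop).

Hypothesis hP : graded_resolution gr (@triv_gr k A) PD.
Hypothesis hfree : forall i, exists (I : eqType) (b : I -> P i),
  is_basis b /\ forall j, @PD i i%:Z (b j).

Definition P_ker i : P i -> Prop :=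
  match i with
  | 0 => fun x => pr_aug P x = 0
  | i.+1 => fun x => pr_diff P i x = 0
  end.

(** One stage of the retraction of P onto the Koszul complex. Asking that cycles be preserved,
    instead of commutation with differentials, lets a stage be stated by itself. *)
Record comparison i (f : {linear P i -> rk i}) (g : {linear rk i -> P i}) : Prop :=
  Comparison {
  cp_f : forall e x, @PD i e x -> rk_gr e (f x);
  cp_g : forall e x, rk_gr e x -> @PD i e (g x);
  cp_fg : forall x, f (g x) = x;
  cp_fker : forall x, P_ker x -> rk_ker (f x);
  cp_gker : forall x, rk_ker x -> P_ker (g x)
}.

(** The entries of [y] have degree one, and there exactness is part of [koszul_data]. *)
Lemma rk_diff_scalar i (y : rk i) : rk_gr (i.+1)%:Z y -> rk_ker y ->
  exists c : 'I_(r i.+1) -> k, y = (\row_j ((c j)%:A : A^c)) *m rk_mx i :> 'rV_(r i).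
Proof.
move=> hy ky.
have y1 l : ca_gr 1 ((y : 'rV_(r i)) 0 l : A).
  by have := hy l; rewrite -addn1 PoszD addrAC subrr add0r.
have [c hc] : exists c : 'I_(r i.+1) -> k, forall l,
    (y : 'rV_(r i)) 0 l = \sum_j c j *: kd_m j l :> A.
  case: i y hy ky y1 => [|i] y _ ky y1; first exact: kd_ker0.
  apply: kd_ker => // q.
  have := congr1 (fun v : 'rV_(r i) => v 0 q : A) ky.
  by rewrite /= rk_mulE mxE.
exists c; apply/rowP => l; rewrite hc rk_mulE.
by apply: eq_bigr => j _; rewrite mxE -scalerAr mulr1.
Qed.

Lemma rk_scalar_inj i (v : rk i.+1) : rk_gr (i.+1)%:Z v ->
  (v : 'rV_(r i.+1)) *m rk_mx i = 0 -> v = 0.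
Proof.
move=> hv e0; apply/rowP => j; rewrite mxE.
have v0 l : ca_gr 0 ((v : 'rV_(r i.+1)) 0 l : A) by have := hv l; rewrite subrr.
rewrite (gr0_scalar (v0 j)); set c := fun l => eps ((v : 'rV_(r i.+1)) 0 l : A).
rewrite -/(c j) (@kd_inj _ _ K i c) ?scale0r // => l.
have := congr1 (fun v : 'rV_(r i) => v 0 l : A) e0.
rewrite /= rk_mulE mxE; apply: etrans; apply: eq_bigr => q _.
by rewrite (gr0_scalar (v0 q)) -scalerAr mulr1.
Qed.

(** [g] uses an element [q] of degree 0 over 1; that [f] after [g] is the identity rests on [kd_ka]
    and [kd_la] being inverse coordinates of W_0 = k. *)
Lemma comparison0 : exists f g, @comparison 0 f g.
Proof.
have [I [b [hb db]]] := hfree 0.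
have [hgm hdiff haug] := hP.
have [f hf] := basis_extend hb (fun i => \row_j ((kd_ka j * (pr_aug P (b i) : k))%:A : A^c) : rk 0).
have f_gr e x : @PD 0 e x -> rk_gr e (f x).
  apply: (basis_graded hb hgr (hgm 0) (graded_module_rk 0) db) => i j.
  by rewrite hf mxE subrr; apply/ca_gr0; eexists.
have f_aug x : rk_aug (f x) = pr_aug P x.
  pose f' : {linear P 0 -> trivial_module A} := (rk_aug \o f)%FUN.
  rewrite -[LHS]/(f' x); apply: (eq_linear_basis hb) => i.
  rewrite /= hf /rk_aug; under eq_bigr do rewrite mxE epsZ eps1 mulr1.
  rewrite -[RHS]mul1r -(kd_kala1 K) mulr_suml; apply: eq_bigr => j _.
  by rewrite mulrA [kd_la _ * _]mulrC.
have [q0 hq0] := pr_surj P (1 : k).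
have [q q_gr hq] : exists2 q, @PD 0 0 q & pr_aug P q = (1 : k).
  have := gr_lift (hgm 0).1 is_grading_triv (linear0 (pr_aug P)) (linearD (pr_aug P)) haug (m := 0) (x := q0).
  by rewrite hq0; apply; left.
pose g : {linear rk 0 -> P 0} := row_lin (fun j => ((kd_la j)%:A : A^c) *: q).
have fq l : (f q : 'rV_(r 0)) 0 l = (kd_ka l)%:A :> A.
  have h0 j : ca_gr 0 ((f q : 'rV_(r 0)) 0 j : A) by have := f_gr _ _ q_gr j; rewrite subr0.
  rewrite (gr0_scalar (h0 l)); congr (_ *: _).
  have := f_aug q; rewrite hq /rk_aug => /(congr1 ( *%R (kd_ka l : k))).
  rewrite mulr1 mulr_sumr => <-.
  rewrite (bigD1 l) //= mulrA kd_kala eqxx mul1r big1 ?addr0 // => j hj.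
  by rewrite mulrA kd_kala eq_sym (negPf hj) mul0r.
have g_gr e x : rk_gr e x -> @PD 0 e (g x).
  move=> hx; apply: (gr_sum (hgm 0).1) => j _; rewrite scalerA -[e]addr0.
  apply: (hgm 0).2 => //; rewrite mulcE -scalerAl mul1r.
  have [c ] : exists c : k, True by exists 0.
  move=> _; have := hx j; rewrite subr0 => h.
  have h1 : ca_gr 0 ((kd_la j)%:A : A) by apply/ca_gr0; eexists.
  by have := ca_mul h1 h; rewrite add0r -scalerAl mul1r.
have fgE x : f (g x) = x.
  pose fg : {linear rk 0 -> rk 0} := (f \o g)%FUN.
  rewrite -[LHS]/(fg x) -[RHS]/(idfun x); apply: eq_row_lin => j.
  rewrite /= row_linE linearZ; apply/rowP => l; rewrite !mxE mulcE fq.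
  rewrite -scalerAl mul1r scalerA kd_kala eqxx /= eq_sym.
  by case: (j == l); rewrite ?scale1r ?scale0r.
exists f, g; split=> // [x hx|x hx].
  by have := f_aug x; rewrite hx.
by rewrite /P_ker -f_aug fgE.
Qed.

Definition rk_diff i (x : rk i.+1) : rk i := (x : 'rV_(r i.+1)) *m rk_mx i.

Fact rk_diff_linear i : linear (@rk_diff i).
Proof. by move=> a x y; rewrite /rk_diff mulmxDl -scalemxAl. Qed.

HB.instance Definition _ i := GRing.isLinear.Build A^c (rk i.+1) (rk i) *:%R
  (@rk_diff i) (@rk_diff_linear i).

Lemma rk_diff_gr i e x : rk_gr e x -> rk_gr e (@rk_diff i x).
Proof.
move=> hx j; rewrite rk_mulE; apply: (gr_sum (ca_grading A)) => l _.
have -> : e - i%:Z = 1 + (e - i.+1%:Z) by lia.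
exact: ca_mul (kd_m1 _ _) (hx l).
Qed.

Lemma rk_row_ker i j : rk_ker (row j (rk_mx i) : rk i).
Proof.
case: i j => [|i] j /=.
  rewrite big1 // => l _; rewrite !mxE (eps_pos (e := 1)) ?mulr0 //.
  exact: kd_m1.
apply/rowP => q; rewrite rk_mulE mxE -[RHS](kd_mm j q).
by apply: eq_bigr => l _; rewrite !mxE.
Qed.

Lemma rk_row_gr i j : rk_gr i.+1%:Z (row j (rk_mx i) : rk i).
Proof.
move=> l; rewrite !mxE; have -> : i.+1%:Z - i%:Z = 1 by lia.
exact: kd_m1.
Qed.

Lemma P_kerS i x : P_ker (pr_diff P i x).
Proof.
case: i x => [|i] x /=; first by apply/pr_exact0; exists x.
by apply/pr_exactS; exists x.
Qed.

Lemma P_ker_im i (x : P i) : P_ker x -> exists y, x = pr_diff P i y.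
Proof. by case: i x => [|i] x /=; [move/pr_exact0 | move/pr_exactS]. Qed.

(** A basis element of P_(i+1) has degree i+1, so f carries its boundary to the differential of a
    row of scalars, which defines f'. The rows of [rk_mx] are cycles; g carries them to boundaries,
    and homogeneous preimages define g'. On generators f' g' and the identity both have scalar
    entries and the same differential, so they agree by [rk_scalar_inj]. *)
Lemma comparisonS i f g : @comparison i f g -> exists (f' : {linear P i.+1 -> rk i.+1})
  (g' : {linear rk i.+1 -> P i.+1}), comparison f' g' /\
  forall x, rk_diff (f' x) = f (pr_diff P i x).
Proof.
move=> [f_gr g_gr fg f_ker g_ker]; have [hgm hdiff _] := hP.
have [I [b [hb db]]] := hfree i.+1.
have hc s : exists c : 'I_(r i.+1) -> k,
    rk_diff (\row_j ((c j)%:A : A^c)) = f (pr_diff P i (b s)).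
  have [||c hc] := @rk_diff_scalar i (f (pr_diff P i (b s))).
  - by apply: f_gr; apply: hdiff; exact: db.
  - exact (f_ker _ (P_kerS (b s))).
  by exists c; rewrite hc.
have [c hc'] := choice hc.
have [f' hf'] := basis_extend hb (fun s => \row_j ((c s j)%:A : A^c) : rk i.+1).
have f'_gr e x : @PD i.+1 e x -> rk_gr e (f' x).
  apply: (basis_graded hb hgr (hgm i.+1) (graded_module_rk i.+1) db) => s j.
  by rewrite hf' mxE subrr; apply/ca_gr0; eexists.
have f'_d x : rk_diff (f' x) = f (pr_diff P i x).
  pose u : {linear P i.+1 -> rk i} := (@rk_diff i \o f')%FUN.
  pose v : {linear P i.+1 -> rk i} := (f \o pr_diff P i)%FUN.
  by rewrite -[LHS]/(u x) -[RHS]/(v x); apply: (eq_linear_basis hb) => s; rewrite /= hf'.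
have hq j : exists q, @PD i.+1 i.+1%:Z q /\ pr_diff P i q = g (row j (rk_mx i) : rk i).
  have [q0 hq0] := P_ker_im (g_ker _ (@rk_row_ker i j)).
  have := gr_lift (hgm i.+1).1 (hgm i).1 (linear0 (pr_diff P i))
    (linearD (pr_diff P i)) (hdiff i) (m := i.+1%:Z) (x := q0).
  rewrite -hq0 => /(_ (g_gr _ _ (@rk_row_gr i j))) [q h1 h2].
  by exists q.
have [q q_spec] := choice hq.
pose g' : {linear rk i.+1 -> P i.+1} := row_lin q.
have g'_gr e x : rk_gr e x -> @PD i.+1 e (g' x).
  move=> hx; apply: (gr_sum (hgm i.+1).1) => j _.
  rewrite -[e](subrK i.+1%:Z); apply: (hgm i.+1).2; first exact: hx.
  exact: (q_spec j).1.
have g'_d x : pr_diff P i (g' x) = g (rk_diff x).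
  pose u : {linear 'rV[A^c]_(r i.+1) -> P i} := (pr_diff P i \o row_lin q)%FUN.
  pose v : {linear 'rV[A^c]_(r i.+1) -> P i} := (g \o @rk_diff i)%FUN.
  rewrite -[LHS]/(u x) -[RHS]/(v x); apply: eq_row_lin => j.
  by rewrite /= row_linE (q_spec j).2 /rk_diff -rowE.
have fg' x : f' (g' x) = x.
  pose u : {linear 'rV[A^c]_(r i.+1) -> 'rV[A^c]_(r i.+1)} := (f' \o row_lin q)%FUN.
  rewrite -[LHS]/(u x) -[RHS]/(idfun x); apply: eq_row_lin => j.
  rewrite /= row_linE; apply/eqP; rewrite -subr_eq0; apply/eqP.
  apply: rk_scalar_inj.
    apply: (grB (is_grading_rk i.+1)); first exact: f'_gr (q_spec j).1.
    move=> l; rewrite mxE subrr eqxx /=.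
    case: (l == j); [apply/ca_gr0; exists 1; by rewrite scale1r | exact: (gr0 hgr)].
  have dB (u' v' : rk i.+1) : (u' - v' : 'rV_(r i.+1)) *m rk_mx i = rk_diff u' - rk_diff v'.
    exact: (linearB (@rk_diff i)).
  rewrite dB f'_d (q_spec j).2 fg; apply/eqP; rewrite subr_eq0; apply/eqP.
  by rewrite /rk_diff -rowE.
exists f', g'; split; last exact: f'_d.
split=> // [x hx|x hx].
  by rewrite /rk_ker -[LHS]/(rk_diff (f' x)) f'_d hx linear0.
by rewrite /P_ker g'_d -[rk_diff x]/((x : 'rV_(r i.+1)) *m rk_mx i) hx linear0.
Qed.

Lemma comparison_exists i : exists f g, @comparison i f g.
Proof.
elim: i => [|i [f [g h]]]; first exact: comparison0.
by have [f' [g' [h' _]]] := comparisonS h; exists f', g'.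
Qed.

(* The Koszul complex is a retract of the linear resolution P.                *)
Lemma rk_exact i (x : rk i) : rk_ker x -> exists y, x = rk_diff y.
Proof.
move=> hx; have [f [g h]] := comparison_exists i.
have [f' [g' [_ hd]]] := comparisonS h.
have [y hy] := P_ker_im (cp_gker h hx).
by exists (f' y); rewrite hd -hy (cp_fg h).
Qed.

End Resolution.
End RightKoszul.

(** [projective] speaks of surjections, so [g] is corestricted to its image, which contains the
    values of [f]. *)
Lemma proj_lift (R : nzRingType) (X Y P : lmodType R) (g : {linear X -> Y})
  (f : {linear P -> Y}) : projective P -> (forall p, exists x, g x = f p) ->
  exists h : {linear P -> X}, forall p, g (h p) = f p.
Proof.
move=> hP hf; pose im y := exists x, g x = y.
have him : submodule im.
  split; first by exists 0; rewrite linear0.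
  by move=> a _ _ [x <-] [y <-]; exists (a *: x + y); rewrite linearP.
have gP x : g x \in submod_pred him by apply/asboolP; exists x.
have fP p : f p \in submod_pred him by apply/asboolP; exact: hf.
pose f1 p := Submod (fP p); pose g1 x := Submod (gP x).
have lf : linear f1 by move=> a x y; apply: val_inj; rewrite /= linearP.
have lg : linear g1 by move=> a x y; apply: val_inj; rewrite /= linearP.
pose f2 : {linear P -> submod_type him} :=
  HB.pack f1 (GRing.isLinear.Build R P (submod_type him) *:%R f1 lf).
pose g2 : {linear X -> submod_type him} :=
  HB.pack g1 (GRing.isLinear.Build R X (submod_type him) *:%R g1 lg).
have [y|h hh] := hP _ _ g2 f2.
  case: y => y hy; have /asboolP [x ex] := hy.
  by exists x; apply: val_inj; rewrite /= ex.
by exists h => p; have := congr1 val (hh p).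
Qed.

(** * Projective dimension *)

Section ProjectiveDimension.
Variables (k : fieldType) (A : connected_algebra k) (K : koszul_data A).
Local Notation r := (kd_r K).
Local Notation rk := (rk K).
Hypothesis exactK : forall i (x : rk i), rk_ker x -> exists y, x = rk_diff y.
Variable Q : proj_resolution (trivial_module A).

Lemma rk_kerS i (x : rk i.+1) : rk_ker (rk_diff x).
Proof.
suff h j : rk_ker (rk_diff (delta_mx 0 j : rk i.+1)).
  case: i x h => [|i] x h.
    pose u : {linear 'rV[A^c]_(r 1) -> trivial_module A} :=
      (@rk_aug _ _ K \o @rk_diff _ _ K 0)%FUN.
    have -> : rk_ker (rk_diff x) = (u x = (\0 : {linear _ -> _}) x) by [].
    by apply: eq_row_lin => j; exact: h.
  pose u : {linear 'rV[A^c]_(r i.+2) -> 'rV[A^c]_(r i)} :=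
    (@rk_diff _ _ K i \o @rk_diff _ _ K i.+1)%FUN.
  have -> : rk_ker (rk_diff x) = (u x = (\0 : {linear _ -> _}) x) by [].
  by apply: eq_row_lin => j; exact: h.
by rewrite /rk_diff -rowE; exact: rk_row_ker.
Qed.

(** The resolution Q need be neither graded nor free, so it is compared with the Koszul complex up
    to homotopy only; a stage records the homotopy on cycles. *)
Record homotopy_data i (f : {linear rk i -> Q i}) (g : {linear Q i -> rk i})
    (s : {linear rk i -> rk i.+1}) : Prop := HomotopyData {
  hd_f : forall x, rk_ker x -> P_ker (f x);
  hd_g : forall x, P_ker x -> rk_ker (g x);
  hd_s : forall x, rk_ker x -> x - g (f x) = rk_diff (s x)
}.

Lemma row_lift i (u : {linear rk i -> rk i}) : (forall x, rk_ker (u x)) ->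
  exists s : {linear rk i -> rk i.+1}, forall x, rk_diff (s x) = u x.
Proof.
move=> hu; have [c hc] := choice (fun j => exactK (hu (delta_mx 0 j : rk i))).
exists (row_lin c) => x.
pose v : {linear 'rV[A^c]_(r i) -> rk i} := (@rk_diff _ _ K i \o row_lin c)%FUN.
by rewrite -[LHS]/(v x); apply: eq_row_lin => j; rewrite /= row_linE hc.
Qed.

Lemma homotopy0 : exists f g s, @homotopy_data 0 f g s.
Proof.
have [q0 hq0] := pr_surj Q (1 : k).
pose f : {linear rk 0 -> Q 0} := row_lin (fun j => ((kd_la j)%:A : A^c) *: q0).
have f_aug x : pr_aug Q (f x) = rk_aug x.
  pose u : {linear 'rV[A^c]_(r 0) -> trivial_module A} := (pr_aug Q \o row_lin (fun j => ((kd_la j)%:A : A^c) *: q0))%FUN.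
  rewrite -[LHS]/(u x); apply: eq_row_lin => j.
  transitivity ((1 : k) * eps ((kd_la j)%:A : A)).
    by rewrite /= row_linE -hq0 linearZ.
  rewrite epsZ eps1 mul1r mulr1 /= /rk_aug (bigD1 j) //= mxE !eqxx eps1 mulr1.
  rewrite big1 ?addr0 // => l hl.
  by rewrite mxE eqxx (negPf hl) -[eps _]/(eps (0 : A)) -(scale0r 1) epsZ mul0r mulr0.
have aug_surj (y : trivial_module A) : exists x, (@rk_aug _ _ K) x = y.
  exists (\row_j (((kd_ka j : k) * (y : k))%:A : A^c)).
  rewrite /rk_aug; under eq_bigr do rewrite mxE epsZ eps1 mulr1 mulrCA mulrA.
  by rewrite -mulr_suml kd_kala1 mul1r.
have [g hg] := proj_lift (g := @rk_aug _ _ K) (@pr_proj _ _ Q 0) (fun p => aug_surj (pr_aug Q p)).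
pose u : {linear rk 0 -> rk 0} := (idfun \- (g \o f))%FUN.
have hu x : rk_ker (u x).
  rewrite -[rk_ker _]/(rk_aug (x - g (f x)) = 0) linearB /=.
  have -> : rk_aug (g (f x)) = rk_aug x by rewrite -[RHS]f_aug -hg.
  exact: subrr.
have [s hs] := row_lift hu.
exists f, g, s; split.
- by move=> x hx; rewrite /P_ker f_aug.
- by move=> x hx; rewrite -[rk_ker _]/(rk_aug (g x) = 0) hg.
- by move=> x _; rewrite hs.
Qed.

(** The comparison theorem: [f] lifts because the Koszul terms are free, [g] because those of Q are
    projective, and the defect of the homotopy is a cycle, hence a boundary. *)
Lemma homotopyS i f g s : @homotopy_data i f g s ->
  exists f' g' s', @homotopy_data i.+1 f' g' s' /\
    forall x, x - g' (f' x) = rk_diff (s' x) + s (rk_diff x).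
Proof.
move=> [hf hg hs].
have hc j : exists q, pr_diff Q i q = f (row j (rk_mx K i) : rk i).
  by have [q ->] := P_ker_im (hf _ (rk_row_ker j)); exists q.
have [c hc'] := choice hc.
pose f' : {linear rk i.+1 -> Q i.+1} := row_lin c.
have f'_d x : pr_diff Q i (f' x) = f (rk_diff x).
  pose u : {linear 'rV[A^c]_(r i.+1) -> Q i} := (pr_diff Q i \o row_lin c)%FUN.
  pose v : {linear 'rV[A^c]_(r i.+1) -> Q i} := (f \o @rk_diff _ _ K i)%FUN.
  rewrite -[LHS]/(u x) -[RHS]/(v x); apply: eq_row_lin => j.
  by rewrite /= row_linE hc' /rk_diff -rowE.
pose gd : {linear Q i.+1 -> rk i} := (g \o pr_diff Q i)%FUN.
have [g' hg'] : exists g' : {linear Q i.+1 -> rk i.+1}, forall p, rk_diff (g' p) = gd p.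
  apply: (proj_lift (g := @rk_diff _ _ K i) (@pr_proj _ _ Q i.+1)) => p.
  by have [y ey] := exactK (hg _ (P_kerS p)); exists y; exact: esym ey.
pose u : {linear rk i.+1 -> rk i.+1} := (idfun \- (g' \o f') \- (s \o @rk_diff _ _ K i))%FUN.
have hu x : rk_ker (u x).
  rewrite -[rk_ker _]/(rk_diff (x - g' (f' x) - s (rk_diff x)) = 0).
  have dB (u' v' : rk i.+1) : rk_diff (u' - v') = rk_diff u' - rk_diff v'.
    exact: (linearB (@rk_diff _ _ K i)).
  rewrite !dB hg' /gd /= f'_d -hs ?subrr //; exact: rk_kerS.
have [s' hs'] := row_lift hu.
have e x : x - g' (f' x) = rk_diff (s' x) + s (rk_diff x) by rewrite hs' /= subrK.
exists f', g', s'; split=> //; split.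
- by move=> x hx; rewrite /P_ker f'_d -[rk_diff x]/((x : 'rV_(r i.+1)) *m rk_mx K i) hx linear0.
- by move=> x hx; rewrite -[rk_ker _]/(rk_diff (g' x) = 0) hg' /gd /= hx linear0.
- by move=> x hx; rewrite e -[rk_diff x]/((x : 'rV_(r i.+1)) *m rk_mx K i) hx linear0 addr0.
Qed.

(** As Q_(d+1) is zero, the homotopy formula makes every element of the Koszul term of degree d+1
    equal to its image under d s' + s d. The differentials have entries of degree one, so [eps]
    kills the coordinates of such images, but not those of a generator. *)
Lemma rk_top d : (forall i, (d < i)%N -> forall x : Q i, x = 0) -> r d.+1 = 0%N.
Proof.
move=> hd; have [f [g [s h]]] : exists f g s, @homotopy_data d f g s.
  by elim: (d) => [|i [f [g [s h]]]]; [exact: homotopy0 |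
    have [f' [g' [s' [h' _]]]] := homotopyS h; exists f', g', s'].
have [f' [g' [s' [_ e]]]] := homotopyS h.
apply/eqP; rewrite -leqn0 leqNgt; apply/negP => rpos.
pose j : 'I_(r d.+1) := Ordinal rpos.
have := congr1 (fun x : rk d.+1 => eps ((x : 'rV_(r d.+1)) 0 j : A)) (e (delta_mx 0 j)).
rewrite (hd _ (ltnSn d) (f' _)) linear0 subr0 mxE !eqxx eps1.
have -> (x y : rk d.+1) : eps ((x + y : 'rV_(r d.+1)) 0 j : A)
    = eps ((x : 'rV_(r d.+1)) 0 j : A) + eps ((y : 'rV_(r d.+1)) 0 j : A).
  by rewrite mxE epsD.
rewrite rk_mulE eps_sum big1 => [|l _]; last first.
  by rewrite epsM (eps_pos (e := 1)) ?mul0r //; exact: kd_m1.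
rewrite add0r /rk_diff -rowE [row _ _]row_sum_delta linear_sum summxE eps_sum big1 => [|l _].
  by move/eqP; rewrite oner_eq0.
rewrite linearZ !mxE mulcE epsM [X in _ * X](eps_pos (e := 1)) ?mulr0 //.
exact: kd_m1.
Qed.

End ProjectiveDimension.

Import Num.Theory.

(** Finite spanning families of the components of A, with coordinates that vanish in the other
    degrees. The families need not be independent. They serve to split off left degrees in A (x)
    A. *)
Record frame (k : fieldType) (A : connected_algebra k) := Frame {
  fr_n : nat -> nat;
  fr_a : forall p, 'I_(fr_n p) -> A;
  fr_c : forall p, 'I_(fr_n p) -> A -> k;
  fr_lin : forall p t, linear (@fr_c p t : A -> k^o);
  fr_gr : forall p t, ca_gr p%:Z (@fr_a p t);
  fr_0 : forall p t (q : int) a, q != p%:Z -> ca_gr q a -> @fr_c p t a = 0;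
  fr_E : forall p a, ca_gr p%:Z a -> a = \sum_(t < fr_n p) @fr_c p t a *: @fr_a p t
}.

(** * The enveloping algebra *)

Section Enveloping.
Variables (k : fieldType) (A : connected_algebra k) (Ae : enveloping_algebra A).
Variable Fr : frame A.
Local Notation et := (env_tens Ae).
Local Notation egr := (@env_gr k A Ae).

Lemma ca_gr_scale i (c : k) (a : A) : ca_gr i a -> ca_gr i (c *: a).
Proof.
move=> ha; rewrite -[a]mul1r scalerAl -[i]add0r; apply: ca_mul => //.
by apply/ca_gr0; exists c.
Qed.

Lemma et_linr a : linear (et a).
Proof. by have [h _] := env_bilin Ae; exact: h. Qed.

Lemma et_linl b : linear (et^~ b).
Proof. by have [_ h] := env_bilin Ae; exact: h. Qed.

(** The universal property lifts the pure tensors to a map into the submodule they span; followed by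
    the inclusion it is the identity, by [env_ext]. *)
Lemma env_span (X : Ae) : exists s : seq (A * A), X = \sum_(p <- s) et p.1 p.2.
Proof.
pose P (X : Ae) := exists s : seq (A * A), X = \sum_(p <- s) et p.1 p.2.
have hP : submodule P.
  split; first by exists [::]; rewrite big_nil.
  move=> c _ _ [s ->] [t ->]; exists ([seq (c *: p.1, p.2) | p <- s] ++ t).
  rewrite big_cat big_map scaler_sumr; congr (_ + _); apply: eq_bigr => p _.
  by rewrite (linZ (et_linl _)).
have etP a b : et a b \in submod_pred hP.
  by apply/asboolP; exists [:: (a, b)]; rewrite big_seq1.
have hb : bilinear_map (fun a b => Submod (etP a b)).
  split=> [a|b] c u v; apply: val_inj; rewrite /=; [exact: et_linr | exact: et_linl].
have := @env_ext _ _ Ae Ae (fun X => val (env_lift Ae hb X)) id _ _ _ X.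
rewrite /= => e; rewrite -e => [|c u v|//|a b]; last by rewrite env_liftE.
  by have /asboolP := valP (env_lift Ae hb X).
by rewrite !linearP.
Qed.

Lemma env_ext_lin (U : lmodType k) (g h : Ae -> U) : linear g -> linear h ->
  (forall a b, g (et a b) = h (et a b)) -> g =1 h.
Proof. exact: env_ext. Qed.

Lemma frame_eq0 p t (a : A) q : ca_gr q a -> q != p%:Z -> fr_c (f := Fr) (p := p) t a = 0.
Proof. by move=> ha hq; exact: fr_0 hq ha. Qed.

Definition hproj p (a : A) : A := \sum_(t < fr_n Fr p) fr_c t a *: fr_a t.

Lemma hproj_lin p : linear (hproj p).
Proof.
move=> c x y; rewrite /hproj scaler_sumr -big_split; apply: eq_bigr => t _.
by rewrite (fr_lin t c x y) scalerDl scalerA.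
Qed.

Lemma hproj_gr p a : ca_gr p%:Z (hproj p a).
Proof.
by apply: (gr_sum (ca_grading A)) => t _; apply: ca_gr_scale; exact: fr_gr.
Qed.

Lemma hproj_id p a : ca_gr p%:Z a -> hproj p a = a.
Proof. by move=> ha; rewrite /hproj -(fr_E Fr ha). Qed.

Lemma hproj_0 p q a : ca_gr q a -> q != p%:Z -> hproj p a = 0.
Proof. by move=> ha hq; rewrite /hproj big1 // => t _; rewrite (frame_eq0 t ha hq) scale0r. Qed.

Fact lcontr_bilin p (t : 'I_(fr_n Fr p)) : bilinear_map (fun a b : A => fr_c t a *: b).
Proof.
split=> [a|b] c u v; first by rewrite scalerDr !scalerA [c * _]mulrC.
by rewrite (fr_lin t c u v) scalerDl scalerA.
Qed.

(** Applies the coordinate [fr_c t] to the left factor. From these [lproj] assembles the component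
    of left degree p. *)
Definition lcontr p (t : 'I_(fr_n Fr p)) : Ae -> A := env_lift Ae (lcontr_bilin t).

Lemma lcontrE p (t : 'I_(fr_n Fr p)) a b : lcontr t (et a b) = fr_c t a *: b.
Proof. exact: env_liftE. Qed.

Lemma lcontr_lin p (t : 'I_(fr_n Fr p)) : linear (lcontr t).
Proof. by move=> c x y; rewrite /lcontr linearP. Qed.

Definition lproj p (X : Ae) : Ae := \sum_t et (fr_a t) (lcontr (p := p) t X).

Lemma lproj_lin p : linear (lproj p).
Proof.
move=> c x y; rewrite /lproj scaler_sumr -big_split; apply: eq_bigr => t _.
by rewrite lcontr_lin et_linr.
Qed.

Lemma lprojE p a b : lproj p (et a b) = et (hproj p a) b.
Proof.
rewrite /lproj /hproj (lin_sum (et_linl b)); apply: eq_bigr => t _.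
by rewrite lcontrE (linZ (et_linr _)) (linZ (et_linl _)).
Qed.

Fact tproj_bilin m : bilinear_map (fun a b : A => \sum_(p < m.+1) et (hproj p a) (hproj (m - p) b)).
Proof.
split=> [a|b] c u v; rewrite scaler_sumr -big_split; apply: eq_bigr => p _.
  by rewrite hproj_lin et_linr.
by rewrite hproj_lin et_linl.
Qed.

Definition tproj m : Ae -> Ae := env_lift Ae (tproj_bilin m).

Lemma tprojE m a b : tproj m (et a b) = \sum_(p < m.+1) et (hproj p a) (hproj (m - p) b).
Proof. exact: env_liftE. Qed.

Lemma tproj_lin m : linear (tproj m).
Proof. by move=> c x y; rewrite /tproj linearP. Qed.

Lemma et0l b : et 0 b = 0.
Proof. exact: (lin0 (et_linl b)). Qed.

Lemma et0r a : et a 0 = 0.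
Proof. exact: (lin0 (et_linr a)). Qed.

Lemma egr0 m : egr m 0.
Proof. by exists [::]; rewrite big_nil; split. Qed.

Lemma egrD m X Y : egr m X -> egr m Y -> egr m (X + Y).
Proof.
move=> [s [hs ->]] [t [ht ->]]; exists (s ++ t); rewrite big_cat; split=> // p.
by rewrite mem_cat => /orP [/hs|/ht].
Qed.

Lemma egr_sum m (I : Type) (s : seq I) (P : pred I) (F : I -> Ae) :
  (forall i, P i -> egr m (F i)) -> egr m (\sum_(i <- s | P i) F i).
Proof. by move=> hF; apply: big_ind => //; [exact: egr0 | move=> *; exact: egrD]. Qed.

Lemma egr_et i j m a b : i + j = m -> ca_gr i a -> ca_gr j b -> egr m (et a b).
Proof.
move=> e ha hb; exists [:: (a, b)]; rewrite big_seq1; split=> // p.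
by rewrite inE => /eqP ->; exists i, j.
Qed.

Lemma egrZ m (c : k) X : egr m X -> egr m (c *: X).
Proof.
move=> [s [hs ->]]; rewrite scaler_sumr big_seq; apply: egr_sum => p /hs [i [j [e ha hb]]].
rewrite -(linZ (et_linl _)); apply: (egr_et e) => //; exact: ca_gr_scale.
Qed.

Lemma egr_mul m m' X Y : egr m X -> egr m' Y -> egr (m + m') (X * Y).
Proof.
move=> [s [hs ->]] [t [ht ->]]; rewrite mulr_suml big_seq; apply: egr_sum => p hp.
rewrite mulr_sumr big_seq; apply: egr_sum => q hq.
have [i [j [e1 a1 b1]]] := hs _ hp; have [i' [j' [e2 a2 b2]]] := ht _ hq.
rewrite env_M; apply: (@egr_et (i + i') (j' + j)); [by lia | exact: ca_mul | exact: ca_mul].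
Qed.

Lemma egr_neg m X : m < 0 -> egr m X -> X = 0.
Proof.
move=> hm [s [hs ->]]; rewrite big_seq big1 // => p /hs [i [j [e ha hb]]].
have [hi|hj] : i < 0 \/ j < 0 by lia.
  by rewrite (ca_neg hi ha) et0l.
by rewrite (ca_neg hj hb) et0r.
Qed.

Lemma tproj_et m i j a b : ca_gr i a -> ca_gr j b ->
  tproj m (et a b) = if i + j == m%:Z then et a b else 0.
Proof.
move=> ha hb; rewrite tprojE.
case: (ltrP i 0) => hi; first by rewrite (ca_neg hi ha) et0l if_same big1 // => p _;
  rewrite (lin0 (@hproj_lin _)) et0l.
case: (ltrP j 0) => hj; first by rewrite (ca_neg hj hb) et0r if_same big1 // => p _;
  rewrite (lin0 (@hproj_lin _)) et0r.
case: i hi ha => // i _ ha; case: j hj hb => // j _ hb.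
case: eqP => e.
  have im : (i < m.+1)%N by lia.
  rewrite (bigD1 (Ordinal im)) //= hproj_id // hproj_id; last first.
    by have -> : (m - i)%N = j by lia.
  rewrite big1 ?addr0 // => p hp; rewrite (hproj_0 (p := p) ha) ?et0l //.
  by apply: contra hp => /eqP [hp]; apply/eqP/val_inj.
rewrite big1 // => p _; case: (eqVneq i p) => [ip|ip].
  rewrite (hproj_0 (p := m - p) hb) ?et0r //; apply/eqP => -[jp].
  by apply: e; have := ltn_ord p; lia.
by rewrite (hproj_0 (p := p) ha) ?et0l //; apply: contra ip => /eqP [->].
Qed.

Lemma tproj_id (m : nat) X : egr m%:Z X -> tproj m X = X.
Proof.
move=> [s [hs ->]]; rewrite (lin_sum (@tproj_lin m)) big_seq [RHS]big_seq.
apply: eq_bigr => p /hs [i [j [e ha hb]]].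
by rewrite (tproj_et _ ha hb) e eqxx.
Qed.

Lemma tproj_0 (m : nat) m' X : egr m' X -> m' != m%:Z -> tproj m X = 0.
Proof.
move=> [s [hs ->]] hm; rewrite (lin_sum (@tproj_lin m)) big_seq big1 // => p.
by move=> /hs [i [j [e ha hb]]]; rewrite (tproj_et _ ha hb) e (negPf hm).
Qed.

(** Independence of the components is tested with the projections [tproj] onto total degree m. *)
Lemma is_grading_env : is_grading egr.
Proof.
split.
- exact: egr0.
- by move=> m x y hx hy; rewrite -scaleN1r; apply: egrD => //; exact: egrZ.
- move=> X; have [s ->] := env_span X.
  have [t [ht et']] : exists t : seq (int * Ae), (forall p, p \in t -> egr p.1 p.2)
      /\ \sum_(p <- s) et p.1 p.2 = \sum_(p <- t) p.2.
    elim: s => [|p s [t [ht IH]]]; first by exists [::]; rewrite !big_nil.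
    have [u [hu eu]] := gr_decomp (ca_grading A) p.1.
    have [v [hv ev]] := gr_decomp (ca_grading A) p.2.
    exists ([seq (x.1 + y.1, et x.2 y.2) | x <- u, y <- v] ++ t); split.
      move=> q; rewrite mem_cat => /orP [/allpairsP [[x y] [/= hx hy ->]]|/ht //].
      exact: (egr_et erefl (hu _ hx) (hv _ hy)).
    rewrite big_cons big_cat IH; congr (_ + _); rewrite big_allpairs_dep eu (lin_sum (et_linl _)).
    by apply: eq_bigr => x _; rewrite ev (lin_sum (et_linr _)).
  exact: (gr_of_list egr0 egrD ht et').
move=> s F us hF e i hi.
case: (ltrP i 0) => i0; first exact: egr_neg i0 (hF i).
case: i i0 hi => // i _ hi; have := congr1 (tproj i) e.
rewrite (lin0 (@tproj_lin i)) (lin_sum (@tproj_lin i)) (bigD1_seq (Posz i)) //=.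
rewrite (tproj_id (hF i)) big1 ?addr0 // => j hj; exact: tproj_0 (hF j) hj.
Qed.

Lemma lproj_et p i a b : ca_gr i a -> lproj p (et a b) = if i == p%:Z then et a b else 0.
Proof.
move=> ha; rewrite lprojE; case: eqP => [e|/eqP e]; last by rewrite (hproj_0 ha e) et0l.
by rewrite hproj_id // -e.
Qed.

Lemma lproj_sum (m : nat) X : egr m%:Z X -> X = \sum_(p < m.+1) lproj p X.
Proof.
move=> [s [hs ->]]; under [RHS]eq_bigr do rewrite (lin_sum (@lproj_lin _)).
rewrite exchange_big big_seq [RHS]big_seq; apply: eq_bigr => p /hs [i [j [e ha hb]]].
under eq_bigr do rewrite (lproj_et _ _ ha).
case: (ltrP i 0) => hi; first by rewrite (ca_neg hi ha) et0l big1 // => q _; rewrite if_same.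
case: (ltrP j 0) => hj; first by rewrite (ca_neg hj hb) et0r big1 // => q _; rewrite if_same.
case: i hi ha e => // i _ ha; case: j hj hb => // j _ hb e.
have im : (i < m.+1)%N by lia.
rewrite (bigD1 (Ordinal im)) //= eqxx big1 ?addr0 // => q hq.
by case: eqP => // -[hq']; case/eqP: hq; apply: val_inj.
Qed.

Lemma lproj_lproj p q X : lproj q (lproj p X) = if q == p then lproj p X else 0.
Proof.
move: X; apply: env_ext_lin.
- by move=> c u v; rewrite !lproj_lin.
- by move=> c u v; case: (q == p); rewrite ?lproj_lin ?scaler0 ?addr0.
move=> a b; rewrite lprojE (lproj_et _ _ (hproj_gr p a)).
by rewrite -[(Posz p == Posz q)]/(p == q) eq_sym.
Qed.

Lemma lcontr_gr p (t : 'I_(fr_n Fr p)) (m : int) X : egr m X -> ca_gr (m - p%:Z) (lcontr t X).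
Proof.
move=> [s [hs ->]]; rewrite (lin_sum (@lcontr_lin _ t)) big_seq.
apply: (gr_sum (ca_grading A)) => q /hs [i [j [e ha hb]]]; rewrite lcontrE.
case: (eqVneq i p%:Z) => [ip|ip]; last first.
  by rewrite (frame_eq0 t ha ip) scale0r; exact: (gr0 (ca_grading A)).
have -> : m - p%:Z = j by rewrite -e ip addrAC subrr add0r.
exact: ca_gr_scale.
Qed.

Lemma lcontr_mulr p (t : 'I_(fr_n Fr p)) X b : lcontr t (X * et 1 b) = b * lcontr t X.
Proof.
move: X; apply: env_ext_lin.
- by move=> c u v; rewrite mulrDl -scalerAl lcontr_lin.
- by move=> c u v; rewrite lcontr_lin mulrDr scalerAr.
by move=> a b'; rewrite env_M mulr1 !lcontrE scalerAr.
Qed.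

(* Right multiplication by n (x) 1 raises the left degree by one.             *)
Lemma lproj_mull0 p X (n : A) : ca_gr 1 n -> (forall q : nat, (q < p)%N -> lproj q X = 0) ->
  forall q : nat, (q <= p)%N -> lproj q (X * et n 1) = 0.
Proof.
move=> hn hX q hq.
case: q hq => [|q] hq.
  move: (X); apply: env_ext_lin => [c u v|c u v|a b].
  - by rewrite mulrDl -scalerAl lproj_lin.
  - by rewrite scaler0 addr0.
  rewrite env_M mul1r lprojE.
  have [s [hs ->]] := gr_decomp (ca_grading A) a.
  rewrite mulr_suml (lin_sum (@hproj_lin _)) big_seq big1 ?et0l // => x /hs hx.
  case: (ltrP x.1 0) => h0; first by rewrite (ca_neg h0 hx) mul0r (lin0 (@hproj_lin _)).
  by apply: (hproj_0 (ca_mul hx hn)); apply/eqP; lia.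
have hS : lproj q.+1 (X * et n 1) = lproj q X * et n 1.
  move: (X); apply: env_ext_lin.
  - by move=> c u v; rewrite mulrDl -scalerAl lproj_lin.
  - by move=> c u v; rewrite lproj_lin mulrDl -scalerAl.
  move=> a b; rewrite env_M mul1r !lprojE env_M mul1r; congr (et _ _).
  have [s [hs ->]] := gr_decomp (ca_grading A) a.
  rewrite mulr_suml !(lin_sum (@hproj_lin _)) mulr_suml big_seq [RHS]big_seq.
  apply: eq_bigr => x /hs hx; case: (eqVneq x.1 q%:Z) => [e|e].
    rewrite e in hx; rewrite (hproj_id hx) hproj_id //.
    by have := ca_mul hx hn; rewrite -PoszD addn1.
  rewrite (hproj_0 hx e) mul0r; apply: (hproj_0 (ca_mul hx hn)).
  by apply: contra e => /eqP e; apply/eqP; lia.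
by rewrite hS hX // mul0r.
Qed.

(** [lcontr t] factors through [lproj p], because [fr_c t] vanishes outside degree p. *)
Lemma lproj_eq0 p X : lproj p X = 0 -> forall t, lcontr (p := p) t X = 0.
Proof.
move=> hX t.
suff h : lcontr t X = lcontr t (lproj p X) by rewrite h hX (lin0 (@lcontr_lin _ t)).
move: (X); apply: env_ext_lin; first exact: lcontr_lin.
  by move=> c u v; rewrite lproj_lin lcontr_lin.
move=> a b; rewrite lprojE !lcontrE; congr (_ *: _).
have [s [hs ->]] := gr_decomp (ca_grading A) a.
rewrite (lin_sum (@hproj_lin p)) !(lin_sum (@fr_lin _ _ Fr _ t)) big_seq [RHS]big_seq.
apply: eq_bigr => x /hs hx; case: (eqVneq x.1 p%:Z) => [e|e].
  by rewrite hproj_id // -e.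
by rewrite (hproj_0 hx e) (frame_eq0 t hx e) (lin0 (@fr_lin _ _ Fr _ t)).
Qed.

End Enveloping.

(** * The bimodule Koszul resolution *)

Section Bimodule.
Variables (k : fieldType) (A : connected_algebra k) (Ae : enveloping_algebra A).
Variables (Fr : frame A) (K : koszul_data A).
Local Notation et := (env_tens Ae).
Local Notation egr := (@env_gr k A Ae).
Local Notation r := (kd_r K).
Local Notation rk := (rk K).
Local Notation hE := (is_grading_env Ae Fr).

Hypothesis exactK : forall i (x : rk i), rk_ker x -> exists y, x = rk_diff y.
Hypothesis coassoc : forall i (j : 'I_(r i.+2)) (q : 'I_(r i)),
  \sum_l et (kd_n j l) (kd_m l q) = \sum_l et (kd_n l q) (kd_m j l).

(** The term A (x) W_i (x) A in coordinates along the basis of W_i. In [bk_mx], [kd_n] multiplies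
    the left factor A and [kd_m] the right one. *)
Definition bk (i : nat) : lmodType Ae := 'rV[Ae]_(r i).
Definition bk_gr (i : nat) (e : int) (x : bk i) : Prop :=
  row_gr egr i%:Z e (x : 'rV[Ae]_(r i)).

Definition sg (i : nat) : Ae := (-1) ^+ i.

Definition bk_mx i : 'M[Ae]_(r i.+1, r i) :=
  \matrix_(j, l) (et (kd_n j l) 1 + sg i.+1 * et 1 (kd_m j l)).

Definition bk_diff i (x : bk i.+1) : bk i := (x : 'rV_(r i.+1)) *m bk_mx i.

Fact bk_diff_linear i : linear (@bk_diff i).
Proof. by move=> a x y; rewrite /bk_diff mulmxDl -scalemxAl. Qed.

HB.instance Definition _ i := GRing.isLinear.Build Ae (bk i.+1) (bk i) *:%R
  (@bk_diff i) (@bk_diff_linear i).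

Definition bk_aug_row (j : 'I_(r 0)) : env_module Ae := (kd_la j)%:A : A.
Definition bk_aug : {linear bk 0 -> env_module Ae} := row_lin bk_aug_row.

Lemma sgC i X : sg i * X = X * sg i.
Proof. by rewrite /sg commr_sign. Qed.

Lemma sg_sg i : sg i * sg i = 1.
Proof. by rewrite /sg -expr2 sqrr_sign. Qed.

Lemma sgS i : sg i.+1 = - sg i.
Proof. by rewrite /sg exprS mulN1r. Qed.

Lemma sgE i (X : Ae) : sg i * X = ((-1) ^+ i : k) *: X.
Proof.
rewrite /sg -signr_odd -[in RHS]signr_odd.
by case: (odd i); rewrite ?expr0 ?expr1 ?mul1r ?scale1r ?mulN1r ?scaleN1r.
Qed.

Lemma egr_sg i m X : egr m X -> egr m (sg i * X).
Proof. by move=> hX; rewrite sgE; exact: egrZ. Qed.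

Lemma bk_entry_gr i j l : egr 1 (bk_mx i j l).
Proof.
rewrite mxE; apply: egrD; last apply: egr_sg.
  by apply: (@egr_et _ _ Ae 1 0) => //; [exact: kd_n1 | apply/ca_gr0; exists 1; rewrite scale1r].
by apply: (@egr_et _ _ Ae 0 1) => //; [apply/ca_gr0; exists 1; rewrite scale1r | exact: kd_m1].
Qed.

Lemma bk_diff_gr i e x : bk_gr e x -> bk_gr e (@bk_diff i x).
Proof.
move=> hx j; rewrite mxE; apply: egr_sum => l _.
have -> : e - i%:Z = (e - i.+1%:Z) + 1 by lia.
by apply: egr_mul; [exact: hx | exact: bk_entry_gr].
Qed.

Lemma signed_mul (s a b c d : Ae) : (forall x, s * x = x * s) -> s * s = 1 ->
  (a - s * b) * (c + s * d) = a * c - b * d + s * (a * d - b * c).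
Proof.
move=> hs ss; rewrite mulrDl !mulrDr !mulNr.
have -> : a * (s * d) = s * (a * d) by rewrite mulrA -hs mulrA.
have -> : s * b * (s * d) = b * d by rewrite hs -mulrA [s * (s * d)]mulrA ss mul1r.
rewrite -[s * b * c]mulrA mulrN -!addrA; congr (_ + _).
by rewrite [LHS]addrC -!addrA addrC -!addrA; congr (_ + _); rewrite addrC.
Qed.

(** The pure parts vanish by [kd_nn] and [kd_mm]; the signs of consecutive differentials are
    opposite, so the mixed terms cancel by [coassoc]. *)
Lemma bk_mx_mx i : bk_mx i.+1 *m bk_mx i = 0.
Proof.
apply/matrixP => j q; rewrite !mxE.
have e l : bk_mx i.+1 j l * bk_mx i l q =
    et (kd_n j l * kd_n l q) 1 - et 1 (kd_m l q * kd_m j l)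
    + sg i.+1 * (et (kd_n j l) (kd_m l q) - et (kd_n l q) (kd_m j l)).
  rewrite !mxE (sgS i.+1) mulNr signed_mul; [|exact: sgC | exact: sg_sg].
  by rewrite !env_M !mul1r !mulr1.
under eq_bigr do rewrite e.
rewrite big_split sumrB /= -mulr_sumr sumrB coassoc subrr mulr0 addr0.
rewrite -(lin_sum (et_linl Ae 1)) kd_nn -(lin_sum (et_linr Ae 1)) kd_mm.
by rewrite et0l et0r subrr.
Qed.

Lemma bk_diff_diff i x : bk_diff (@bk_diff i.+1 x) = 0.
Proof. by rewrite /bk_diff -mulmxA bk_mx_mx mulmx0. Qed.

Lemma bk_augE x : bk_aug x = \sum_j env_scale ((x : 'rV_(r 0)) 0 j) ((kd_la j)%:A : A).
Proof. by []. Qed.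

Lemma bk_aug_diff x : bk_aug (@bk_diff 0 x) = 0.
Proof.
pose u : {linear 'rV[Ae]_(r 1) -> env_module Ae} := (bk_aug \o @bk_diff 0)%FUN.
rewrite -[LHS]/(u x) -[RHS]/((\0 : {linear _ -> _}) x); apply: eq_row_lin => j.
rewrite /= /bk_diff -rowE bk_augE.
have e l : env_scale ((row j (bk_mx 0)) 0 l) ((kd_la l)%:A : A)
    = kd_la l *: kd_n j l - kd_la l *: kd_m j l.
  rewrite !mxE /sg expr1 mulN1r env_scaleDl.
  have -> : env_scale (- et 1 (kd_m j l)) ((kd_la l)%:A : A) = - env_scale (et 1 (kd_m j l)) ((kd_la l)%:A).
    exact: (scaleNr (et 1 (kd_m j l)) ((kd_la l)%:A : env_module Ae)).
  by rewrite !env_scaleE mulr1 mul1r -scalerAr -scalerAl mulr1 mul1r.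
by under eq_bigr do rewrite e; rewrite sumrB -kd_mn0 subrr.
Qed.

Lemma bk_aug_gr m x : bk_gr m x -> ca_gr m (bk_aug x).
Proof.
move=> hx; apply: (gr_sum (ca_grading A)) => j _.
have [s [hs e]] := hx j; rewrite subr0 in hs.
rewrite /bk_aug_row; have -> : (x : 'rV_(r 0)) 0 j *: ((kd_la j)%:A : env_module Ae)
  = \sum_(p <- s) kd_la j *: (p.1 * p.2).
  rewrite e scaler_suml; apply: eq_bigr => p _.
  by rewrite -[LHS]/(env_scale (et p.1 p.2) ((kd_la j)%:A : A)) env_scaleE -scalerAr -scalerAl mulr1.
rewrite big_seq; apply: (gr_sum (ca_grading A)) => p /hs [a [b [<- ha hb]]].
by apply: ca_gr_scale; exact: ca_mul.
Qed.

Lemma bk_aug_surj a : exists x, bk_aug x = a.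
Proof.
exists (\row_j et (kd_ka j *: a) 1); rewrite bk_augE.
transitivity (\sum_(j < r 0) (kd_ka j * kd_la j) *: (a : A)).
  apply: eq_bigr => j _.
  by rewrite mxE env_scaleE mulr1 -scalerAr mulr1 scalerA mulrC.
by rewrite -scaler_suml kd_kala1 scale1r.
Qed.

Definition bk_ker i : bk i -> Prop :=
  match i with 0 => fun x => bk_aug x = 0 | i.+1 => fun x => bk_diff x = 0 end.

Lemma bk_kerB i (x y : bk i) : bk_ker x -> bk_ker y -> bk_ker (x - y).
Proof.
case: i x y => [|i] x y hx hy.
  by rewrite -[bk_ker _]/(bk_aug (x - y) = 0) linearB (hx : bk_aug x = 0)
    (hy : bk_aug y = 0) subrr.
have hB : bk_diff (x - y) = bk_diff x - bk_diff y := linearB (@bk_diff i) x y.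
by rewrite -[bk_ker _]/(bk_diff (x - y) = 0) hB (hx : bk_diff x = 0)
  (hy : bk_diff y = 0) subrr.
Qed.

Lemma bk_ker_diff i x : bk_ker (@bk_diff i x).
Proof. by case: i x => [|i] x; [exact: bk_aug_diff | exact: bk_diff_diff]. Qed.

Definition rcontr i p (t : 'I_(fr_n Fr p)) (x : bk i) : rk i :=
  \row_j (lcontr (Ae := Ae) t ((x : 'rV_(r i)) 0 j) : A^c).

Definition left_ge i p (x : bk i) : Prop :=
  forall q : nat, (q < p)%N -> forall j, lproj Fr q ((x : 'rV_(r i)) 0 j) = 0.

(** The [kd_n] summand raises the left degree, so in the lowest left degree p the cycle equation
    involves the [kd_m] summand only, which is the right Koszul differential. *)
Lemma rcontr_ker i p t (x : bk i.+1) : left_ge p x -> bk_diff x = 0 ->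
  rk_ker (@rcontr i.+1 p t x).
Proof.
move=> hx dx; apply/rowP => l; rewrite rk_mulE mxE.
have := congr1 (fun y : bk i => lcontr t ((y : 'rV_(r i)) 0 l)) dx.
rewrite /= mxE (lin_sum (lcontr_lin t)) mxE (lin0 (lcontr_lin t)).
set s := sg i.+1; move=> h.
have h1 j : lcontr t ((x : 'rV_(r i.+1)) 0 j * bk_mx i j l)
    = (-1) ^+ i.+1 *: (kd_m j l * lcontr t ((x : 'rV_(r i.+1)) 0 j)).
  rewrite mxE mulrDr (linD (lcontr_lin t)).
  rewrite (lproj_eq0 (lproj_mull0 (p := p) (kd_n1 _ _) (fun q hq => hx q hq j) (leqnn p))) add0r.
  have -> : (x : 'rV_(r i.+1)) 0 j * (sg i.+1 * et 1 (kd_m j l))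
     = ((-1) ^+ i.+1 : k) *: ((x : 'rV_(r i.+1)) 0 j * et 1 (kd_m j l)).
    by rewrite mulrA -sgC -mulrA sgE.
  by rewrite (linZ (lcontr_lin t)) lcontr_mulr.
have h2 : (-1) ^+ i.+1 *: (\sum_j kd_m j l * lcontr t ((x : 'rV_(r i.+1)) 0 j)) = 0.
  by rewrite scaler_sumr -[RHS]h; apply: eq_bigr => j _; rewrite h1.
have h3 := congr1 (fun a : A => (-1) ^+ i.+1 *: a) h2.
rewrite scalerA -expr2 sqrr_sign scale1r scaler0 in h3.
by rewrite -[RHS]h3; apply: eq_bigr => j _; rewrite mxE.
Qed.

(* Exactness of the right Koszul complex removes the component of lowest left *)
(* degree of a cycle.                                                         *)
Lemma left_step i (p : nat) (e : int) (x : bk i) : bk_gr e x -> left_ge p x ->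
  (forall t, rk_ker (@rcontr i p t x)) ->
  exists2 y : bk i.+1, bk_gr e y & left_ge p.+1 (x - bk_diff y).
Proof.
move=> ex hx kx.
have hy (t : 'I_(fr_n Fr p)) : exists y : rk i.+1, rk_gr (e - p%:Z) y /\ rcontr t x = rk_diff y.
  have [y0 hy0] := exactK (kx t).
  have y0_gr : rk_gr (e - p%:Z) (rk_diff y0).
    by rewrite -hy0 => j; rewrite mxE addrAC; apply: lcontr_gr; exact: ex.
  have [y h1 h2] := gr_lift (is_grading_rk K i.+1) (is_grading_rk K i)
    (linear0 (@rk_diff _ _ K i)) (linearD (@rk_diff _ _ K i)) (@rk_diff_gr _ _ K i) y0_gr.
  by exists y; split=> //; rewrite hy0; exact: esym h2.
have [Y hY] := choice hy.
pose s : k := (-1) ^+ i.+1.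
have ss : s * s = 1 by rewrite -expr2 sqrr_sign.
(* The sign cancels that of the [kd_m] summand, which then reproduces the component of left degree
   p; the [kd_n] summand goes to left degree p+1. *)
pose y : bk i.+1 := \row_j (s *: \sum_t et (fr_a t) ((Y t : 'rV_(r i.+1)) 0 j : A)).
exists y.
  move=> j; rewrite mxE; apply: egrZ; apply: egr_sum => t _.
  apply: (@egr_et _ _ Ae _ _ _ _ _ _ (fr_gr t) ((hY t).1 j)); lia.
move=> q hq l; rewrite !mxE.
have -> : \sum_j y 0 j * bk_mx i j l
    = s *: (\sum_t \sum_j et (fr_a t * kd_n j l) ((Y t : 'rV_(r i.+1)) 0 j : A))
      + lproj Fr p ((x : 'rV_(r i)) 0 l).
  have e1 j : y 0 j * bk_mx i j l
     = s *: (\sum_t et (fr_a t * kd_n j l) ((Y t : 'rV_(r i.+1)) 0 j : A))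
       + \sum_t et (fr_a t) (kd_m j l * (Y t : 'rV_(r i.+1)) 0 j : A).
    rewrite !mxE mulrDr -!scalerAl sgE -/s -scalerAr scalerA ss scale1r !mulr_suml.
    by congr (s *: _ + _); apply: eq_bigr => t _; rewrite env_M ?mulr1 ?mul1r.
  under eq_bigr do rewrite e1.
  rewrite big_split -scaler_sumr /= [in X in s *: X]exchange_big /=; congr (_ + _).
  rewrite exchange_big /lproj; apply: eq_bigr => t _.
  rewrite -(lin_sum (et_linr Ae _)); congr (et _ _).
  have := congr1 (fun z : rk i => (z : 'rV_(r i)) 0 l : A) (hY t).2.
  by rewrite /= mxE rk_mulE => ->.
rewrite (linB (lproj_lin Fr q)) (linD (lproj_lin Fr q)) (linZ (lproj_lin Fr q)).
rewrite lproj_lproj (lin_sum (lproj_lin Fr q)) [in X in s *: X]big1 => [|t _]; last first.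
  rewrite (lin_sum (lproj_lin Fr q)) big1 // => j _.
  rewrite (lproj_et _ _ _ _ (ca_mul (fr_gr t) (kd_n1 j l))).
  by case: eqP => // e1; lia.
rewrite scaler0 add0r; case: eqP => [->|qp]; first by rewrite subrr.
by rewrite hx ?subr0 //; lia.
Qed.

Lemma bk_grB i e (x y : bk i) : bk_gr e x -> bk_gr e y -> bk_gr e (x - y).
Proof.
by move=> hx hy j; rewrite !mxE; exact: (grB hE (hx j) (hy j)).
Qed.

(** The bound is smaller for i = 0, where cycles are defined by the augmentation: for p < E the
    right factors have positive degree and [eps] kills them, but not for p = E. *)
Lemma left_iter i (e : int) (x : bk i) (E : nat) : e - i%:Z = E%:Z ->
  bk_gr e x -> bk_ker x ->
  forall p : nat, (p <= if i is 0 then E else E.+1)%N ->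
  exists2 y : bk i.+1, bk_gr e y & left_ge p (x - bk_diff y).
Proof.
move=> hE' ex kx; elim=> [|p IH] hp.
  exists 0; last by [].
  by move=> j; rewrite mxE; exact: egr0.
have [|y ey hy] := IH _; first by case: (i) hp => [|?]; lia.
have ex' := bk_grB ex (bk_diff_gr ey).
have kx' := bk_kerB kx (bk_ker_diff y).
have [t|y' ey' hy'] := left_step ex' hy.
  case: i x y E hE' ex kx hp {IH} ey hy ex' kx' t => [|i] x y E hE' ex kx hp ey hy ex' kx' t.
    rewrite /rk_ker big1 // => j _; rewrite mxE (eps_pos (e := e - p%:Z)) ?mulr0 //; first by lia.
    by have := lcontr_gr t (ex' j); rewrite subr0.
  exact: rcontr_ker.
exists (y + y'); first by rewrite -[y']opprK; apply: bk_grB => // j; have := ey' j; rewrite mxE; exact: (grN hE).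
by rewrite linearD opprD addrA.
Qed.

(** After [left_iter] no left degree is left if i > 0. If i = 0 the entries that remain are of the
    form a (x) 1, and [bk_aug] being zero on them forces each a to vanish. *)
Lemma bk_exact_gr i (e : int) (x : bk i) : bk_gr e x -> bk_ker x ->
  exists y, x = bk_diff y.
Proof.
move=> ex kx.
case: (ltrP (e - i%:Z) 0) => he.
  exists 0; rewrite linear0; apply/rowP => j; rewrite mxE; exact: egr_neg he (ex j).
have [E hE'] : exists E : nat, e - i%:Z = E%:Z by exists `|e - i%:Z|%N; lia.
have [//|y ey hy] := left_iter hE' ex kx (p := if i is 0 then E else E.+1).
exists y; apply/eqP; rewrite -subr_eq0; apply/eqP.
have ex' := bk_grB ex (bk_diff_gr ey).
have kx' := bk_kerB kx (bk_ker_diff y).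
move: hy ex' kx'; move: (x - bk_diff y) => {ex kx ey y} {x} x hx ex kx.
apply/rowP => j; rewrite mxE.
have xE l : (x : 'rV_(r i)) 0 l = \sum_(p < E.+1) lproj Fr p ((x : 'rV_(r i)) 0 l).
  by apply: lproj_sum; rewrite -hE'; exact: ex.
case: i x e he hE' hx ex kx j xE => [|i] x e he hE' hx ex kx j xE; last first.
  by rewrite xE big1 // => p _; apply: hx.
have xs l : exists a : A, (x : 'rV_(r 0)) 0 l = et a 1.
  rewrite xE big_ord_recr big1 => [|p _] /=; last by apply: hx; exact: (ltn_ord p).
  rewrite add0r /lproj.
  have h (t : 'I_(fr_n Fr E)) : lcontr t ((x : 'rV_(r 0)) 0 l) = (eps (lcontr t ((x : 'rV_(r 0)) 0 l)))%:A.
    apply: gr0_scalar; have := lcontr_gr t (ex l).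
    by have -> : e - 0%:Z - E%:Z = 0 by lia.
  exists (\sum_(t < fr_n Fr E) eps (lcontr t ((x : 'rV_(r 0)) 0 l)) *: fr_a t).
  rewrite (lin_sum (et_linl Ae 1)); apply: eq_bigr => t _.
  by rewrite {1}h (linZ (et_linr Ae _)) (linZ (et_linl Ae _)).
have [a ha] := choice xs.
have a0 : \sum_l kd_la l *: a l = 0.
  have kx' : bk_aug x = 0 := kx.
  rewrite bk_augE in kx'; rewrite -[RHS]kx'; apply: eq_bigr => l _.
  by rewrite ha env_scaleE mulr1 -scalerAr mulr1.
rewrite ha; have -> : a j = 0; last exact: et0l.
have := congr1 (fun b => kd_ka j *: b) a0; rewrite scaler0 scaler_sumr (bigD1 j) //=.
rewrite scalerA kd_kala eqxx scale1r big1 ?addr0 // => l hl.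
by rewrite scalerA kd_kala eq_sym (negPf hl) scale0r.
Qed.

Lemma bk_exact i (x : bk i) : bk_ker x -> exists y, x = bk_diff y.
Proof.
move=> kx; have [s [F [hF ->]]] : exists (s : seq int) (F : int -> bk i),
    (forall e, bk_gr e (F e) /\ bk_ker (F e)) /\ x = \sum_(e <- s) F e.
  case: i x kx => [|i] x kx.
    have [s [F [h1 h2]]] := (@gr_kernel (bk 0) (env_module Ae) (@bk_gr 0) (@ca_gr k A : int -> env_module Ae -> Prop)
      (is_grading_row hE (r 0) 0%:Z) (ca_grading A) bk_aug (linear0 bk_aug)
      (linearD bk_aug) bk_aug_gr x kx).
    by exists s, F.
  have [s [F [h1 h2]]] := (@gr_kernel (bk i.+1) (bk i) (@bk_gr i.+1) (@bk_gr i)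
    (is_grading_row hE (r i.+1) i.+1%:Z) (is_grading_row hE (r i) i%:Z) (@bk_diff i)
    (linear0 (@bk_diff i)) (linearD (@bk_diff i)) (@bk_diff_gr i) x kx).
  by exists s, F.
have [Y hY] := choice (fun e => bk_exact_gr (hF e).1 (hF e).2).
exists (\sum_(e <- s) Y e); rewrite linear_sum; apply: eq_bigr => e _; exact: hY.
Qed.

(** Transparent, so that its terms and differentials compute to [bk] and [bk_diff]. *)
Definition bk_resolution : proj_resolution (env_module Ae).
Proof.
apply: (@ProjResolution Ae (env_module Ae) bk (fun i => @bk_diff i) bk_aug).
- by move=> i; exact: row_projective.
- exact: bk_aug_surj.
- by move=> p; split=> [hp|[q ->]]; [exact: (bk_exact (i := 0)) | exact: bk_aug_diff].
- by move=> i p; split=> [hp|[q ->]]; [exact: (bk_exact (i := i.+1)) | exact: bk_diff_diff].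
Defined.

Lemma bk_graded : graded_resolution egr
  (@ca_gr k A : int -> env_module Ae -> Prop) (P := bk_resolution) (fun i => @bk_gr i).
Proof.
split=> [i|i m x|m x].
- split; first exact: (is_grading_row hE (r i) i%:Z).
  move=> a b X x hX hx j; rewrite mxE; have -> : a + b - i%:Z = a + (b - i%:Z) by lia.
  exact: egr_mul.
- exact: bk_diff_gr.
- exact: bk_aug_gr.
Qed.

End Bimodule.

(** * The Nakayama relation *)

Section Nakayama.
Variables (k : fieldType) (A : connected_algebra k) (Ae : enveloping_algebra A).
Variables (Fr : frame A) (K : koszul_data A).
Local Notation et := (env_tens Ae).
Local Notation egr := (@env_gr k A Ae).
Local Notation r := (kd_r K).
Local Notation rk := (rk K).
Local Notation bk := (bk Ae K).
Hypothesis exactK : forall i (x : rk i), rk_ker x -> exists y, x = rk_diff y.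
Hypothesis coassoc : forall i (j : 'I_(r i.+2)) (q : 'I_(r i)),
  \sum_l et (kd_n j l) (kd_m l q) = \sum_l et (kd_n l q) (kd_m j l).

Local Notation P := (bk_resolution Fr exactK coassoc).
Local Notation PD := (fun i => @bk_gr _ _ Ae K i).

(** The functional on W_i with values [c] on the basis, extended to an Ae-linear map on A (x) W_i
    (x) A. *)
Definition cochain i (c : 'I_(r i) -> k) (x : bk i) : Ae :=
  \sum_j c j *: (x : 'rV_(r i)) 0 j.

Lemma cochain_lin i (c : 'I_(r i) -> k) (a : Ae) x y :
  cochain c (a *: x + y) = a * cochain c x + cochain c y.
Proof.
rewrite /cochain mulr_sumr -big_split; apply: eq_bigr => l _.
by rewrite /= !mxE scalerDr scalerAr.
Qed.

Lemma cochain_mul i c (X : Ae) :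
  @graded_hom _ _ P PD Ae^o egr i (fun x => cochain c x * X).
Proof.
have [_ _ dec _] := is_grading_env Ae Fr.
have [s [F [hF ->]]] := dec X.
exists [seq m - i%:Z | m <- s], (fun j x => cochain c x * F (j + i%:Z)); split.
  move=> j; split.
    by move=> a x y; rewrite cochain_lin mulrDl -mulrA.
  move=> m x hx; have -> : m + j = (m - i%:Z) + (j + i%:Z) by lia.
  apply: egr_mul; last exact: hF.
  by apply: egr_sum => l _; apply: egrZ; exact: hx.
move=> x; rewrite big_map mulr_sumr; apply: eq_bigr => m _.
by rewrite subrK.
Qed.

Variables (d : nat) (mu : graded_auto A).
Hypothesis hmu : is_Nakayama Ae d.+1 mu.
Hypothesis top : r d.+2 = 0%N.
Variables (la ka : 'I_(r d.+1) -> k).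
Hypothesis kala : forall j l, ka j * la l = (j == l)%:R.

Lemma cocycle_cochain c X :
  @cocycle _ _ P PD Ae^o egr d.+1 (fun x => cochain c x * X).
Proof.
split; first exact: cochain_mul.
move=> x; have -> : x = 0.
  apply/rowP => j; have := ltn_ord j; by rewrite {2}top.
by rewrite linear0 /cochain big1 ?mul0r // => j _; rewrite mxE scaler0.
Qed.

(** The coordinates [la] and [ka] present W_(d+1) as a line, so a linear map is the basic cochain
    times its value on the generator. *)
Lemma cochain_la (u : bk d.+1 -> Ae) :
  (forall a x y, u (a *: x + y) = a * u x + u y) ->
  forall x, u x = cochain la x * \sum_j ka j *: u (delta_mx 0 j).
Proof.
move=> lu x; pose u' : bk d.+1 -> Ae^o := u.
have lu' : linear u' by exact: lu.
pose v : {linear 'rV[Ae]_(r d.+1) -> Ae^o} :=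
  HB.pack u' (GRing.isLinear.Build Ae 'rV[Ae]_(r d.+1) Ae^o *:%R u' lu').
rewrite -[LHS]/(v x) [x in LHS]row_sum_delta linear_sum /cochain mulr_suml.
apply: eq_bigr => l _; rewrite linearZ mulr_sumr (bigD1 l) //= big1 => [|j hj].
  by rewrite addr0 -scalerAl -scalerAr scalerA mulrC kala eqxx scale1r.
by rewrite -scalerAl -scalerAr scalerA mulrC kala (negPf hj) scale0r.
Qed.

(** The coboundary of the cochain [ga] is e0 (Y (x) 1 + 1 (x) sX). Applying psi gives u mu(Y) + sX u
    = 0, where u = psi(e0), and u is a non-zero scalar. *)
Lemma nakayama_relation (ga : 'I_(r d) -> k) :
  mu (\sum_l \sum_j (ka l * ga j) *: kd_n l j)
  = - ((-1) ^+ d.+1 *: \sum_l \sum_j (ka l * ga j) *: kd_m l j).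
Proof.
have [l0 hl] := hmu; have [_ [psi [psiD psiM psi_gr psi0 psi_surj]]] := hl P PD (bk_graded Fr exactK coassoc).
set cocyc := (@cocycle _ _ _ _ _ _ _) in psiD psiM psi_gr psi0 psi_surj.
pose e0 (x : bk d.+1) : Ae := cochain la x.
have cc X : cocyc (fun x => e0 x * X) := cocycle_cochain la X.
have ce0 : cocyc e0.
  have := cc 1; congr cocyc; apply: funext => x; exact: mulr1.
pose u := psi e0.
have psiS (s : seq (A * A)) : psi (fun x => e0 x * \sum_(p <- s) et p.1 p.2)
    = \sum_(p <- s) p.2 * u * mu p.1.
  elim: s => [|p s IH].
    rewrite [RHS]big_nil; set h0 := (h in psi h).
    have e : psi h0 = psi h0 + psi h0.
      apply: psiD; try exact: cc.
      by move=> x; rewrite /h0 big_nil mulr0 addr0.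
    by apply: (addIr (psi h0)); rewrite add0r.
  rewrite (psiD (fun x => e0 x * et p.1 p.2) (fun x => e0 x * \sum_(p <- s) et p.1 p.2)).
  - by rewrite IH big_cons (psiM p.1 p.2 e0).
  - exact: cc.
  - exact: cc.
  - by move=> x; rewrite big_cons mulrDr.
have u_gr : ca_gr (- d.+1%:Z + l0%:Z) u.
  apply: psi_gr => //; split.
    by move=> a x y; rewrite /e0 cochain_lin.
  move=> m x hx; apply: egr_sum => l _; apply: egrZ; exact: hx.
(* psi reaches 1 and every cochain is a multiple of e0, so 1 is a sum of terms b u mu(a); hence
   [eps u] is not zero. *)
have [s hs] : exists s : seq (A * A), 1 = \sum_(p <- s) p.2 * u * mu p.1.
  have [f hf f1] := psi_surj 1.
  have lf a x y : f (a *: x + y) = a * f x + f y.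
    have [[t [F [hF fE]]] _] := hf; rewrite !fE mulr_sumr -big_split.
    by apply: eq_bigr => j _; have [lF _] := hF j; exact: lF.
  have [s es] := env_span (\sum_j ka j *: f (delta_mx 0 j)).
  exists s; rewrite -psiS -f1; congr psi; apply: funext => x.
  by rewrite (cochain_la lf x) es.
have eu : eps u <> 0.
  move=> eu; have := congr1 (@eps k A) hs; rewrite eps1 eps_sum big1 => [|p _].
    by move/eqP; rewrite oner_eq0.
  by rewrite !epsM eu mulr0 mul0r.
(* u is homogeneous; in negative degree it would be zero, in positive degree [eps u] would be. *)
have u0 : u = (eps u)%:A.
  apply: gr0_scalar; case: (ltrP (- d.+1%:Z + l0%:Z) 0) => h.
    by case: eu; rewrite (ca_neg h u_gr) -(scale0r 1) epsZ mul0r.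
  case: (ltrP 0 (- d.+1%:Z + l0%:Z)) => h'; first by case: eu; exact: eps_pos h' u_gr.
  by have <- : - d.+1%:Z + l0%:Z = 0 by lia.
pose Y := \sum_l \sum_j (ka l * ga j) *: kd_n l j.
pose X := \sum_l \sum_j (ka l * ga j) *: kd_m l j.
rewrite -/X -/Y.
pose sX : A := (-1) ^+ d.+1 *: X.
have := psiS [:: (Y, 1); (1, sX)].
rewrite !big_cons !big_nil addr0 /= addr0.
have -> : psi (fun x => e0 x * (et Y 1 + et 1 sX)) = 0.
  apply/psi0; first exact: cc.
  exists (fun x => cochain ga x * 1); split; first exact: cochain_mul.
  move=> x; rewrite mulr1.
  have lw a x' y' : cochain ga (bk_diff (a *: x' + y'))
      = a * cochain ga (@bk_diff _ _ Ae K d x') + cochain ga (@bk_diff _ _ Ae K d y').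
    have -> : bk_diff (a *: x' + y') = a *: @bk_diff _ _ Ae K d x' + bk_diff y' := linearP _ _ _ _.
    exact: cochain_lin.
  rewrite [RHS](cochain_la lw x); congr (_ * _).
  rewrite /Y /X /sX (lin_sum (et_linl Ae 1)) (linZ (et_linr Ae 1)) (lin_sum (et_linr Ae 1)).
  rewrite scaler_sumr -big_split; apply: eq_bigr => l _.
  rewrite /= (lin_sum (et_linl Ae 1)) (lin_sum (et_linr Ae 1)) scaler_sumr -big_split.
  rewrite /cochain scaler_sumr; apply: eq_bigr => j _.
  rewrite /= /bk_diff -rowE !mxE (linZ (et_linl Ae 1)) (linZ (et_linr Ae 1)).
  rewrite [RHS]scalerA scalerDr; congr (_ + _).
  rewrite [LHS]scalerA [X in X *: _]mulrC -!scalerA; apply: congr1; apply: congr1.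
  by rewrite sgE.
rewrite mul1r u0 rmorph1 mulr1 -scalerAl mul1r -scalerAr mulr1 -scalerDr => /esym/eqP.
rewrite scaler_eq0 => /orP [/eqP /eu //|]; rewrite addr_eq0 => /eqP ->.
by [].
Qed.

End Nakayama.

(** * The tensor algebra *)

Section Presentation.
Variables (k : fieldType) (T : lalgType k) (A : connected_algebra k).
Variables (tp : nat -> T -> Prop) (tm : nat -> (T -> T) -> (T -> T) -> T -> T).
Hypothesis H : tensor_theory tp tm.
Variables (R : T -> Prop) (sR : gsubspace R) (hR : forall x, R x -> tp 2 x).
Variable pi : T -> A.

(** The facts about [pi] that are used over the abstract T; [comp m] is the projection onto tensors
    of length m. *)
Record presentation (comp : nat -> T -> T) : Prop := Presentation {
  ps_lin : linear pi;
  ps_M : forall x y, pi (x * y) = pi x * pi y;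
  ps_gr : forall m x, tp m x -> ca_gr m%:Z (pi x);
  ps_onto : forall a, exists x, pi x = a;
  ps_surj_gr : forall (m : nat) a, ca_gr m%:Z a -> exists2 x, tp m x & pi x = a;
  ps_ker1 : forall x, tp 1 x -> pi x = 0 -> x = 0;
  ps_ker2 : forall x, tp 2 x -> pi x = 0 -> R x;
  ps_R : forall x, R x -> pi x = 0;
  ps_comp_lin : forall m, linear (comp m);
  ps_comp_id : forall m x, tp m x -> comp m x = x;
  ps_comp_0 : forall m q x, tp q x -> q != m -> comp m x = 0;
  ps_comp_tp : forall m x, tp m (comp m x);
  ps_comp_pi : forall m x, pi x = 0 -> pi (comp m x) = 0
}.

Variable comp : nat -> T -> T.
Hypothesis hP : presentation comp.
Let lpi := ps_lin hP.

Lemma one_neq0 : (1 : T) <> 0.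
Proof.
by move=> e; have := @oner_eq0 T; rewrite e eqxx.
Qed.

Variable K : W_bases tp R.
Lemma W_line1 i (om : T) (la ka : 'I_(wr K i) -> k) : om <> 0 ->
  (forall j, wb j = la j *: om) -> om = \sum_j ka j *: wb j ->
  \sum_j ka j * la j = 1.
Proof.
move=> om0 hla hka; apply/eqP; rewrite -subr_eq0; apply/eqP.
have : (\sum_j ka j * la j - 1) *: om = 0.
  rewrite scalerBl scale1r scaler_suml {2}hka; apply/eqP; rewrite subr_eq0; apply/eqP.
  by apply: eq_bigr => j _; rewrite hla scalerA.
by move/eqP; rewrite scaler_eq0 => /orP [/eqP|/eqP].
Qed.

Lemma W0_coords : exists la ka : 'I_(wr K 0) -> k,
  [/\ forall j, wb j = la j *: 1, forall j l, ka j * la l = (j == l)%:R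
    & \sum_j ka j * la j = 1].
Proof.
have W1 : gW tp R 0 1 by exact: (tt_1 H).
have [la [ka [hla hka kala]]] := W_line K W1 (fun x hx => tt_0 H hx).
by exists la, ka; split=> //; exact: (W_line1 one_neq0 hla hka).
Qed.

Let la0 := sval (cid W0_coords).
Let ka0 := sval (cid (svalP (cid W0_coords))).
Let laka0 := svalP (cid (svalP (cid W0_coords))).

(** As W_0 is spanned by 1, both sides are [pi (wb j)]. *)
Lemma kd_mn0_sub (j : 'I_(wr K 1)) :
  \sum_l la0 l *: pi (Nl tm j l) = \sum_l la0 l *: pi (Mr tm j l).
Proof.
have [hla _ _] := laka0.
have e1 : wb j = \sum_l la0 l *: Mr tm j l.
  rewrite (wb_Mr H sR hR); apply: eq_bigr => l _.
  by rewrite hla -scalerAl mul1r.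
have e2 : wb j = \sum_l la0 l *: Nl tm j l.
  rewrite (wb_Nl H sR hR); apply: eq_bigr => l _.
  by rewrite hla -(tt_ZAr H) mulr1.
transitivity (pi (wb j)).
  by rewrite e2 (lin_sum lpi); apply: eq_bigr => l _; rewrite (linZ lpi).
by rewrite e1 (lin_sum lpi); apply: eq_bigr => l _; rewrite (linZ lpi).
Qed.

Lemma lift_degree1 (I : Type) (x : I -> A) : (forall l, ca_gr 1 (x l)) ->
  exists v : I -> T, forall l, tp 1 (v l) /\ pi (v l) = x l.
Proof.
move=> hx; have [l|v hv] := choice (P := fun l y => tp 1 y /\ pi y = x l).
  by have [y h1 h2] := ps_surj_gr hP (hx l); exists y.
by exists v.
Qed.

Definition W_koszul_data : koszul_data A.
Proof.
refine (@KoszulData k A (wr K) (fun i j l => pi (Mr tm j l)) (fun i j l => pi (Nl tm j l))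
  la0 ka0 _ _ _ _ _ _ _ _ _ _).
- by move=> i j l; apply: (ps_gr hP); exact: (Mr_tp H sR hR).
- by move=> i j l; apply: (ps_gr hP); exact: (Nl_tp H sR hR).
- move=> i j q; rewrite -[RHS](ps_R hP (Mr_Mr H sR hR j q)) (lin_sum lpi).
  by apply: eq_bigr => l _; rewrite (ps_M hP).
- move=> i j q; rewrite -[RHS](ps_R hP (Nl_Nl H sR hR j q)) (lin_sum lpi).
  by apply: eq_bigr => l _; rewrite (ps_M hP).
- exact: kd_mn0_sub.
- move=> i x hx e; have [v hv] := lift_degree1 hx.
  have [l|m|c hc] := Mr_kernel H sR hR (v := v); first exact: (hv l).1.
    apply: (ps_ker2 hP).
      apply: (gsubspace_sum (tt_sub H 2)) => l _.
      exact: (tt_M H (Mr_tp H sR hR l m) (hv l).1).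
    rewrite (lin_sum lpi) -[RHS](e m); apply: eq_bigr => l _.
    by rewrite (ps_M hP) (hv l).2.
  exists c => l; rewrite -(hv l).2 hc (lin_sum lpi).
  by apply: eq_bigr => j _; rewrite (linZ lpi).
- move=> x hx; have [v hv] := lift_degree1 hx.
  have [c hc] := Mr_kernel0 H sR hR (fun l => (hv l).1).
  exists c => l; rewrite -(hv l).2 hc (lin_sum lpi).
  by apply: eq_bigr => j _; rewrite (linZ lpi).
- move=> i c hc; apply: (Mr_inj H sR hR (c := c)) => l; apply: (ps_ker1 hP).
    apply: (gsubspace_sum (tt_sub H 1)) => j _; apply: (gsubspaceZ (tt_sub H 1)).
    exact: (Mr_tp H sR hR).
  rewrite (lin_sum lpi) -[RHS](hc l); apply: eq_bigr => j _; exact: (linZ lpi).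
- by case: laka0.
- by case: laka0.
Defined.

Lemma W_coassoc (Ae : enveloping_algebra A) (tau : T -> Ae) : linear tau ->
  (forall x y, tp 1 x -> tp 1 y -> tau (x * y) = env_tens Ae (pi x) (pi y)) ->
  forall i (j : 'I_(wr K i.+2)) (q : 'I_(wr K i)),
    \sum_l env_tens Ae (pi (Nl tm j l)) (pi (Mr tm l q))
    = \sum_l env_tens Ae (pi (Nl tm l q)) (pi (Mr tm j l)).
Proof.
move=> lt ht i j q; have := congr1 tau (Nl_Mr H sR hR j q); rewrite !(lin_sum lt).
under eq_bigr do rewrite (ht _ _ (Nl_tp H sR hR _ _) (Mr_tp H sR hR _ _)).
by under [X in _ = X -> _]eq_bigr do rewrite (ht _ _ (Nl_tp H sR hR _ _) (Mr_tp H sR hR _ _)).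
Qed.

(** The family in degree m is the image of a basis of V^m. The coordinates of a are those of rho
    applied to the length m part of a lift of a; since rho kills the relations of length m, they do
    not depend on the lift. *)
Lemma frame_exists : inhabited (frame A).
Proof.
have tb m := tt_basis H (tt_sub H m) (fun x h => h).
pose ker m x := tp m x /\ pi x = 0.
have sker m : gsubspace (ker m).
  split; first by split; [case: (tt_sub H m) | exact: (lin0 lpi)].
  move=> c x y [h1 h2] [h3 h4]; split; first by case: (tt_sub H m) => _; apply.
  by rewrite lpi h2 h4 scaler0 addr0.
have tk m := tt_basis H (sker m) (fun x h => h.1).
have rho m : exists rho : T -> T, [/\ linear rho, forall x, ker m x -> rho x = 0
    & forall x, tp m x -> tp m (rho x) /\ pi (rho x) = pi x].
  have [r [w [al [lal hw _ hE]]]] := tk m.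
  exists (fun x => x - \sum_j al j x *: w j); split.
  - move=> c x y.
    have -> : \sum_j al j (c *: x + y) *: w j = c *: (\sum_j al j x *: w j) + \sum_j al j y *: w j.
      rewrite scaler_sumr -big_split; apply: eq_bigr => j _.
      by rewrite (lal j c x y) scalerDl scalerA.
    by rewrite opprD scalerBr addrACA.
  - by move=> x hx; rewrite {1}(hE x hx) subrr.
  move=> x hx; split.
    apply: (gsubspaceB (tt_sub H m) hx); apply: (gsubspace_sum (tt_sub H m)) => j _.
    by apply: (gsubspaceZ (tt_sub H m)); case: (hw j).
  rewrite (linB lpi) (lin_sum lpi) big1 ?subr0 // => j _.
  by rewrite (linZ lpi) (hw j).2 scaler0.
pose s a := sval (cid (ps_onto hP a)).
have sE a : pi (s a) = a by exact: (svalP (cid (ps_onto hP a))).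
have f m : exists (r : nat) (a : 'I_r -> A) (c : 'I_r -> A -> k),
    [/\ forall t, linear (c t : A -> k^o), forall t, ca_gr m%:Z (a t),
      forall t (q : int) x, q != m%:Z -> ca_gr q x -> c t x = 0
      & forall x, ca_gr m%:Z x -> x = \sum_t c t x *: a t].
  have [r [w [al [lal hw _ hE]]]] := tb m; have [rh [lrh rh0 rhE]] := rho m.
  have cE x t : al t (rh (comp m (s (pi x)))) = al t (rh (comp m x)).
    have e : rh (comp m (s (pi x) - x)) = 0.
      apply: rh0; split; first exact: (ps_comp_tp hP).
      by apply: (ps_comp_pi hP); rewrite (linB lpi) sE subrr.
    rewrite (linB (ps_comp_lin hP m)) (linB lrh) in e.
    by move/eqP: e; rewrite subr_eq0 => /eqP ->.
  exists r, (fun t => pi (w t)), (fun t a => al t (rh (comp m (s a)))); split.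
  - move=> t c x y; have -> : c *: x + y = pi (c *: s x + s y) by rewrite lpi !sE.
    by rewrite cE (ps_comp_lin hP) lrh lal.
  - by move=> t; apply: (ps_gr hP).
  - move=> t q x hq hx.
    have [q0|[q' eq]] : q < 0 \/ exists q' : nat, q = q'%:Z.
      by case: q {hq hx} => q; [right; exists q | left].
      have -> : x = pi 0 by rewrite (ca_neg q0 hx) (lin0 lpi).
      rewrite cE (lin0 (ps_comp_lin hP m)) (lin0 lrh); exact: (lin0 (lal t)).
    rewrite eq in hx hq; have [y hy <-] := ps_surj_gr hP hx.
    rewrite cE (ps_comp_0 hP hy) ?(lin0 lrh); first exact: (lin0 (lal t)).
    by apply: contra hq => /eqP ->.
  - move=> x hx; have [y hy <-] := ps_surj_gr hP hx.
    have [h1 h2] := rhE y hy.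
    rewrite -h2 {1}(hE _ h1) (lin_sum lpi) h2; apply: eq_bigr => t _.
    by rewrite (linZ lpi) cE (ps_comp_id hP hy).
have [r hr] := choice f.
pose ok m (a : 'I_(r m) -> A) (c : 'I_(r m) -> A -> k) :=
  [/\ forall t, linear (c t : A -> k^o), forall t, ca_gr m%:Z (a t),
      forall t (q : int) x, q != m%:Z -> ca_gr q x -> c t x = 0
    & forall x, ca_gr m%:Z x -> x = \sum_t c t x *: a t].
have [a h2] : exists a : forall m, 'I_(r m) -> A, forall m, exists c, ok m (a m) c.
  by exists (fun m => sval (cid (hr m))) => m; exact: (svalP (cid (hr m))).
have [c h3] : exists c : forall m, 'I_(r m) -> A -> k, forall m, ok m (a m) (c m).
  by exists (fun m => sval (cid (h2 m))) => m; exact: (svalP (cid (h2 m))).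
by split; exists r a c => m; case: (h3 m).
Qed.

End Presentation.

(** * The free algebra on words as a tensor algebra *)

Section Concrete.
Variables (k : fieldType) (n : nat).
Local Notation T := (tensor_algebra k n).

Lemma tensor_algebra_theory : @tensor_theory k T (@tpow k n) (@tensmap k n).
Proof.
split.
- exact: TZAr.
- exact: subspace_tpow.
- exact: tpow0_1.
- by move=> x /tpow0P ->; eexists.
- exact: tpowM.
- by move=> p q x; exact: tpow_tens.
- exact: tensmap_is_linear.
- exact: tensmapM.
- exact: tpow_basis.
Qed.

Lemma word_sum (x : T) : x = \sum_(w <- msupp x) x@_w *: << w >>.
Proof.
rewrite {1}[x]monalgE; apply: eq_bigr => w _.
by apply/malgP => v; rewrite mcoeffZU mcoeffU; case: (w == v).
Qed.

Lemma eq_words (U : lmodType k) (f g : T -> U) : linear f -> linear g ->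
  (forall w, f << w >> = g << w >>) -> f =1 g.
Proof.
move=> lf lg h x; rewrite [x]word_sum (lin_sum lf) (lin_sum lg).
by apply: eq_bigr => w _; rewrite (linZ lf) (linZ lg) h.
Qed.

Definition comp m : T -> T :=
  linext (fun w : {fmonom 'I_n} => if size w == m then << w >> else 0 : T).

Lemma comp_linear m : linear (comp m).
Proof. exact: linext_is_linear. Qed.

Lemma comp_word m w : comp m << w >> = if size w == m then << w >> else 0 : T.
Proof. exact: linextU. Qed.

Lemma comp_id m x : tpow m x -> comp m x = x.
Proof.
move=> /tpowE ->; rewrite (lin_sum (@comp_linear m)); apply: eq_bigr => t _.
by rewrite (linZ (@comp_linear m)) comp_word size_tuple eqxx.
Qed.

Lemma comp_0 m q x : tpow q x -> q != m -> comp m x = 0.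
Proof.
move=> /tpowE -> hq; rewrite (lin_sum (@comp_linear m)) big1 // => t _.
by rewrite (linZ (@comp_linear m)) comp_word size_tuple (negPf hq) scaler0.
Qed.

Lemma comp_tpow m x : tpow m (comp m x).
Proof.
have sS := @subspace_tpow k n m; apply: (subspace_sum sS) => w _.
apply: (subspaceZ sS); case: eqP => [<-|_]; [exact: tpow_wordP | exact: tpow0].
Qed.

(** Only the constant terms of [a] and [b] contribute to lengths up to 2. Hence the ideal of R meets
    V in zero and V (x) V in R. *)
Lemma comp_ideal m (a r b : T) : tpow 2 r -> (m <= 2)%N ->
  comp m (a * r * b)
  = if m == 2 then (a@_(FMonom [::]) * b@_(FMonom [::])) *: r else 0.
Proof.
move=> hr hm; pose g (a b : T) : T :=
  if m == 2 then (a@_(FMonom [::]) * b@_(FMonom [::])) *: r else 0.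
rewrite -[RHS]/(g a b); move: a; apply: eq_words.
- by move=> c u v; rewrite !mulT_linl comp_linear.
- move=> c u v; rewrite /g; case: (m == 2); last by rewrite scaler0 addr0.
  by rewrite mcoeffD mcoeffZ mulrDl scalerDl -mulrA scalerA.
move=> u; move: b; apply: eq_words.
- by move=> c x y; rewrite !mulT_linr comp_linear.
- move=> c x y; rewrite /g; case: (m == 2); last by rewrite scaler0 addr0.
  by rewrite mcoeffD mcoeffZ mulrDr scalerDl mulrCA scalerA.
move=> v; have hp := tpowM (tpowM (@tpow_wordP k n u) hr) (@tpow_wordP k n v).
rewrite /g !mcoeffU1.
case: (eqVneq m 2) => [->|m2]; last by rewrite (comp_0 hp) //; lia.
case: (posnP (size u)) => [/size0nil u0|u0]; last first.
  have -> : (u == FMonom [::]) = false by rewrite fmP; case: (u : seq _) u0.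
  by rewrite mul0r scale0r (comp_0 hp) //; lia.
case: (posnP (size v)) => [/size0nil v0|v0]; last first.
  have -> : (v == FMonom [::]) = false by rewrite fmP; case: (v : seq _) v0.
  by rewrite mulr0 scale0r (comp_0 hp) //; lia.
have eu : u = FMonom [::] by apply/eqP; rewrite fmP u0.
have ev : v = FMonom [::] by apply/eqP; rewrite fmP v0.
by rewrite eu ev !eqxx mulr1 scale1r !word1 T1mul Tmul1 comp_id.
Qed.

(** The words of [x] are grouped by their prefix u of length m; [Q] is asked of the cofactor of each
    u. *)
Lemma tens_sums m (Q : T -> Prop) x : tpow (m + 2) x ->
  (forall u : m.-tuple 'I_n,
     Q (linext (fun w : {fmonom 'I_n} =>
       if take m w == u then << FMonom (drop m w) >> else 0 : T) x)) ->
  tens (@tpow k n m) Q x.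
Proof.
move=> hx hQ; exists [seq (<< FMonom u >>, linext (fun w : {fmonom 'I_n} =>
    if take m w == u then << FMonom (drop m w) >> else 0 : T) x) | u : m.-tuple 'I_n].
split; first by move=> p /mapP [u _ ->]; split; [exact: (@tpow_word _ _ _ u) | exact: hQ].
rewrite big_map big_enum /=.
pose f (u : m.-tuple 'I_n) := linext (fun w : {fmonom 'I_n} =>
  if take m w == u then << FMonom (drop m w) >> else 0 : T).
move: x hx {hQ}.
pose g0 (x : T) : T := \sum_(u : m.-tuple 'I_n) << FMonom u >> * f u x.
have gl : linear g0.
  move=> c x y; rewrite /g0 scaler_sumr -big_split; apply: eq_bigr => u _.
  by rewrite /f linext_is_linear mulT_linr.
pose g : {linear T -> T} := HB.pack g0 (GRing.isLinear.Build k T T *:%R g0 gl).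
apply: (eq_tpow (f := idfun) (g := g)) => t; rewrite /= /g0.
have ht : size (take m t) == m by rewrite size_take size_tuple; case: ltnP => //; lia.
rewrite (bigD1 (Tuple ht)) //= /f linextU eqxx wordM cat_take_drop big1 ?addr0 // => u hu.
rewrite linextU; case: eqP => [e|_]; last by rewrite Tmul0.
by case/eqP: hu; apply: val_inj.
Qed.

Variables (R : T -> Prop) (A : connected_algebra k) (pi : {lrmorphism T -> A}).
Hypothesis hA : presents R pi.

Lemma pi_comp m x : ca_gr m%:Z (pi x) -> pi (comp m x) = pi x.
Proof.
move=> hx; have [_ _ _ _ hg] := hA.
pose s := [seq (Posz (size w), x@_w *: pi << w >>) | w : {fmonom 'I_n} <- msupp x].
have e : pi x = \sum_(p <- s) p.2.
  by rewrite big_map {1}[x]word_sum linear_sum; apply: eq_bigr => w _; rewrite linearZ.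
rewrite (gr_component (ca_grading A) _ e hx) => [|p /mapP [w _ ->]]; last first.
  by rewrite -linearZ; apply: hg; apply: (subspaceZ (@subspace_tpow k n _)); exact: tpow_wordP.
rewrite big_map /comp /linext linear_sum big_mkcond [RHS]big_mkcond /=.
apply: eq_bigr => w _; rewrite eqz_nat linearZ.
by case: (size w == m); rewrite ?linear0 /= ?scaler0.
Qed.

Lemma presentation_pi : presentation (T := T) (@tpow k n) R pi comp.
Proof.
have [sR hR surj kerI hg] := hA; split.
- exact: linearP.
- exact: rmorphM.
- exact: hg.
- exact: surj.
- move=> m a ha; have [x hx] := surj a; exists (comp m x); first exact: comp_tpow.
  by rewrite pi_comp hx.
- move=> x hx /kerI [s [hs ex]].
  rewrite -(comp_id hx) ex (lin_sum (@comp_linear 1)) big_seq big1 // => p /hs hp.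
  by rewrite comp_ideal //; exact: hR.
- move=> x hx /kerI [s [hs ex]].
  rewrite -(comp_id hx) ex (lin_sum (@comp_linear 2)); apply: (subspace_sum_seq sR).
  move=> p /hs hp; rewrite comp_ideal //=; last exact: hR.
  exact: (subspaceZ sR).
- move=> x hx; apply/kerI; exists [:: (1, x, 1)]; split.
    by move=> p; rewrite inE => /eqP ->.
  by rewrite big_seq1 T1mul Tmul1.
- exact: comp_linear.
- exact: comp_id.
- by move=> m q x; exact: comp_0.
- exact: comp_tpow.
- move=> m x hx; rewrite pi_comp // hx; exact: (gr0 (ca_grading A)).
Qed.

Lemma tens2_map (U : lmodType k) (b : A -> A -> U) :
  (forall a, linear (b a)) -> (forall a', linear (b^~ a')) ->
  exists2 tau : T -> U, linear tau
    & forall x y, tpow 1 x -> tpow 1 y -> tau (x * y) = b (pi x) (pi y).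
Proof.
move=> h1 h2; pose tau := linext (fun w : {fmonom 'I_n} =>
  b (pi << FMonom (take 1 w) >>) (pi << FMonom (drop 1 w) >>)).
exists tau; first exact: linext_is_linear.
apply: (bilin_tpow (b := fun x y => tau (x * y)) (b' := fun x y => b (pi x) (pi y))).
- by move=> x c u v; rewrite mulT_linr /tau linext_is_linear.
- by move=> y c u v; rewrite /= mulT_linl /tau linext_is_linear.
- by move=> x c u v; rewrite linearP h1.
- by move=> y c u v; rewrite /= linearP h2.
move=> t s; rewrite wordM /tau linextU /= take_size_cat ?size_tuple //.
by rewrite drop_size_cat ?size_tuple.
Qed.

Section Pairs.
Variables (sbar : graded_auto A) (sigma : {linear T -> T}) (dbar : {linear A -> A}).
Variables (B : algType k) (iota : {lrmorphism A -> B}) (z : B).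
Hypothesis hsigma : forall v, tpow 1 v -> tpow 1 (sigma v) /\ pi (sigma v) = sbar (pi v).
Hypothesis hB : Ore_extension sbar dbar iota z.

(** The polynomials 0 and [a%:P] would both expand 0 in powers of [z]. *)
Lemma iota_inj a : iota a = 0 -> a = 0.
Proof.
have [_ uniq] := hB; move=> ha; have [p [_ hp]] := uniq 0.
have e0 : p = 0 by apply: hp; rewrite size_poly0 big_ord0.
have : p = a%:P.
  apply: hp; rewrite size_polyC; case: (a != 0); last by rewrite big_ord0.
  by rewrite big_ord_recl big_ord0 coefC eqxx ha mul0r addr0.
by rewrite e0 => /esym/eqP; rewrite polyC_eq0 => /eqP.
Qed.

Lemma id_mBE j y u : @id_mB k n A pi B iota j y u =
  iota (pi (linext (fun w : {fmonom 'I_n} =>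
     if take j w == u then << FMonom (drop j w) >> else 0 : T) y)).
Proof.
rewrite /id_mB /linext !linear_sum big_mkcond; apply: eq_bigr => w _.
case: eqP => _; last by rewrite scaler0 !linear0.
rewrite !linearZ /mB -!rmorphM wordM; congr (_ *: iota (pi << FMonom _ >>)).
have -> : drop j.+1 w = drop 1 (drop j w) by rewrite drop_drop add1n.
exact: cat_take_drop.
Qed.

(** On V (x) V the map [mB] is [iota] after [pi], whose kernel there is R; apply this to the
    cofactor of each prefix. *)
Lemma id_mB_kernel j y y' : tpow (j + 2) (y - y') ->
  @id_mB k n A pi B iota j y =1 @id_mB k n A pi B iota j y' ->
  tens (@tpow k n j) R (y - y').
Proof.
move=> hy h; apply: tens_sums => // u.
have hP := presentation_pi; apply: (ps_ker2 hP).
  have sS := @subspace_tpow k n 2.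
  apply: (subspace_sum_seq sS) => w hw; apply: (subspaceZ sS).
  case: eqP => _; last exact: tpow0.
  have -> : 2%N = size (FMonom (drop j w)) by rewrite /= size_drop (hy w hw) addKn.
  exact: tpow_wordP.
apply: iota_inj; have := h u; rewrite !id_mBE => /eqP; rewrite -subr_eq0 => /eqP <-.
by rewrite !linearB.
Qed.

Lemma tpowmap_linear m : linear (tpowmap sigma m).
Proof. by case: m => [|m]; [by [] | exact: tensmap_is_linear]. Qed.

Lemma tpowmap_tpow m x : tpow m x -> tpow m (tpowmap sigma m x).
Proof.
elim: m x => [//|m IH] x hx /=.
have H := tensor_algebra_theory.
apply: (tp_tm H (p' := 1) (q' := m) (P := @tpow k n 1) (linearP sigma) (@tpowmap_linear m)).
- by move=> y hy; split=> //; exact: (hsigma hy).1.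
- exact: IH.
- exact: (@tpow_tens k n 1 m).
Qed.

Lemma gpair_of_sequence_pair dr dl : sequence_pair R pi dbar sigma iota dr dl ->
  exists2 delta : T -> T,
    forall v, tpow 1 v -> tpow 2 (delta v) /\ pi (delta v) = dbar (pi v)
    & gpair (T := T) (@tpow k n) (@tensmap k n) R sigma (tpowmap sigma) delta
        (fun i => dr i) (fun i => dl i).
Proof.
move=> [delta [h1 [h2 _] h3 h4 h5]]; have [sR hR _ _ _] := hA.
have H := tensor_algebra_theory.
have idl : linear (id : T -> T) by [].
exists delta; first exact: h1.
split.
- exact: linearP.
- by move=> i; exact: linearP.
- by move=> i; exact: linearP.
- by move=> v /h1 [].
- exact: h2.
- by move=> i x hx; have [] := h3 i.+1 x isT hx.
- move=> i x hx; rewrite -addrA -opprD; apply: id_mB_kernel; last exact: (h4 i.+2 x isT hx).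
  have sS := @subspace_tpow k n (i.+1 + 2).
  have dr_tp j y : W R j.+1 y -> tpow (j + 2) (dr j.+1 y).
    move=> hy; have -> : (j + 2 = j.+1 + 1)%N by lia.
    apply/(gtens_tp H); apply: gtens_mono (h3 j.+1 y isT hy).1 => // v.
    exact: (gW_tp H sR hR (i := j.+1)).
  have wx : tpow (i.+1 + 1) x by rewrite addn1; exact: (gW_tp H sR hR (i := i.+2) hx).
  apply: (subspaceB sS); first exact: (dr_tp i.+1).
  apply: (subspaceD sS).
    apply: (tp_tm H (P := @tpow k n i.+1) (q := 1) (@tpowmap_linear i.+1) (linearP delta)).
    - by move=> y hy; split=> //; exact: tpowmap_tpow.
    - by move=> y hy; exact: (h1 _ hy).1.
    - exact: tpow_tens.
  have -> : (i.+1 + 2 = (i + 2) + 1)%N by lia.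
  apply: (tp_tm H (P := W R i.+1) (q := 1) (linearP (dr i.+1)) idl) => //.
  - by move=> y hy; split; [exact: (gW_tp H sR hR (i := i.+1)) | exact: dr_tp].
  - exact: (W_tensr H sR hR (i := i.+1)).
by move=> i x hx; exact: (h5 i.+1 x isT hx).
Qed.

End Pairs.
End Concrete.

(** * Comparison of two sequence pairs in A *)

Section PairInvariance.
Variables (k : fieldType) (T : lalgType k) (A : connected_algebra k).
Variables (tp : nat -> T -> Prop) (tm : nat -> (T -> T) -> (T -> T) -> T -> T).
Hypothesis H : tensor_theory tp tm.
Variables (R : T -> Prop) (sR : gsubspace R) (hR : forall x, R x -> tp 2 x).
Variables (pi : T -> A) (comp : nat -> T -> T).
Hypothesis hP : presentation tp R pi comp.
Variables (Ae : enveloping_algebra A) (tau : T -> Ae).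
Hypothesis ltau : linear tau.
Hypothesis htau : forall x y, tp 1 x -> tp 1 y -> tau (x * y) = env_tens Ae (pi x) (pi y).
Variables (d : nat) (mu : graded_auto A).
Hypotheses (hKoszul : Koszul A) (hAS : AS_regular A d.+1) (hmu : is_Nakayama Ae d.+1 mu).
Variables (sbar : graded_auto A) (sigma : T -> T) (F : nat -> T -> T).
Hypothesis lsigma : linear sigma.
Hypothesis hsigma : forall v, tp 1 v -> tp 1 (sigma v) /\ pi (sigma v) = sbar (pi v).
Hypothesis lF : forall i, linear (F i).
Hypothesis F_tp : forall i x, tp i x -> tp i (F i x).
Variables (delta delta' : T -> T) (dr dl dr' dl' : nat -> T -> T).
Hypotheses (hp : gpair tp tm R sigma F delta dr dl)
  (hp' : gpair tp tm R sigma F delta' dr' dl').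
Hypothesis hdelta : forall v, tp 1 v -> pi (delta v) = pi (delta' v).
Variables (om er el er' el' : T).
Hypotheses (hom : gW tp R d.+1 om) (om0 : om <> 0).
Hypothesis hline : forall x, gW tp R d.+1 x -> exists c : k, x = c *: om.
Hypotheses (her : tp 1 er) (hel : tp 1 el) (her' : tp 1 er') (hel' : tp 1 el').
Hypotheses (der : dr d.+1 om = om * er) (del : dl d.+1 om = el * om).
Hypotheses (der' : dr' d.+1 om = om * er') (del' : dl' d.+1 om = el' * om).

(** Changing the pair adds [pi X] to the first summand; it changes the second by (-1)^(d+1)
    mu([pi Y]), which is - [pi X] by [nakayama_relation]. *)
Lemma pair_invariance : pi er + mu (gau_inv sbar (pi el)) = pi er' + mu (gau_inv sbar (pi el')).
Proof.
have [K] := W_bases_exist H sR hR; have [Fr] := frame_exists H hP.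
pose D := W_koszul_data H sR hR hP K.
have [P [PD [hgr [hfree _]]]] := hKoszul.
have exactD : forall i (x : rk D i), rk_ker x -> exists y, x = rk_diff y.
  by move=> i x; exact: (rk_exact hgr hfree).
(* The global dimension bounds some resolution of k, which forces W_(d+2) = 0 through [rk_top]. *)
have [[hgl _] _] := hAS; have [Q hQ] := hgl (trivial_module A).
have top : kd_r D d.+2 = 0%N := rk_top exactD hQ.
have W_top x : gW tp R d.+2 x -> x = 0.
  move=> /(@wbE _ _ _ _ K d.+2) ->; rewrite big1 // => j _.
  by have := ltn_ord j; rewrite [X in (_ < X)%N](top : wr K d.+2 = 0%N).
have [la [ka [_ hka kala]]] := W_line K hom hline.
have coassocD := W_coassoc H sR hR (K := K) ltau htau.
have [ga [e1 e2]] := pair_difference H sR hR lsigma (fun v hv => (hsigma hv).1) lF F_tp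
  hp hp' (fun v hv => ps_ker2 hP (gsubspaceB (tt_sub H 2) (gp_tp hp hv) (gp_tp hp' hv))
     (etrans (linB (ps_lin hP) _ _) (etrans (congr1 (fun a => a - _) (hdelta hv)) (subrr _))))
  hom om0 hline hka W_top her hel her' hel' der del der' del'.
have lpi := ps_lin hP.
have nak := nakayama_relation Fr exactD (coassocD : forall i j q, _ = _) hmu top kala ga.
set Y := \sum_l _ in e2; set X := \sum_l _ in e1.
have piX : pi X = \sum_l \sum_j (ka l * ga j) *: @kd_m _ _ D d l j.
  rewrite (lin_sum lpi); apply: eq_bigr => l _; rewrite (lin_sum lpi).
  by apply: eq_bigr => j _; rewrite (linZ lpi).
have piY : pi Y = \sum_l \sum_j (ka l * ga j) *: @kd_n _ _ D d l j.
  rewrite (lin_sum lpi); apply: eq_bigr => l _; rewrite (lin_sum lpi).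
  by apply: eq_bigr => j _; rewrite (linZ lpi).
have hY : tp 1 Y.
  apply: (gsubspace_sum (tt_sub H 1)) => l _; apply: (gsubspace_sum (tt_sub H 1)) => j _.
  by apply: (gsubspaceZ (tt_sub H 1)); exact: (Nl_tp H sR hR).
have er_eq : pi er - pi er' = pi X by rewrite -(linB lpi) e1.
have el_eq : gau_inv sbar (pi el) - gau_inv sbar (pi el') = (-1) ^+ d.+1 *: pi Y.
  apply: (can_inj (gauK sbar)).
  transitivity (pi el - pi el').
    by rewrite linearB; congr (_ - _); exact: gau_invK.
  rewrite -(linB lpi) e2 (linZ lpi) (hsigma hY).2.
  by rewrite linearZ.
have : mu (gau_inv sbar (pi el)) - mu (gau_inv sbar (pi el')) = - pi X.
  rewrite -linearB el_eq linearZ /= piY nak piX scalerN scalerA -expr2 sqrr_sign.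
  by rewrite scale1r.
rewrite -er_eq opprB => h; apply/eqP; rewrite -subr_eq0 opprD addrACA h.
by rewrite addrA subrK subrr.
Qed.

End PairInvariance.

Theorem corollary3p1 (k : fieldType) (n d : nat)
    (R : tensor_algebra k n -> Prop)
    (A : connected_algebra k) (pi : {lrmorphism tensor_algebra k n -> A})
    (hA : presents R pi)
    (hKoszul : Koszul A) (hAS : AS_regular A d)
    (Ae : enveloping_algebra A) (mu : graded_auto A)
    (hmu : is_Nakayama Ae d mu)
    (sbar : graded_auto A)
    (sigma : {linear tensor_algebra k n -> tensor_algebra k n})
    (hsigma : forall v, tpow 1 v ->
       tpow 1 (sigma v) /\ pi (sigma v) = sbar (pi v))
    (dbar : {linear A -> A}) (hdbar : degree_one_derivation sbar dbar)
    (B : algType k) (iota : {lrmorphism A -> B}) (z : B)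
    (hB : Ore_extension sbar dbar iota z)
    (omega : tensor_algebra k n)
    (homega : [/\ W R d omega, omega <> 0
       & forall x, W R d x -> exists c : k, x = c *: omega])
    (dr dl dr' dl' : nat -> {linear tensor_algebra k n -> tensor_algebra k n})
    (hpair : sequence_pair R pi dbar sigma iota dr dl)
    (hpair' : sequence_pair R pi dbar sigma iota dr' dl')
    (er el er' el' : tensor_algebra k n)
    (her : tpow 1 er /\ dr d omega = omega * er)
    (hel : tpow 1 el /\ dl d omega = el * omega)
    (her' : tpow 1 er' /\ dr' d omega = omega * er')
    (hel' : tpow 1 el' /\ dl' d omega = el' * omega) :
  pi er + mu (gau_inv sbar (pi el)) = pi er' + mu (gau_inv sbar (pi el')).
Proof.
have [sR hR _ _ _] := hA.
have H := tensor_algebra_theory k n.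
have [hom om0 hline] := homega.
case: d hAS hmu homega her hel her' hel' hom hline => [|d'] hAS' hmu' _ [er1 er2] [el1 el2] [er1' er2'] [el1' el2'] hom hline.
  (* In dimension 0, omega is a non-zero scalar on which [dr 0] and [dl 0] vanish, so all four
     elements of V are zero. *)
  have [c ec] : exists c : k, omega = c%:A by have /tpow0P -> := hom; eexists.
  have c0 : c != 0 by apply/eqP => c0; apply: om0; rewrite ec c0 scale0r.
  have dz (f : {linear tensor_algebra k n -> tensor_algebra k n}) (x : tensor_algebra k n) :
      f omega = 0 -> f omega = omega * x -> x = 0.
    move=> -> /esym/eqP; rewrite ec -TZAl T1mul scaler_eq0 (negPf c0) /= => /eqP.
    by [].
  have dz' (f : {linear tensor_algebra k n -> tensor_algebra k n}) (x : tensor_algebra k n) :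
      f omega = 0 -> f omega = x * omega -> x = 0.
    move=> -> /esym/eqP; rewrite ec -TZAr Tmul1 scaler_eq0 (negPf c0) /= => /eqP.
    by [].
  have [_ [_ [_ z0] _ _ _]] := hpair; have [_ [_ [_ z0'] _ _ _]] := hpair'.
  have [z1 z2] := z0 _ hom; have [z1' z2'] := z0' _ hom.
  by rewrite (dz _ _ z1 er2) (dz' _ _ z2 el2) (dz _ _ z1' er2') (dz' _ _ z2' el2').
have hP := presentation_pi hA.
have [tau ltau htau] := tens2_map pi (et_linr Ae) (et_linl Ae).
have [delta hd hp] := gpair_of_sequence_pair hA hsigma hB hpair.
have [delta' hd' hp'] := gpair_of_sequence_pair hA hsigma hB hpair'.
apply: (pair_invariance H sR hR hP ltau htau hKoszul hAS' hmu' (linearP sigma) hsigma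
  (@tpowmap_linear k n sigma) _ hp hp' _ hom om0 hline er1 el1 er1' el1' er2 el2 er2' el2').
- exact: tpowmap_tpow hsigma.
- by move=> v hv; rewrite (hd v hv).2 (hd' v hv).2.
Qed.
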